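(* Let $(\mathfrak{B},\mathfrak{A},\mathfrak{C},I,0)$ be a well-posed boundary node on the Hilbert spaces $(U_b,U,X,U)$ with $U_b=U$, and assume that $$\mathrm{Re}\,\langle\mathfrak{A}x,x\rangle_X\le\mathrm{Re}\,\langle\mathfrak{B}x,\mathfrak{C}x\rangle_U,\qquad x\in D(\mathfrak{A}).$$ Let $\mathfrak{K}=-K\mathfrak{C}$ with $K\in\mathcal{L}(U)$, let $L\in\mathcal{L}(U)$, and let $L_i=0$, where $\mathrm{Re}\,K\ge c_1I$ and $-\mathrm{Re}\,L\ge c_2I$ for some $c_1,c_2>0$. Then $(\mathfrak{B}_e,\mathfrak{A}_e,\mathfrak{C}_e,Q_e,B_{ei})$ is a well-posed boundary node on $(U_{be},U_e,X_e,Y_e)$, and $A_K$ and $A_L$ generate strongly continuous semigroups $T_K$ and $T_L$, respectively. If $T_K$ and $T_L$ are polynomially stable with exponents $\alpha_K>0$ and $\alpha_L>0$, respectively, then the semigroup $T_e$ generated by $A_e=\mathfrak{A}_e|_{\mathrm{Ker}(\mathfrak{B}_e)}$ is polynomially stable with exponent $\alpha=\min\{\alpha_K,\alpha_L\}$.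
   Context: Notation. $\mathcal{L}(X,Y)$ denotes the bounded linear operators, $\mathcal{L}(X)=\mathcal{L}(X,X)$. For $T\in\mathcal{L}(X)$ on a Hilbert space, $\mathrm{Re}\,T=\frac12(T+T^* )$, and $T\ge cI$ means $T-cI\ge0$. Boundary node. A tuple $(\mathfrak{B},\mathfrak{A},\mathfrak{C},Q,B_i)$ is a boundary node on the Hilbert spaces $(U_b,U,X,Y)$ if: (i) $\mathfrak{A}:D(\mathfrak{A})\subset X\to X$ is linear, $\mathfrak{B}\in\mathcal{L}(D(\mathfrak{A}),U_b)$, $\mathfrak{C}\in\mathcal{L}(D(\mathfrak{A}),Y)$, $Q\in\mathcal{L}(U,U_b)$, $B_i\in\mathcal{L}(U,X)$; (ii) the restriction $A=\mathfrak{A}|_{\mathrm{Ker}(\mathfrak{B})}$ with domain $D(A)=\mathrm{Ker}(\mathfrak{B})$ generates a strongly continuous semigroup on $X$; (iii) there is $\mathfrak{B}^r\in\mathcal{L}(U_b,D(\mathfrak{A}))$ with $\mathfrak{B}\mathfrak{B}^r=I$. Here $D(\mathfrak{A})$ carries a Hilbert space norm for which the embedding $D(\mathfrak{A})\hookrightarrow X$ and $\mathfrak{A}:D(\mathfrak{A})\to X$ are bounded (such as the graph norm of $\mathfrak{A}$); for other nodes built on the same domain (or products of it) the same norm (or product norm) is used. Well-posedness. For $x_0\in D(\mathfrak{A})$ and $u\in C^2([0,\tau];U)$ with $\mathfrak{B}x_0=Qu(0)$ the system $\dot x=\mathfrak{A}x+B_iu$, $x(0)=x_0$, $\mathfrak{B}x=Qu$,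 $y=\mathfrak{C}x$ has a unique classical solution on $[0,\tau]$ ($x\in C^1$, $x(t)\in D(\mathfrak{A})$, $y$ continuous, equations hold pointwise). The boundary node is well-posed if there exist $\tau,M_\tau>0$ such that for all such $x_0,u$: $\|x(\tau)\|^2+\int_0^\tau\|y(t)\|^2dt\le M_\tau(\|x_0\|^2+\int_0^\tau\|u(t)\|^2dt)$. Stability. A strongly continuous semigroup $T$ with generator $A$ is polynomially stable with exponent $\alpha>0$ if $T$ is bounded and there exist $M,t_0>0$ such that $\|T(t)x\|\le Mt^{-\alpha}(\|Ax\|+\|x\|)$ for all $t\ge t_0$, $x\in D(A)$. Closed-loop operators. In general, for a boundary node $(\mathfrak{B},\mathfrak{A},\mathfrak{C},Q,B_i)$ on $(U_b,U,X,Y)$ and $\mathfrak{K}\in\mathcal{L}(D(\mathfrak{A}),U)$, $L\in\mathcal{L}(Y,U_b)$, $L_i\in\mathcal{L}(Y,X)$, let $X_e=X\times X$, $U_e=U\times Y$, $Y_e=Y\times Y\times U$, $U_{be}=U_b\times U_b$, $D(\mathfrak{A}_e)=D(\mathfrak{A})\times D(\mathfrak{A})$ and $$\mathfrak{A}_e=\begin{bmatrix}\mathfrak{A}&B_i\mathfrak{K}\\ -L_i\mathfrak{C}&\mathfrak{A}+B_i\mathfrak{K}+L_i\mathfrak{C}\end{bmatrix},\quad \mathfrak{B}_e=\begin{bmatrix}\mathfrak{B}&-Q\mathfrak{K}\\ L\mathfrak{C}&\mathfrak{B}-Q\mathfrak{K}-L\mathfrak{C}\end{bmatrix},$$ $$B_{ei}=\begin{bmatrix}B_i&0\\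 B_i&L_i\end{bmatrix},\quad Q_e=\begin{bmatrix}Q&0\\ Q&L\end{bmatrix},\quad \mathfrak{C}_e=\begin{bmatrix}\mathfrak{C}&0\\ 0&\mathfrak{C}\\ 0&\mathfrak{K}\end{bmatrix},$$ $A_K=(\mathfrak{A}+B_i\mathfrak{K})|_{\mathrm{Ker}(\mathfrak{B}-Q\mathfrak{K})}$, $A_L=(\mathfrak{A}+L_i\mathfrak{C})|_{\mathrm{Ker}(\mathfrak{B}-L\mathfrak{C})}$. In the present statement $Y=U=U_b$, $Q=I$, $B_i=0$, $L_i=0$, $\mathfrak{K}=-K\mathfrak{C}$, so that $\mathfrak{A}_e=\mathrm{diag}(\mathfrak{A},\mathfrak{A})$, $\mathfrak{B}_e=\begin{bmatrix}\mathfrak{B}&K\mathfrak{C}\\ L\mathfrak{C}&\mathfrak{B}+K\mathfrak{C}-L\mathfrak{C}\end{bmatrix}$, $B_{ei}=0$, $Q_e=\begin{bmatrix}I&0\\ I&L\end{bmatrix}$, $A_K=\mathfrak{A}|_{\mathrm{Ker}(\mathfrak{B}+K\mathfrak{C})}$ and $A_L=\mathfrak{A}|_{\mathrm{Ker}(\mathfrak{B}-L\mathfrak{C})}$. *)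

(* Defs.v *)
From Stdlib Require Import Reals.
From Coquelicot Require Import Coquelicot.

Set Implicit Arguments.
Unset Strict Implicit.
Unset Printing Implicit Defensive.

Open Scope R_scope.

(* Complex Hilbert spaces: Coquelicot's complex Banach spaces whose norm comes
   from an inner product, linear in its first argument.  Bounded linear
   operators are Coquelicot's [is_linear], which includes boundedness. *)
Record Hilbert := MkHilbert {
  Hspace :> CompleteNormedModule C_AbsRing;
  inner : Hspace -> Hspace -> C;
  inner_plus_l : forall x y z : Hspace,
    inner (plus x y) z = Cplus (inner x z) (inner y z);
  inner_scal_l : forall (a : C) (x y : Hspace),
    inner (scal a x) y = Cmult a (inner x y);
  inner_conj : forall x y : Hspace, inner y x = Cconj (inner x y);
  inner_norm : forall x : Hspace, inner x x = RtoC (norm x ^ 2)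
}.

Section ProductHilbert.

Variables H1 H2 : Hilbert.

Definition prod_lim (F : (H1 * H2 -> Prop) -> Prop) : H1 * H2 :=
  (lim (filtermap fst F), lim (filtermap snd F)).

Lemma prod_complete_cauchy (F : (H1 * H2 -> Prop) -> Prop) :
  ProperFilter F -> cauchy F ->
  forall eps : posreal, F (ball (prod_lim F) eps).
Proof.
intros FF cF eps.
assert (c1 : cauchy (filtermap fst F)).
{ intros e. destruct (cF e) as [x Hx]. exists (fst x).
  change (F (fun z => ball (fst x) e (fst z))).
  apply (filter_imp (ball x e)); [intros z Hz; apply Hz | exact Hx]. }
assert (c2 : cauchy (filtermap snd F)).
{ intros e. destruct (cF e) as [x Hx]. exists (snd x).
  change (F (fun z => ball (snd x) e (snd z))).
  apply (filter_imp (ball x e)); [intros z Hz; apply Hz | exact Hx]. }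
pose proof (complete_cauchy (filtermap fst F)
  (@filtermap_proper_filter _ _ _ F FF) c1 eps) as L1.
pose proof (complete_cauchy (filtermap snd F)
  (@filtermap_proper_filter _ _ _ F FF) c2 eps) as L2.
unfold filtermap in L1, L2.
exact (filter_and _ _ L1 L2).
Qed.

Lemma prod_complete_close (F1 F2 : (H1 * H2 -> Prop) -> Prop) :
  filter_le F1 F2 -> filter_le F2 F1 -> close (prod_lim F1) (prod_lim F2).
Proof.
intros h12 h21 eps; split.
- apply (close_lim (filtermap fst F1) (filtermap fst F2));
  intros P HP; [apply h12 | apply h21]; exact HP.
- apply (close_lim (filtermap snd F1) (filtermap snd F2));
  intros P HP; [apply h12 | apply h21]; exact HP.
Qed.

Definition prod_CompleteNormedModule : CompleteNormedModule C_AbsRing :=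
  CompleteNormedModule.Pack C_AbsRing (H1 * H2)
    (CompleteNormedModule.Class C_AbsRing (H1 * H2)
       (NormedModule.class C_AbsRing (prod_NormedModule C_AbsRing H1 H2))
       (CompleteSpace.Mixin (prod_UniformSpace H1 H2) prod_lim
          prod_complete_cauchy prod_complete_close))
    (H1 * H2).

Definition prod_inner (x y : H1 * H2) : C :=
  Cplus (inner (fst x) (fst y)) (inner (snd x) (snd y)).

Lemma prod_inner_plus_l (x y z : prod_CompleteNormedModule) :
  prod_inner (plus x y) z = Cplus (prod_inner x z) (prod_inner y z).
Proof.
unfold prod_inner. cbn -[Cplus plus inner].
destruct x as [x1 x2], y as [y1 y2]; cbn -[Cplus plus inner].
change (plus (x1, x2) (y1, y2)) with (plus x1 y1, plus x2 y2).
cbn -[Cplus plus inner]. rewrite !inner_plus_l. ring.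
Qed.

Lemma prod_inner_scal_l (a : C) (x y : prod_CompleteNormedModule) :
  prod_inner (scal a x) y = Cmult a (prod_inner x y).
Proof.
destruct x as [x1 x2]. unfold prod_inner.
change (scal a ((x1, x2) : prod_CompleteNormedModule))
  with (scal a x1, scal a x2).
cbn -[Cplus Cmult scal inner]. rewrite !inner_scal_l. ring.
Qed.

Lemma prod_inner_conj (x y : prod_CompleteNormedModule) :
  prod_inner y x = Cconj (prod_inner x y).
Proof.
unfold prod_inner.
rewrite (inner_conj (fst x)), (inner_conj (snd x)).
unfold Cconj, Cplus; cbn -[inner]. f_equal. ring.
Qed.

(* The norm of [prod_NormedModule] is the Euclidean one. *)
Lemma prod_inner_norm (x : prod_CompleteNormedModule) :
  prod_inner x x = RtoC (norm x ^ 2).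
Proof.
unfold prod_inner. rewrite !inner_norm, <- RtoC_plus. f_equal.
change (norm x) with (sqrt (norm (fst x) ^ 2 + norm (snd x) ^ 2)).
rewrite pow2_sqrt; [reflexivity|].
apply Rplus_le_le_0_compat; apply pow2_ge_0.
Qed.

Definition prod_Hilbert : Hilbert :=
  MkHilbert prod_inner_plus_l prod_inner_scal_l
    prod_inner_conj prod_inner_norm.

End ProductHilbert.

Definition is_adjoint (H1 H2 : Hilbert) (T : H1 -> H2) (S : H2 -> H1) : Prop :=
  is_linear S /\ forall x y, inner (T x) y = inner x (S y).

Definition is_Re_op (H : Hilbert) (T ReT : H -> H) : Prop :=
  exists S : H -> H, is_adjoint T S /\
    forall x, ReT x = scal (RtoC (/ 2)) (plus (T x) (S x)).

Definition op_nonneg (H : Hilbert) (T : H -> H) : Prop :=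
  forall x, Im (inner (T x) x) = 0 /\ 0 <= Re (inner (T x) x).

Definition op_ge (H : Hilbert) (T : H -> H) (c : R) : Prop :=
  op_nonneg (fun x => minus (T x) (scal (RtoC c) x)).

(* Only the values [T t] with [0 <= t] are meaningful. *)
Definition C0_semigroup (X : Hilbert) (T : R -> X -> X) : Prop :=
  (forall t, 0 <= t -> is_linear (T t)) /\
  (forall x, T 0 x = x) /\
  (forall s t, 0 <= s -> 0 <= t -> forall x, T (s + t) x = T s (T t x)) /\
  (forall x, filterlim (fun t => T t x) (at_right 0) (locally x)).

(* An unbounded operator on [X] is given by its graph. *)
Definition generates (X : Hilbert) (G : X -> X -> Prop) (T : R -> X -> X)
    : Prop :=
  C0_semigroup T /\
  forall x y, G x y <->
    filterlim (fun h => scal (RtoC (/ h)) (minus (T h x) x))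
      (at_right 0) (locally y).

Definition polynomially_stable (X : Hilbert) (G : X -> X -> Prop)
    (T : R -> X -> X) (alpha : R) : Prop :=
  0 < alpha /\
  (exists M, forall t, 0 <= t -> forall x, norm (T t x) <= M * norm x) /\
  exists M t0, 0 < M /\ 0 < t0 /\
    forall t, t0 <= t -> forall x y, G x y ->
      norm (T t x) <= M * Rpower t (- alpha) * (norm y + norm x).

(* The tuple [(B, A, C, Q, Bi)].  The domain of [A] is the Hilbert space [D]
   with its own norm; [emb] is its inclusion into [X]. *)
Record node (Ub U X Y D : Hilbert) := MkNode {
  emb : D -> X;
  nodeB : D -> Ub;
  nodeA : D -> X;
  nodeC : D -> Y;
  nodeQ : U -> Ub;
  nodeBi : U -> X
}.

(* The graph of the operator [A] (on [X], with domain [emb D]) restricted to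
   the kernel of [B]. *)
Definition restr_ker (X D V : Hilbert) (i A : D -> X) (B : D -> V)
    (x y : X) : Prop :=
  exists d : D, B d = zero /\ x = i d /\ y = A d.

Definition op_A (Ub U X Y D : Hilbert) (N : node Ub U X Y D)
    : X -> X -> Prop :=
  restr_ker (emb N) (nodeA N) (nodeB N).

Definition boundary_node (Ub U X Y D : Hilbert) (N : node Ub U X Y D) : Prop :=
  is_linear (emb N) /\ (forall d1 d2, emb N d1 = emb N d2 -> d1 = d2) /\
  is_linear (nodeB N) /\ is_linear (nodeA N) /\ is_linear (nodeC N) /\
  is_linear (nodeQ N) /\ is_linear (nodeBi N) /\
  (exists T, generates (op_A N) T) /\
  exists Br : Ub -> D, is_linear Br /\ forall v, nodeB N (Br v) = v.

Definition interval (tau t : R) : Prop := 0 <= t <= tau.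

(* [f'] is the derivative of [f] on [[0, tau]], one-sided at the end points. *)
Definition is_derive_on (V : Hilbert) (tau : R) (f f' : R -> V) : Prop :=
  forall t, interval tau t ->
    filterlim (fun s => scal (RtoC (/ (s - t))) (minus (f s) (f t)))
      (within (interval tau) (locally' t)) (locally (f' t)).

Definition C2_on (V : Hilbert) (tau : R) (f : R -> V) : Prop :=
  exists f' f'' : R -> V, is_derive_on tau f f' /\ is_derive_on tau f' f'' /\
    continuous_on (interval tau) f''.

(* The state trajectory is [fun t => emb N (z t)]. *)
Definition classical_solution (Ub U X Y D : Hilbert) (N : node Ub U X Y D)
    (tau : R) (x0 : D) (u : R -> U) (z : R -> D) (y : R -> Y) : Prop :=
  (exists x' : R -> X, is_derive_on tau (fun t => emb N (z t)) x' /\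
     continuous_on (interval tau) x' /\
     forall t, interval tau t ->
       x' t = plus (nodeA N (z t)) (nodeBi N (u t))) /\
  z 0 = x0 /\
  (forall t, interval tau t -> nodeB N (z t) = nodeQ N (u t)) /\
  (forall t, interval tau t -> y t = nodeC N (z t)) /\
  continuous_on (interval tau) y.

(* For a boundary node the classical solution exists and is unique for all
   such data, so quantifying over solutions is quantifying over the data. *)
Definition well_posed (Ub U X Y D : Hilbert) (N : node Ub U X Y D) : Prop :=
  exists tau M, 0 < tau /\ 0 < M /\
    forall (x0 : D) (u : R -> U),
      C2_on tau u -> nodeB N x0 = nodeQ N (u 0) ->
      forall (z : R -> D) (y : R -> Y), classical_solution N tau x0 u z y ->
        norm (emb N (z tau)) ^ 2 + RInt (fun t => norm (y t) ^ 2) 0 tau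
        <= M * (norm (emb N x0) ^ 2 + RInt (fun t => norm (u t) ^ 2) 0 tau).

(* The closed-loop node on [Ub * Ub], [U * Y], [X * X], [Y * Y * U], with
   domain [D * D]. *)
Definition closed_loop (Ub U X Y D : Hilbert) (N : node Ub U X Y D)
    (K : D -> U) (L : Y -> Ub) (Li : Y -> X) :
    node (prod_Hilbert Ub Ub) (prod_Hilbert U Y) (prod_Hilbert X X)
      (prod_Hilbert (prod_Hilbert Y Y) U) (prod_Hilbert D D) :=
  let A := nodeA N in let B := nodeB N in let C := nodeC N in
  let Q := nodeQ N in let Bi := nodeBi N in
  @MkNode (prod_Hilbert Ub Ub) (prod_Hilbert U Y) (prod_Hilbert X X)
      (prod_Hilbert (prod_Hilbert Y Y) U) (prod_Hilbert D D)
    (fun d : D * D => (emb N (fst d), emb N (snd d)))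
    (fun d : D * D =>
       (minus (B (fst d)) (Q (K (snd d))),
        plus (L (C (fst d)))
          (minus (minus (B (snd d)) (Q (K (snd d)))) (L (C (snd d))))))
    (fun d : D * D =>
       (plus (A (fst d)) (Bi (K (snd d))),
        plus (opp (Li (C (fst d))))
          (plus (plus (A (snd d)) (Bi (K (snd d)))) (Li (C (snd d))))))
    (fun d : D * D => ((C (fst d), C (snd d)), K (snd d)))
    (fun w : U * Y => (Q (fst w), plus (Q (fst w)) (L (snd w))))
    (fun w : U * Y => (Bi (fst w), plus (Bi (fst w)) (Li (snd w)))).

Definition op_AK (Ub U X Y D : Hilbert) (N : node Ub U X Y D) (K : D -> U)
    : X -> X -> Prop :=
  restr_ker (emb N) (fun d => plus (nodeA N d) (nodeBi N (K d)))
    (fun d => minus (nodeB N d) (nodeQ N (K d))).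

Definition op_AL (Ub U X Y D : Hilbert) (N : node Ub U X Y D)
    (L : Y -> Ub) (Li : Y -> X) : X -> X -> Prop :=
  restr_ker (emb N) (fun d => plus (nodeA N d) (Li (nodeC N d)))
    (fun d => minus (nodeB N d) (L (nodeC N d))).

(* Main.v *)
Require Import Defs.
From Stdlib Require Import Reals Lra Lia ClassicalEpsilon FunctionalExtensionality.
From Coquelicot Require Import Coquelicot.

Open Scope R_scope.

(** With [e = x1 - x2] the closed loop is the cascade
      [B e - L C e = - L w],  [B x1 + K C x1 = u + K C e],
    each stage being the passive node under strictly dissipative feedback.
    Completing squares, [d/dt (|x1|^2 + k |e|^2)] is at most
    [- a (|C x1|^2 + |C e|^2) + b (|u|^2 + |w|^2)] for suitable constants; this
    yields well-posedness, and dissipativity in an equivalent inner product.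
    The generators are obtained from Lumer-Phillips; their range condition
    follows from that of the given generator, because the transfer function of
    a passive node is monotone and [K^-1] plus it is strongly monotone.

    For the decay, [e(t) = T_L(t) e(0)] is [O(t^-alpha_L)].  The output [C e] need
    not decay pointwise at this rate, but [d/dt |e|^2 <= - 2 c2 |C e|^2], so some
    [r] in [[t/2, t/2 + 1]] has [|C e(r)| = O(t^-alpha_L)].  There [x1(r)] is an
    element of [D(A_K)], controlled in graph norm, plus a boundary correction of
    size [O(|C e(r)|)].  On [[r, t]] the first part decays by [T_K], and the energy
    inequality bounds the remainder by [|e(r)|]. *)

(** * Real inner product and sequences *)

(** The decay assumption on [T_K] concerns data in its domain, while [x1] obeys an inhomogeneous
    boundary condition at all times. Variation of constants would need decay of [C e], hence of
    [A e], and data in the domain only yield decay of the state [e]. Freezing the input at one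
    well-chosen time avoids this. The boundary correction is taken in the kernel of [l - A], where
    the graph norm is a multiple of the state norm, so that a bound in [X] by [|C e(r)|] is also a
    bound in graph norm. Splitting the time interval near [t/2] costs only the factors [2^alpha_L]
    and [4^alpha_K], which is why no exponent is lost beyond the minimum. The weight [k] is there
    because the coupling [K C e] has no sign: it can only be absorbed by the dissipation of the
    error stage, so the closed loop need not be dissipative in the product norm itself. In the range
    condition the inverse of the gain appears because a composite of monotone maps need not be
    monotone, while a sum is. *)

Definition dot (H : Hilbert) (x y : H) : R := Re (inner x y).
Arguments dot {H} x y.

Lemma dot_plus_l (H : Hilbert) (x y z : H) :
  dot (plus x y) z = dot x z + dot y z.
Proof. unfold dot. rewrite inner_plus_l. reflexivity. Qed.

Lemma dot_sym (H : Hilbert) (x y : H) : dot x y = dot y x.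
Proof. unfold dot. rewrite (inner_conj x y). reflexivity. Qed.

Lemma dot_plus_r (H : Hilbert) (x y z : H) :
  dot z (plus x y) = dot z x + dot z y.
Proof. rewrite !(dot_sym _ z). apply dot_plus_l. Qed.

Lemma dot_scal_l (H : Hilbert) (r : R) (x y : H) :
  dot (scal (RtoC r) x) y = r * dot x y.
Proof. unfold dot. rewrite inner_scal_l. unfold Re; simpl. ring. Qed.

Lemma dot_scal_r (H : Hilbert) (r : R) (x y : H) :
  dot y (scal (RtoC r) x) = r * dot y x.
Proof. rewrite !(dot_sym _ y). apply dot_scal_l. Qed.

Lemma inner_zero_l (H : Hilbert) (y : H) : inner zero y = RtoC 0.
Proof.
replace (@zero H) with (scal (RtoC 0) (@zero H)) by exact (@scal_zero_r C_Ring H (RtoC 0)).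
rewrite inner_scal_l. apply Cmult_0_l.
Qed.

Lemma inner_opp_l (H : Hilbert) (x y : H) : inner (opp x) y = Copp (inner x y).
Proof.
replace (opp x) with (scal (opp one) x) by exact (@scal_opp_one C_Ring H x).
rewrite inner_scal_l. change (opp one : C) with (Copp (RtoC 1)). ring.
Qed.

Lemma inner_minus_l (H : Hilbert) (x y z : H) :
  inner (minus x y) z = Cminus (inner x z) (inner y z).
Proof. unfold minus. rewrite inner_plus_l, inner_opp_l. reflexivity. Qed.

Lemma dot_zero_l (H : Hilbert) (y : H) : dot zero y = 0.
Proof. unfold dot. rewrite inner_zero_l. reflexivity. Qed.

Lemma dot_zero_r (H : Hilbert) (y : H) : dot y zero = 0.
Proof. rewrite dot_sym. apply dot_zero_l. Qed.

Lemma dot_opp_l (H : Hilbert) (x y : H) : dot (opp x) y = - dot x y.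
Proof. unfold dot. rewrite inner_opp_l. reflexivity. Qed.

Lemma dot_opp_r (H : Hilbert) (x y : H) : dot y (opp x) = - dot y x.
Proof. rewrite !(dot_sym _ y). apply dot_opp_l. Qed.

Lemma dot_minus_l (H : Hilbert) (x y z : H) :
  dot (minus x y) z = dot x z - dot y z.
Proof. unfold minus. rewrite dot_plus_l, dot_opp_l. reflexivity. Qed.

Lemma dot_minus_r (H : Hilbert) (x y z : H) :
  dot z (minus x y) = dot z x - dot z y.
Proof. rewrite !(dot_sym _ z). apply dot_minus_l. Qed.

Lemma normsq (H : Hilbert) (x : H) : norm x ^ 2 = dot x x.
Proof. unfold dot. rewrite inner_norm. reflexivity. Qed.

Lemma norm_pos (H : Hilbert) (x : H) : 0 <= norm x.
Proof. exact (@norm_ge_0 C_AbsRing H x). Qed.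

Lemma hnorm_eq0 (H : Hilbert) (x : H) : norm x = 0 -> x = zero.
Proof. exact (@norm_eq_zero C_AbsRing H x). Qed.

Lemma hnorm0 (H : Hilbert) : norm (@zero H) = 0.
Proof. exact (@norm_zero C_AbsRing H). Qed.

Lemma hnorm_opp (H : Hilbert) (x : H) : norm (opp x) = norm x.
Proof. exact (@norm_opp C_AbsRing H x). Qed.

Lemma hnorm_plus (H : Hilbert) (x y : H) : norm (plus x y) <= norm x + norm y.
Proof. exact (@norm_triangle C_AbsRing H x y). Qed.

Lemma dot_eq0 (H : Hilbert) (x : H) : dot x x <= 0 -> x = zero.
Proof.
intros h. apply hnorm_eq0. rewrite <- normsq in h.
pose proof (norm_pos H x). nra.
Qed.

Lemma dot_ext (H : Hilbert) (x y : H) :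
  (forall z, dot x z = dot y z) -> x = y.
Proof.
intros h. assert (e : minus x y = zero).
{ apply dot_eq0. rewrite dot_minus_l, h. lra. }
exact (@plus_reg_r H (opp y) x y (eq_trans e (eq_sym (plus_opp_r y)))).
Qed.

Lemma inner_ext (H : Hilbert) (x y : H) :
  (forall z, inner x z = inner y z) -> x = y.
Proof. intros h. apply dot_ext. intros z. unfold dot. now rewrite h. Qed.

Ltac dots := repeat (progress (rewrite ?dot_plus_l, ?dot_plus_r, ?dot_minus_l,
  ?dot_minus_r, ?dot_opp_l, ?dot_opp_r, ?dot_scal_l, ?dot_scal_r, ?dot_zero_l,
  ?dot_zero_r)).
Ltac dots_in h := repeat first [rewrite dot_plus_l in h|rewrite dot_plus_r in h|
  rewrite dot_minus_l in h|rewrite dot_minus_r in h|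
  rewrite dot_opp_l in h|rewrite dot_opp_r in h|
  rewrite dot_scal_l in h|rewrite dot_scal_r in h|
  rewrite dot_zero_l in h|rewrite dot_zero_r in h].
(** Vector identities with real coefficients become scalar ones after pairing both sides with an
    arbitrary vector. [cvec] does the same with the complex inner product, for complex
    coefficients. *)
Ltac vec := apply dot_ext; let z := fresh "z" in intros z;
  dots; try ring.
Ltac cvec := apply inner_ext; let z := fresh "z" in intros z;
  repeat (progress rewrite ?inner_plus_l, ?inner_minus_l, ?inner_opp_l,
    ?inner_scal_l, ?inner_zero_l); try ring.

Lemma cauchy_schwarz_sq (H : Hilbert) (x y : H) :
  dot x y ^ 2 <= dot x x * dot y y.
Proof.
pose proof (norm_pos H y) as hy.
assert (q : forall s, 0 <= dot x x - 2 * s * dot x y + s ^ 2 * dot y y).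
{ intros s. replace (_ + _) with
   (norm (minus x (scal (RtoC s) y)) ^ 2); [nra|].
  rewrite normsq. dots. rewrite (dot_sym _ y x). ring. }
destruct (Req_dec (dot y y) 0) as [e|e].
- assert (y = zero) by (apply dot_eq0; lra). subst. rewrite !dot_zero_r. lra.
- assert (0 < dot y y). { pose proof (normsq _ y). nra. }
  specialize (q (dot x y / dot y y)).
  replace (_ + _) with (dot x x - dot x y ^ 2 / dot y y) in q by (field; lra).
  apply Rmult_le_reg_r with (/ dot y y). now apply Rinv_0_lt_compat.
  replace (dot x x * dot y y * / dot y y) with (dot x x) by (field; lra).
  unfold Rdiv in q. lra.
Qed.

Lemma dot_le (H : Hilbert) (x y : H) : dot x y <= norm x * norm y.
Proof.
pose proof (cauchy_schwarz_sq _ x y) as h. rewrite <- !normsq in h.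
pose proof (norm_pos _ x). pose proof (norm_pos _ y).
pose proof (Rmult_le_pos _ _ H0 H1). nra.
Qed.

Lemma dot_abs (H : Hilbert) (x y : H) : Rabs (dot x y) <= norm x * norm y.
Proof.
apply Rabs_le. split; [|apply dot_le].
pose proof (dot_le _ (opp x) y) as h. rewrite dot_opp_l in h.
rewrite hnorm_opp in h. lra.
Qed.

Lemma norm_le_of_sq (H : Hilbert) (x : H) (c : R) :
  0 <= c -> dot x x <= c ^ 2 -> norm x <= c.
Proof. intros h0 h. rewrite <- normsq in h. pose proof (norm_pos _ x). nra. Qed.

Lemma norm_scalR (H : Hilbert) (r : R) (x : H) :
  norm (scal (RtoC r) x) = Rabs r * norm x.
Proof.
apply Rsqr_inj; [apply norm_pos|apply Rmult_le_pos; [apply Rabs_pos|apply norm_pos]|].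
rewrite !Rsqr_pow2, normsq, Rpow_mult_distr, normsq, pow2_abs. dots. ring.
Qed.

Lemma norm_minus_sym (H : Hilbert) (x y : H) : norm (minus x y) = norm (minus y x).
Proof. rewrite <- hnorm_opp. f_equal. vec. Qed.

Lemma norm_tri_mid (H : Hilbert) (m x y : H) :
  norm (minus x y) <= norm (minus x m) + norm (minus m y).
Proof.
replace (minus x y) with (plus (minus x m) (minus m y)) by vec.
apply hnorm_plus.
Qed.

Lemma norm_tri_mid' (H : Hilbert) (m x y : H) :
  norm (minus x y) <= norm (minus m x) + norm (minus m y).
Proof. rewrite (norm_minus_sym _ m x). apply norm_tri_mid. Qed.

Lemma norm_le_mid (H : Hilbert) (m x : H) :
  norm x <= norm (minus x m) + norm m.
Proof.
replace (norm x) with (norm (plus (minus x m) m)) by (f_equal; vec).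
apply hnorm_plus.
Qed.

Lemma norm_minus_le (H : Hilbert) (x y : H) :
  norm (minus x y) <= norm x + norm y.
Proof. unfold minus. rewrite <- (hnorm_opp _ y). apply hnorm_plus. Qed.

Lemma minus_eq0 (H : Hilbert) (x y : H) : norm (minus x y) <= 0 -> x = y.
Proof.
intros h. assert (e : minus x y = zero).
{ apply hnorm_eq0. pose proof (norm_pos _ (minus x y)). lra. }
replace x with (plus (minus x y) y) by vec. rewrite e. vec.
Qed.

Definition nlim {T : Type} {H : Hilbert} (f : T -> H) (F : (T -> Prop) -> Prop)
  (l : H) : Prop := forall eps, 0 < eps -> F (fun s => norm (minus (f s) l) < eps).

(** Balls of the uniform structure and balls of the norm agree only up to [norm_factor]; this
    passage confines that factor to one place. *)
Lemma filterlim_nlim {T : Type} {H : Hilbert} (f : T -> H)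
  (F : (T -> Prop) -> Prop) {FF : Filter F} (l : H) :
  filterlim f F (locally l) <-> nlim f F l.
Proof.
split.
- intros h eps heps.
  pose proof (@norm_factor_gt_0 C_AbsRing H) as hf.
  assert (hp : 0 < eps / @norm_factor C_AbsRing H) by (apply Rdiv_lt_0_compat; assumption).
  pose proof (proj1 (filterlim_locally f l) h (mkposreal _ hp)) as h1.
  eapply filter_imp; [|exact h1]. intros s hs.
  apply (@norm_compat2 C_AbsRing H) in hs. simpl in hs.
  replace (@norm_factor C_AbsRing H * (eps / @norm_factor C_AbsRing H)) with eps in hs
    by (field; lra). exact hs.
- intros h. apply filterlim_locally. intros eps.
  eapply filter_imp; [|apply (h eps (cond_pos eps))].
  intros s hs. exact (@norm_compat1 C_AbsRing H _ _ _ hs).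
Qed.

Definition seqlim {H : Hilbert} (u : nat -> H) (l : H) : Prop :=
  forall eps, 0 < eps -> exists N, forall n, (N <= n)%nat -> norm (minus (u n) l) < eps.

Lemma cauchy_seqlim (H : Hilbert) (u : nat -> H) :
  (forall eps, 0 < eps -> exists N, forall n m, (N <= n)%nat -> (N <= m)%nat ->
     norm (minus (u n) (u m)) < eps) ->
  exists l, seqlim u l.
Proof.
intros h. exists (lim (filtermap u eventually)).
pose proof (@complete_cauchy H (filtermap u eventually) _) as hc.
assert (cau : cauchy (filtermap u eventually)).
{ intros eps. destruct (h eps (cond_pos eps)) as [N hN].
  exists (u N). exists N. intros n hn. apply (@norm_compat1 C_AbsRing H). apply hN; lia. }
specialize (hc cau).
assert (hl : filterlim u eventually (locally (lim (filtermap u eventually)))).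
{ apply filterlim_locally. exact hc. }
apply filterlim_nlim in hl; [|apply eventually_filter].
exact hl.
Qed.

Lemma seqlim_unique (H : Hilbert) (u : nat -> H) (l l' : H) :
  seqlim u l -> seqlim u l' -> l = l'.
Proof.
intros h h'. apply minus_eq0. apply le_epsilon. intros eps he.
destruct (h (eps / 2)) as [N hN]; [lra|].
destruct (h' (eps / 2)) as [N' hN']; [lra|].
specialize (hN (max N N') ltac:(lia)). specialize (hN' (max N N') ltac:(lia)).
pose proof (norm_tri_mid' _ (u (max N N')) l l'). lra.
Qed.

Lemma seqlim_norm_le (H : Hilbert) (u : nat -> H) (l a : H) (c : R) :
  seqlim u l -> (exists N, forall n, (N <= n)%nat -> norm (minus (u n) a) <= c) ->
  norm (minus l a) <= c.
Proof.
intros h [N hN]. apply le_epsilon. intros eps he.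
destruct (h eps he) as [N' hN'].
specialize (hN (max N N') ltac:(lia)). specialize (hN' (max N N') ltac:(lia)).
pose proof (norm_tri_mid' _ (u (max N N')) l a). lra.
Qed.

Lemma seqlim_ext (H : Hilbert) (u v : nat -> H) (l : H) :
  (forall n, u n = v n) -> seqlim u l -> seqlim v l.
Proof. intros e h eps he. destruct (h eps he) as [N hN]. exists N. intros n hn.
rewrite <- e. now apply hN. Qed.

Lemma seqlim_plus (H : Hilbert) (u v : nat -> H) (l m : H) :
  seqlim u l -> seqlim v m -> seqlim (fun n => plus (u n) (v n)) (plus l m).
Proof.
intros h h' eps he.
destruct (h (eps / 2)) as [N hN]; [lra|].
destruct (h' (eps / 2)) as [N' hN']; [lra|].
exists (max N N'). intros n hn.
specialize (hN n ltac:(lia)). specialize (hN' n ltac:(lia)).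
replace (minus (plus (u n) (v n)) (plus l m)) with
  (plus (minus (u n) l) (minus (v n) m)) by vec.
eapply Rle_lt_trans; [apply hnorm_plus|]. lra.
Qed.

Lemma seqlim_lip (H1 H2 : Hilbert) (f : H1 -> H2) (c : R) (u : nat -> H1) (l : H1) :
  (forall x y, norm (minus (f x) (f y)) <= c * norm (minus x y)) ->
  seqlim u l -> seqlim (fun n => f (u n)) (f l).
Proof.
intros hf h eps he.
assert (hc : 0 < Rabs c + 1) by (pose proof (Rabs_pos c); lra).
destruct (h (eps / (Rabs c + 1))) as [N hN]; [now apply Rdiv_lt_0_compat|].
exists N. intros n hn. specialize (hN n hn).
eapply Rle_lt_trans; [apply hf|].
apply Rle_lt_trans with ((Rabs c + 1) * norm (minus (u n) l)).
- pose proof (Rle_abs c). pose proof (norm_pos _ (minus (u n) l)). nra.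
- apply Rmult_lt_compat_l with (r := Rabs c + 1) in hN; [|assumption].
  replace ((Rabs c + 1) * (eps / (Rabs c + 1))) with eps in hN by (field; lra).
  exact hN.
Qed.

Lemma linear_bound (H1 H2 : Hilbert) (f : H1 -> H2) : is_linear f ->
  exists M, 0 < M /\ forall x, norm (f x) <= M * norm x.
Proof. intros h. destruct (linear_norm f h) as [M hM]. exists M. exact hM. Qed.

(** Besides convergence, the tail bound from every index matters: in the gliding hump it measures
    how far the later humps move the point. *)
Lemma geometric_seqlim (H : Hilbert) (u : nat -> H) (c q : R) :
  0 <= c -> 0 <= q < 1 ->
  (forall n, norm (minus (u (S n)) (u n)) <= c * q ^ n) ->
  exists l, seqlim u l /\
    forall n, norm (minus l (u n)) <= c * q ^ n / (1 - q).
Proof.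
intros hc hq hu.
assert (hd : forall n k, norm (minus (u (n + k)%nat) (u n))
   <= c * q ^ n / (1 - q)).
{ intros n k.
  assert (norm (minus (u (n + k)%nat) (u n)) <= c * q ^ n * (1 - q ^ k) / (1 - q)).
  { induction k as [|k IH].
    - rewrite Nat.add_0_r. replace (minus (u n) (u n)) with (@zero H) by vec.
      rewrite hnorm0. simpl. unfold Rdiv. rewrite Rminus_diag. lra.
    - eapply Rle_trans; [apply (norm_tri_mid _ (u (n + k)%nat))|].
      rewrite Nat.add_succ_r.
      pose proof (hu (n + k)%nat) as h1. rewrite pow_add in h1.
      replace (c * q ^ n * (1 - q ^ S k) / (1 - q)) with
       (c * (q ^ n * q ^ k) + c * q ^ n * (1 - q ^ k) / (1 - q))
       by (simpl; field; lra). lra. }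
  eapply Rle_trans; [exact H0|]. unfold Rdiv.
  apply Rmult_le_compat_r; [left; apply Rinv_0_lt_compat; lra|].
  pose proof (pow_le q n (proj1 hq)). pose proof (pow_le q k (proj1 hq)).
  pose proof (Rmult_le_pos _ _ hc H1). nra. }
assert (hq0 : forall eps, 0 < eps -> exists N, forall n, (N <= n)%nat ->
   c * q ^ n / (1 - q) < eps).
{ intros eps he.
  destruct (pow_lt_1_zero q) with (y := eps * (1 - q) / (c + 1)) as [N hN].
  - rewrite Rabs_pos_eq; lra.
  - apply Rdiv_lt_0_compat; [|lra]. apply Rmult_lt_0_compat; lra.
  - exists N. intros n hn. specialize (hN n hn).
    pose proof (pow_le q n (proj1 hq)) as hp.
    rewrite Rabs_pos_eq in hN by assumption.
    apply Rmult_lt_reg_r with (1 - q); [lra|].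
    unfold Rdiv. rewrite Rmult_assoc, Rinv_l, Rmult_1_r by lra.
    apply Rmult_lt_compat_r with (r := c + 1) in hN; [|lra].
    replace (eps * (1 - q) / (c + 1) * (c + 1)) with (eps * (1 - q)) in hN
      by (field; lra). nra. }
destruct (cauchy_seqlim _ u) as [l hl].
{ intros eps he. destruct (hq0 (eps / 2)) as [N hN]; [lra|].
  exists N. intros n m hn hm.
  pose proof (norm_tri_mid _ (u N) (u n) (u m)).
  pose proof (hd N (n - N)%nat). pose proof (hd N (m - N)%nat).
  replace (N + (n - N))%nat with n in H1 by lia.
  replace (N + (m - N))%nat with m in H2 by lia.
  rewrite (norm_minus_sym _ (u m)) in H2.
  specialize (hN N (le_n N)). lra. }
exists l. split; [exact hl|]. intros n.
apply seqlim_norm_le with u; [exact hl|].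
exists n. intros m hm. replace m with (n + (m - n))%nat by lia. apply hd.
Qed.

(* [minus (scal ..) ..] can be elaborated through different but convertible
   structures, so the term to rewrite is read off the goal. *)
Tactic Notation "norm_as" uconstr(b) "by" tactic(tac) :=
  match goal with |- context [@norm ?K ?V ?a] =>
    let E := fresh in
    assert (E : @norm K V a = @norm K V b)
      by (apply (f_equal (@norm K V)); vec; tac);
    rewrite E; clear E end.
Tactic Notation "norm_as" uconstr(b) := norm_as b by idtac.

Ltac test_eq z h := let e := fresh "e" in
  pose proof (f_equal (fun v => dot v z) h) as e; cbv beta in e; dots_in e.

(** * Monotone maps, uniform boundedness and bounded inverses *)

Lemma contraction_fixpoint (H : Hilbert) (g : H -> H) (q : R) :
  0 <= q < 1 -> (forall x y, norm (minus (g x) (g y)) <= q * norm (minus x y)) ->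
  exists x, g x = x.
Proof.
intros hq hg. set (u := fun n => Nat.iter n g (@zero H)).
destruct (geometric_seqlim _ u (norm (minus (u 1%nat) (u 0%nat))) q)
  as [l [hl _]]; [apply norm_pos|exact hq| |].
{ induction n as [|n IH].
  - simpl pow. lra.
  - change (u (S (S n))) with (g (u (S n))).
    change (norm (minus (g (u (S n))) (g (u n))) <=
      norm (minus (u 1%nat) (u 0%nat)) * (q * q ^ n)).
    eapply Rle_trans; [apply hg|]. nra. }
exists l. apply seqlim_unique with (fun n => g (u n)).
- exact (seqlim_lip _ _ g q u l hg hl).
- intros eps he. destruct (hl eps he) as [N hN]. exists N. intros n hn.
  apply (hN (S n)). lia.
Qed.

(** For small [rho] the map [x - rho F x] is a strict contraction. With [l] dominating both [c] and
    [k], the choice [rho = c / l^2] gives the squared ratio [1 - (c/l)^2]. [F] need not be linear,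
    so it can absorb an inhomogeneous term. *)
Lemma strongly_monotone_zero (H : Hilbert) (F : H -> H) (c k : R) :
  0 < c -> (forall x y, norm (minus (F x) (F y)) <= k * norm (minus x y)) ->
  (forall x y, c * norm (minus x y) ^ 2 <= dot (minus (F x) (F y)) (minus x y)) ->
  exists x, F x = zero.
Proof.
intros hc hL hm. set (l := Rabs k + c).
assert (hl : c <= l) by (unfold l; pose proof (Rabs_pos k); lra).
assert (hkl : k <= l) by (unfold l; pose proof (Rle_abs k); lra).
set (rho := c / l ^ 2). set (q2 := 1 - (c / l) ^ 2).
assert (hcl : 0 < c / l <= 1).
{ split; [apply Rdiv_lt_0_compat; lra|].
  apply Rmult_le_reg_r with l; [lra|]. unfold Rdiv.
  rewrite Rmult_assoc, Rinv_l by lra. lra. }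
assert (hq2 : 0 <= q2 < 1) by (unfold q2; nra).
destruct (contraction_fixpoint _ (fun x => minus x (scal (RtoC rho) (F x))) (sqrt q2))
  as [x hx].
- split; [apply sqrt_pos|]. rewrite <- sqrt_1. apply sqrt_lt_1; lra.
- intros x y. apply norm_le_of_sq.
  { apply Rmult_le_pos; [apply sqrt_pos|apply norm_pos]. }
  rewrite Rpow_mult_distr, pow2_sqrt by lra.
  set (e := minus x y). set (f := minus (F x) (F y)).
  replace (minus (minus x _) _) with (minus e (scal (RtoC rho) f))
    by (unfold e, f; vec).
  assert (h1 : norm f ^ 2 <= l ^ 2 * norm e ^ 2).
  { rewrite <- Rpow_mult_distr. apply pow_incr. split; [apply norm_pos|].
    eapply Rle_trans; [apply hL|]. apply Rmult_le_compat_r; [apply norm_pos|lra]. }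
  assert (h2 : c * norm e ^ 2 <= dot f e) by apply hm.
  dots. rewrite (dot_sym _ e f), <- (normsq _ e), <- (normsq _ f).
  assert (hr : 0 < rho). { apply Rdiv_lt_0_compat; [lra|]. apply pow_lt; lra. }
  apply Rle_trans with (norm e ^ 2 - 2 * rho * (c * norm e ^ 2)
     + rho ^ 2 * (l ^ 2 * norm e ^ 2)).
  + assert (rho * (c * norm e ^ 2) <= rho * dot f e) by nra.
    assert (rho ^ 2 * norm f ^ 2 <= rho ^ 2 * (l ^ 2 * norm e ^ 2)).
    { apply Rmult_le_compat_l; [apply pow2_ge_0|exact h1]. }
    lra.
  + right. unfold rho, q2. field. lra.
- exists x. assert (hr : 0 < rho).
  { apply Rdiv_lt_0_compat; [lra|]. apply pow_lt; lra. }
  apply dot_ext. intros z.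
  pose proof (f_equal (fun v => dot v z) hx) as h. simpl in h.
  dots_in h. rewrite dot_zero_l. nra.
Qed.

(** * Orthogonal projection and the Riesz representation *)

Definition real_subspace (H : Hilbert) (S : H -> Prop) : Prop :=
  S zero /\ (forall x y, S x -> S y -> S (plus x y)) /\
  (forall (r : R) x, S x -> S (scal (RtoC r) x)).

Definition adherent (H : Hilbert) (S : H -> Prop) (p : H) : Prop :=
  forall eps, 0 < eps -> exists s, S s /\ norm (minus p s) < eps.

Arguments real_subspace {H} S.
Arguments adherent {H} S p.

(** [S] need not be closed, so the minimiser of the distance is found in its closure, as the limit
    of a minimising sequence. Orthogonality then comes from varying the minimiser along [r t] and
    optimising over [r]. *)
Lemma projection_closure (H : Hilbert) (S : H -> Prop) (x : H) :
  real_subspace S ->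
  exists p, adherent S p /\ forall s, S s -> dot (minus x p) s = 0.
Proof.
intros [S0 [Sp Ss]].
(* Completeness of the reals supplies suprema, so the infimum of the squared distance appears as
   [- m]. *)
destruct (completeness (fun r => exists s, S s /\ r = - norm (minus x s) ^ 2))
  as [m [hm1 hm2]].
{ exists 0. intros r [s [_ ->]]. pose proof (pow2_ge_0 (norm (minus x s))). lra. }
{ exists (- norm (minus x zero) ^ 2). exists zero. split; [exact S0|reflexivity]. }
assert (hlow : forall s, S s -> - m <= norm (minus x s) ^ 2).
{ intros s hs. assert (- norm (minus x s) ^ 2 <= m); [|lra].
  apply hm1. exists s. split; [exact hs|reflexivity]. }
assert (hex : forall n : nat, exists s, S s /\
  norm (minus x s) ^ 2 < - m + / (INR n + 1)).
{ intros n. apply NNPP. intros hn.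
  assert (hp : 0 < / (INR n + 1)).
  { apply Rinv_0_lt_compat. pose proof (pos_INR n). lra. }
  assert (m <= m - / (INR n + 1)); [|lra].
  apply hm2. intros r [s [hs ->]].
  apply Rnot_lt_le. intros hl. apply hn. exists s. split; [exact hs|lra]. }
destruct (choice _ hex) as [s hs].
assert (hinv : forall eps, 0 < eps -> exists N : nat, forall n, (N <= n)%nat ->
   / (INR n + 1) < eps).
{ intros eps he. destruct (archimed_cor1 eps he) as [N [hN hN0]].
  exists N. intros n hn. eapply Rle_lt_trans; [|exact hN].
  apply Rinv_le_contravar. { apply lt_0_INR; lia. }
  apply le_INR in hn. lra. }
destruct (cauchy_seqlim _ s) as [p hp].
{ intros eps he. destruct (hinv (eps ^ 2 / 4)) as [N hN]; [nra|].
  exists N. intros n k hn hk.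
  (* Parallelogram law: the midpoint of two nearly optimal points also lies in [S], so its distance
     is no smaller than the infimum. *)
  assert (h2 : norm (minus (s n) (s k)) ^ 2 < eps ^ 2).
  { pose proof (hlow (scal (RtoC (/ 2)) (plus (s n) (s k)))
      (Ss _ _ (Sp _ _ (proj1 (hs n)) (proj1 (hs k))))) as hl.
    pose proof (proj2 (hs n)) as h1. pose proof (proj2 (hs k)) as h2.
    pose proof (hN n hn). pose proof (hN k hk).
    rewrite !normsq in *. revert hl h1 h2. dots.
    rewrite (dot_sym _ (s n) x), (dot_sym _ (s k) x), (dot_sym _ (s k) (s n)).
    intros. lra. }
  pose proof (norm_pos _ (minus (s n) (s k))). nra. }
exists p. split.
- intros eps he. destruct (hp eps he) as [N hN]. exists (s N).
  split; [apply hs|]. rewrite norm_minus_sym. apply hN. lia.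
- intros t ht.
  assert (hr : forall r, 0 <= - 2 * r * dot (minus x p) t + r ^ 2 * norm t ^ 2).
  { intros r. apply Rnot_lt_le. intros hneg.
    set (g := - 2 * r * dot (minus x p) t + r ^ 2 * norm t ^ 2) in *.
    destruct (hinv (- g / 2)) as [N hN]; [lra|].
    set (B := 2 * Rabs r * norm t + 1).
    assert (hB : 0 < B).
    { unfold B. pose proof (Rmult_le_pos _ _ (Rabs_pos r) (norm_pos _ t)). lra. }
    destruct (hp (- g / 2 / B)) as [N' hN'].
    { apply Rdiv_lt_0_compat; lra. }
    set (n := max N N'). specialize (hN n ltac:(lia)). specialize (hN' n ltac:(lia)).
    pose proof (hlow _ (Sp _ _ (proj1 (hs n)) (Ss r _ ht))) as hl.
    pose proof (proj2 (hs n)) as h1.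
    assert (h3 : norm (minus x (plus (s n) (scal (RtoC r) t))) ^ 2 =
      norm (minus x (s n)) ^ 2 + g + 2 * r * dot (minus (s n) p) t).
    { unfold g. rewrite !normsq. dots.
      rewrite (dot_sym _ t x), (dot_sym _ t (s n)). ring. }
    assert (h4 : 2 * r * dot (minus (s n) p) t <= B * norm (minus (s n) p)).
    { pose proof (dot_abs _ (minus (s n) p) t) as h5.
      assert (r * dot (minus (s n) p) t <=
        Rabs r * (norm (minus (s n) p) * norm t)).
      { eapply Rle_trans; [apply Rle_abs|]. rewrite Rabs_mult.
        apply Rmult_le_compat_l; [apply Rabs_pos|exact h5]. }
      pose proof (norm_pos _ (minus (s n) p)). unfold B. nra. }
    assert (h5 : B * norm (minus (s n) p) < - g / 2).
    { apply Rmult_lt_compat_l with (r := B) in hN'; [|exact hB].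
      replace (B * (- g / 2 / B)) with (- g / 2) in hN' by (field; lra). exact hN'. }
    lra. }
  destruct (Req_dec (norm t) 0) as [e|e].
  + apply hnorm_eq0 in e. subst t. apply dot_zero_r.
  (* At its minimiser [b / norm t ^ 2] the quadratic takes the value [- b^2 / norm t ^ 2], which
     forces [b = 0]. *)
  + set (b := dot (minus x p) t) in *. specialize (hr (b / norm t ^ 2)).
    replace (_ + _) with (- (b ^ 2 / norm t ^ 2)) in hr by (field; exact e).
    assert (h0 : 0 < / norm t ^ 2).
    { apply Rinv_0_lt_compat. apply pow2_gt_0. exact e. }
    unfold Rdiv in hr. destruct (Req_dec b 0) as [hb|hb]; [exact hb|].
    pose proof (pow2_gt_0 b hb). nra.
Qed.

Lemma dense_of_orthogonal (H : Hilbert) (S : H -> Prop) :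
  real_subspace S ->
  (forall w, (forall s, S s -> dot w s = 0) -> w = zero) ->
  forall x, adherent S x.
Proof.
intros hS h x. destruct (projection_closure _ _ x hS) as [p [hp ho]].
assert (e : minus x p = zero) by (apply h; exact ho).
replace x with p; [exact hp|]. symmetry. apply minus_eq0. rewrite e, hnorm0. lra.
Qed.

(** Off the kernel, [f] is fixed by its value on one vector [w] orthogonal to the kernel, here [x0]
    minus its projection. The real version is enough for the adjoints built below. *)
Lemma riesz (H : Hilbert) (f : H -> R) (M : R) :
  (forall x y, f (plus x y) = f x + f y) ->
  (forall r x, f (scal (RtoC r) x) = r * f x) ->
  (forall x, Rabs (f x) <= M * norm x) ->
  exists w, forall x, f x = dot x w.
Proof.
intros fp fs fb.
destruct (classic (forall x, f x = 0)) as [h0|h0].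
{ exists zero. intros x. rewrite h0, dot_zero_r. reflexivity. }
apply not_all_ex_not in h0. destruct h0 as [x0 hx0].
assert (f0 : f zero = 0).
{ replace (@zero H) with (scal (RtoC 0) (@zero H)) by vec. rewrite fs. ring. }
assert (fm : forall x y, f (minus x y) = f x - f y).
{ intros x y. replace (minus x y) with (plus x (scal (RtoC (-1)) y)) by vec.
  rewrite fp, fs. ring. }
destruct (projection_closure _ (fun x => f x = 0) x0) as [p [hp ho]].
{ split; [exact f0|]. split; [intros x y hx hy; rewrite fp, hx, hy; ring|].
  intros r x hx. rewrite fs, hx. ring. }
(* The projection is only adherent to the kernel; boundedness of [f] puts it in the kernel. *)
assert (fp0 : f p = 0).
{ assert (Rabs (f p) <= 0); [|pose proof (Rabs_pos (f p));
    destruct (Rcase_abs (f p)); [rewrite Rabs_left in *|rewrite Rabs_right in *]; lra].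
  apply le_epsilon. intros eps he.
  destruct (hp (eps / (Rabs M + 1))) as [s [hs1 hs2]].
  { apply Rdiv_lt_0_compat; [lra|]. pose proof (Rabs_pos M). lra. }
  replace (f p) with (f (minus p s)) by (rewrite fm, hs1; ring).
  eapply Rle_trans; [apply fb|]. pose proof (Rabs_pos M). pose proof (Rle_abs M).
  pose proof (norm_pos _ (minus p s)).
  assert (norm (minus p s) * (Rabs M + 1) <= eps); [|nra].
  left. apply Rmult_lt_reg_r with (/ (Rabs M + 1)).
  - apply Rinv_0_lt_compat; lra.
  - rewrite Rmult_assoc, Rinv_r, Rmult_1_r by lra. exact hs2. }
set (w := minus x0 p) in *.
assert (fw : f w <> 0) by (unfold w; rewrite fm, fp0; lra).
assert (hw : dot w w <> 0).
{ intros e. apply fw. rewrite (dot_eq0 _ w); [exact f0|lra]. }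
exists (scal (RtoC (f w / dot w w)) w). intros x.
specialize (ho (minus x (scal (RtoC (f x / f w)) w))).
rewrite fm, fs in ho. specialize (ho ltac:(field; exact fw)).
dots_in ho. dots. rewrite (dot_sym _ x w).
replace (dot w x) with (f x / f w * dot w w) by lra. field. split; assumption.
Qed.

(* The gliding hump: the sequence is built so that the n-th hump makes the
   n-th seminorm larger than n, and later humps are too small to undo this. *)
Lemma uniform_boundedness (H : Hilbert) (I : Type) (p : I -> H -> R) :
  (forall i x y, p i (plus x y) <= p i x + p i y) ->
  (forall i r x, p i (scal (RtoC r) x) = Rabs r * p i x) ->
  (forall i, exists M, forall x, p i x <= M * norm x) ->
  (forall x, exists C, forall i, p i x <= C) ->
  exists C, forall i x, p i x <= C * norm x.
Proof.
intros psub phom pbd ppt. apply NNPP. intros hno.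
assert (hex : forall C, exists i x, C * norm x < p i x).
{ intros C. apply NNPP. intros h. apply hno. exists C. intros i x.
  apply Rnot_lt_le. intros hl. apply h. exists i, x. exact hl. }
assert (p0 : forall i, p i zero = 0).
{ intros i. replace (@zero H) with (scal (RtoC 0) (@zero H)) by vec.
  rewrite phom, Rabs_R0. ring. }
assert (ppos : forall i x, 0 <= p i x).
{ intros i x. pose proof (psub i x (scal (RtoC (-1)) x)) as h.
  rewrite phom in h. replace (plus x (scal (RtoC (-1)) x)) with (@zero H) in h by vec.
  rewrite p0, Rabs_left in h; lra. }
assert (hstep : forall (n : nat) (st : H * posreal), exists st' : H * posreal,
  norm (minus (fst st') (fst st)) <= snd st /\ snd st' <= snd st / 2 /\
  exists i, INR n < p i (fst st') /\ forall v, p i v * snd st' <= norm v).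
{ intros n [x [d hd]]. simpl.
  destruct (hex (INR n / d)) as [i [v hv]].
  assert (hv0 : 0 < norm v).
  { pose proof (norm_pos _ v) as h. destruct h as [h|h]; [exact h|].
    rewrite <- h in hv. symmetry in h. apply hnorm_eq0 in h. subst v.
    rewrite p0 in hv. lra. }
  set (w := scal (RtoC (d / norm v)) v).
  assert (hdv : 0 < d / norm v) by now apply Rdiv_lt_0_compat.
  assert (hw : norm w = d).
  { unfold w. rewrite norm_scalR, Rabs_pos_eq by lra. field. lra. }
  assert (hpw : INR n < p i w).
  { unfold w. rewrite phom, Rabs_pos_eq by lra.
    apply Rmult_lt_compat_l with (r := d / norm v) in hv; [|exact hdv].
    replace (d / norm v * (INR n / d * norm v)) with (INR n) in hv by (field; lra).
    exact hv. }
  (* Since [2 w = (x + w) - (x - w)], subadditivity makes the seminorm large at one of [x + w] and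
     [x - w]. *)
  assert (hx' : exists x', norm (minus x' x) <= d /\ INR n < p i x').
  { destruct (Rlt_le_dec (INR n) (p i (plus x w))) as [h|h].
    - exists (plus x w). split; [|exact h].
      replace (minus (plus x w) x) with w by vec. lra.
    - exists (minus x w). split.
      + replace (minus (minus x w) x) with (opp w) by vec. rewrite hnorm_opp. lra.
      + pose proof (psub i (plus x w) (scal (RtoC (-1)) (minus x w))) as h1.
        replace (plus (plus x w) (scal (RtoC (-1)) (minus x w)))
          with (scal (RtoC 2) w) in h1 by vec.
        rewrite !phom in h1. rewrite (Rabs_left (-1)), (Rabs_pos_eq 2) in h1 by lra.
        lra. }
  destruct hx' as [x' [h1 h2]].
  destruct (pbd i) as [M hM].
  assert (hM1 : 0 < Rabs M + 1) by (pose proof (Rabs_pos M); lra).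
  (* Halving makes the later displacements summable to twice the new radius; the other term makes a
     displacement of that radius change [p i] by at most one. *)
  assert (hd' : 0 < Rmin (d / 2) (/ (Rabs M + 1))).
  { apply Rmin_pos; [lra|]. now apply Rinv_0_lt_compat. }
  exists (x', mkposreal _ hd'). simpl. split; [exact h1|].
  split; [apply Rmin_l|]. exists i. split; [exact h2|]. intros u.
  apply Rle_trans with ((Rabs M + 1) * norm u * / (Rabs M + 1)).
  - apply Rmult_le_compat; [apply ppos|lra| |apply Rmin_r].
    eapply Rle_trans; [apply hM|]. pose proof (Rle_abs M).
    pose proof (norm_pos _ u). nra.
  - right. field. lra. }
destruct (choice (fun (a : nat * (H * posreal)) (st' : H * posreal) =>
  norm (minus (fst st') (fst (snd a))) <= snd (snd a) /\
  snd st' <= snd (snd a) / 2 /\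
  exists i, INR (fst a) < p i (fst st') /\ forall v, p i v * snd st' <= norm v))
  as [f hf].
{ intros [n st]. apply hstep. }
set (u := nat_rect (fun _ => (H * posreal)%type) (@zero H, mkposreal 1 Rlt_0_1)
  (fun n st => f (n, st))).
assert (hu : forall n, norm (minus (fst (u (S n))) (fst (u n))) <= snd (u n) /\
  snd (u (S n)) <= snd (u n) / 2 /\
  exists i, INR n < p i (fst (u (S n))) /\ forall v, p i v * snd (u (S n)) <= norm v).
{ intros n. apply (hf (n, u n)). }
assert (hdec : forall m n, snd (u (m + n)%nat) <= snd (u m) * (/ 2) ^ n).
{ intros m n. induction n as [|n IH].
  - rewrite Nat.add_0_r. simpl. lra.
  - rewrite Nat.add_succ_r. destruct (hu (m + n)%nat) as [_ [h _]]. simpl pow. lra. }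
assert (hlim : forall m, exists l, seqlim (fun n => fst (u (m + n)%nat)) l /\
  norm (minus l (fst (u m))) <= 2 * snd (u m)).
{ intros m. destruct (geometric_seqlim _ (fun n => fst (u (m + n)%nat))
    (snd (u m)) (/ 2)) as [l [h1 h2]].
  - left. apply cond_pos.
  - lra.
  - intros n. rewrite Nat.add_succ_r.
    eapply Rle_trans; [apply hu|apply hdec].
  - exists l. split; [exact h1|]. specialize (h2 0%nat). rewrite Nat.add_0_r in h2.
    replace (snd (u m) * (/ 2) ^ 0 / (1 - / 2)) with (2 * snd (u m)) in h2
      by (simpl; field). exact h2. }
destruct (hlim 0%nat) as [l [hl _]].
destruct (ppt l) as [C hC].
(* All humps after the chosen one change its seminorm by at most 2, so a hump above [Rabs C + 2]
   leaves more than [C] in the limit. *)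
destruct (nfloor_ex (Rabs C + 2)) as [N [_ hN]]; [pose proof (Rabs_pos C); lra|].
pose proof (Rle_abs C).
destruct (hlim (S (S N))) as [l' [h1 h2]].
assert (l' = l).
{ apply seqlim_unique with (fun n => fst (u (S (S N) + n)%nat)); [exact h1|].
  intros eps he. destruct (hl eps he) as [N1 hN1]. exists N1. intros n hn.
  apply (hN1 (S (S N) + n)%nat). lia. }
subst l'. destruct (hu (S N)) as [_ [_ [i [hi1 hi2]]]].
assert (hp2 : p i (minus (fst (u (S (S N)))) l) <= 2).
{ pose proof (hi2 (minus (fst (u (S (S N)))) l)) as h3.
  rewrite norm_minus_sym in h3. pose proof (cond_pos (snd (u (S (S N))))).
  apply Rmult_le_reg_r with (snd (u (S (S N)))); [assumption|]. lra. }
set (a := fst (u (S (S N)))) in *.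
assert (h4 : p i a <= p i (minus a l) + p i l).
{ replace a with (plus (minus a l) l) at 1 by vec. apply psub. }
specialize (hC i). rewrite S_INR in hi1. lra.
Qed.

(* The adjoint of [T] is bounded below by uniform boundedness, so [T T^*] is
   strongly monotone and the preimage of [f] is [T^* z] with [T T^* z = f]. *)
Lemma bounded_inverse (D Z : Hilbert) (T : D -> Z) :
  is_linear T -> (forall d, T d = zero -> d = zero) -> (forall z, exists d, T d = z) ->
  exists C, 0 < C /\ forall d, norm d <= C * norm (T d).
Proof.
intros hT hinj hsurj.
destruct (linear_bound _ _ T hT) as [M [hM hTM]].
assert (Ts : forall r d, T (scal (RtoC r) d) = scal (RtoC r) (T d))
  by (intros; apply (linear_scal T hT)).
assert (Tm : forall x y, T (minus x y) = minus (T x) (T y))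
  by (intros; apply (linear_minus T); exact hT).
assert (hadj : forall z, exists w, forall d, dot (T d) z = dot d w).
{ intros z. apply (riesz D (fun d => dot (T d) z) (M * norm z)).
  - intros x y. rewrite (linear_plus T hT). apply dot_plus_l.
  - intros r x. rewrite Ts. apply dot_scal_l.
  - intros x. eapply Rle_trans; [apply dot_abs|].
    pose proof (hTM x). pose proof (norm_pos _ z). nra. }
destruct (choice _ hadj) as [Tst hTst].
assert (Tsts : forall r z, Tst (scal (RtoC r) z) = scal (RtoC r) (Tst z)).
{ intros r z. apply dot_ext. intros d. rewrite !(dot_sym _ _ d).
  rewrite <- hTst. dots. rewrite <- hTst. reflexivity. }
assert (Tstm : forall z z', Tst (minus z z') = minus (Tst z) (Tst z')).
{ intros z z'. apply dot_ext. intros d. rewrite !(dot_sym _ _ d).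
  rewrite <- hTst. dots. rewrite <- !hTst. reflexivity. }
(* Surjectivity gives the pointwise bounds: for [f = T d] the pairing of [f] with [z] equals that of
   [d] with [Tst z], which is at most [norm d]. *)
destruct (uniform_boundedness Z {z : Z | norm (Tst z) <= 1}
  (fun z f => Rabs (dot f (proj1_sig z)))) as [C hC].
{ intros [z hz] x y. simpl. rewrite dot_plus_l. apply Rabs_triang. }
{ intros [z hz] r x. simpl. rewrite dot_scal_l. apply Rabs_mult. }
{ intros [z hz]. exists (norm z). intros x. simpl. rewrite Rmult_comm. apply dot_abs. }
{ intros f. destruct (hsurj f) as [d <-]. exists (norm d). intros [z hz]. simpl.
  rewrite hTst. eapply Rle_trans; [apply dot_abs|]. pose proof (norm_pos _ d). nra. }
set (C1 := Rabs C + 1).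
assert (hC1 : 0 < C1) by (unfold C1; pose proof (Rabs_pos C); lra).
assert (hb1 : forall z, norm (Tst z) <= 1 -> norm z <= C1).
{ intros z hz. pose proof (hC (exist _ z hz) z) as h. simpl in h.
  rewrite <- normsq, Rabs_pos_eq in h by apply pow2_ge_0.
  pose proof (norm_pos _ z). pose proof (norm_pos _ z). unfold C1.
  pose proof (Rle_abs C). pose proof (Rabs_pos C).
  destruct (Req_dec (norm z) 0); [lra|]. nra. }
assert (hb : forall z, norm z <= C1 * norm (Tst z)).
{ intros z. apply le_epsilon. intros eps he.
  (* The added term keeps the normalising factor positive even when [Tst z] vanishes. *)
  set (r := norm (Tst z) + eps / C1).
  assert (he1 : 0 < eps / C1) by now apply Rdiv_lt_0_compat.
  assert (hr : 0 < r) by (unfold r; pose proof (norm_pos _ (Tst z)); lra).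
  assert (hri : 0 < / r) by now apply Rinv_0_lt_compat.
  pose proof (hb1 (scal (RtoC (/ r)) z)) as h.
  rewrite Tsts, !norm_scalR, Rabs_pos_eq in h by lra.
  assert (h' : / r * norm (Tst z) <= 1).
  { apply Rmult_le_reg_l with r; [exact hr|].
    rewrite <- Rmult_assoc, Rinv_r, Rmult_1_l, Rmult_1_r by lra. unfold r. lra. }
  specialize (h h'). apply Rmult_le_compat_l with (r := r) in h; [|lra].
  rewrite <- Rmult_assoc, Rinv_r, Rmult_1_l in h by lra.
  replace (C1 * norm (Tst z) + eps) with (r * C1) by (unfold r; field; lra).
  exact h. }
assert (hTstb : forall z, norm (Tst z) <= M * norm z).
{ intros z. pose proof (norm_pos _ (Tst z)). pose proof (norm_pos _ z).
  pose proof (normsq _ (Tst z)) as h. rewrite <- hTst in h.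
  pose proof (dot_le _ (T (Tst z)) z). pose proof (hTM (Tst z)).
  destruct (Req_dec (norm (Tst z)) 0) as [e|e]; [rewrite e; nra|].
  apply Rmult_le_reg_r with (norm (Tst z)); [lra|]. nra. }
exists C1. split; [exact hC1|]. intros d.
destruct (strongly_monotone_zero Z (fun z => minus (T (Tst z)) (T d)) (/ C1 ^ 2) (M * M))
  as [z hz].
{ apply Rinv_0_lt_compat. now apply pow_lt. }
{ intros x y. cbv beta.
  replace (minus (minus (T (Tst x)) (T d)) (minus (T (Tst y)) (T d)))
    with (T (Tst (minus x y)))
    by (rewrite Tstm, Tm; vec).
  eapply Rle_trans; [apply hTM|]. pose proof (hTstb (minus x y)). nra. }
{ intros x y. cbv beta.
  replace (minus (minus (T (Tst x)) (T d)) (minus (T (Tst y)) (T d)))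
    with (T (Tst (minus x y)))
    by (rewrite Tstm, Tm; vec).
  rewrite hTst, <- normsq. apply Rmult_le_reg_l with (C1 ^ 2); [now apply pow_lt|].
  rewrite <- Rmult_assoc, Rinv_r, Rmult_1_l by (apply pow_nonzero; lra).
  rewrite <- Rpow_mult_distr. apply pow_incr. split; [apply norm_pos|apply hb]. }
(* Injectivity puts [d] in the range of the adjoint, so that [norm d ^ 2] is the pairing of [T d]
   with [z], and [norm z] is at most [C1 * norm d]. *)
assert (hd : d = Tst z).
{ symmetry. apply minus_eq0. rewrite (hinj (minus (Tst z) d)); [rewrite hnorm0; lra|].
  rewrite Tm. exact hz. }
assert (hTd : T d = T (Tst z)) by congruence.
assert (h1 : norm d ^ 2 <= norm (T d) * norm z).
{ rewrite hd at 1. rewrite normsq, <- hTst, <- hTd. apply dot_le. }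
pose proof (hb z) as h2. rewrite <- hd in h2.
pose proof (norm_pos _ d). pose proof (norm_pos _ (T d)).
destruct (Req_dec (norm d) 0) as [e|e]; [rewrite e; nra|].
apply Rmult_le_reg_r with (norm d); [lra|]. nra.
Qed.

(** * Strongly continuous semigroups *)

Section RealScalars.

Variable H : Hilbert.

(** Integrals and derivatives along the real line take values in real normed modules, so the same
    carrier is given real scalars. Norm and balls are unchanged, and the definitions are
    transparent, so limits pass between both structures by conversion. *)
Definition real_ModuleSpace_mixin :
  ModuleSpace.mixin_of R_Ring (AbelianGroup.Pack H (AbelianGroup.class H) H).
Proof.
refine (@ModuleSpace.Mixin R_Ring (AbelianGroup.Pack H (AbelianGroup.class H) H)
  (fun (r : R) (x : H) => scal (RtoC r) x) _ _ _ _).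
- intros a b u. change (mult a b) with (Rmult a b). vec.
- intros u. change (@one R_Ring) with 1. vec.
- intros a u v. vec.
- intros a b u. change (plus a b) with (Rplus a b). vec.
Defined.

Definition real_NormedModuleAux : NormedModuleAux R_AbsRing :=
  NormedModuleAux.Pack R_AbsRing H
    (NormedModuleAux.Class R_AbsRing H
      (ModuleSpace.Class R_Ring H (AbelianGroup.class H) real_ModuleSpace_mixin)
      (UniformSpace.class H)) H.

Definition real_NormedModule_mixin :
  NormedModule.mixin_of R_AbsRing real_NormedModuleAux.
Proof.
refine (@NormedModule.Mixin R_AbsRing real_NormedModuleAux
  (@norm C_AbsRing H) (@norm_factor C_AbsRing H) _ _ _ _ _).
- exact (hnorm_plus H).
- intros l x. right. exact (norm_scalR H l x).
- exact (@norm_compat1 C_AbsRing H).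
- exact (@norm_compat2 C_AbsRing H).
- exact (hnorm_eq0 H).
Defined.

Definition real_Hilbert : CompleteNormedModule R_AbsRing :=
  CompleteNormedModule.Pack R_AbsRing H
    (CompleteNormedModule.Class R_AbsRing H
      (NormedModule.Class R_AbsRing H
        (NormedModuleAux.class R_AbsRing real_NormedModuleAux)
        real_NormedModule_mixin)
      (CompleteSpace.mixin _ (CompleteSpace.class H))) H.

End RealScalars.

Lemma at_right_nlim (H : Hilbert) (f : R -> H) (l : H) :
  filterlim f (at_right 0) (locally l) <->
  forall eps, 0 < eps -> exists d, 0 < d /\
    forall h, 0 < h < d -> norm (minus (f h) l) < eps.
Proof.
assert (FF : Filter (at_right 0)) by apply within_filter, locally_filter.
rewrite (filterlim_nlim f (at_right 0) l). split.
- intros h eps he. destruct (h eps he) as [d hd]. exists d. split; [apply cond_pos|].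
  intros t ht. apply hd; [|lra].
  change (Rabs (t - 0) < d). rewrite Rabs_pos_eq; lra.
- intros h eps he. destruct (h eps he) as [d [hd hf]]. exists (mkposreal d hd).
  intros t ht ht0. apply hf. change (Rabs (t - 0) < d) in ht.
  rewrite Rabs_pos_eq in ht; lra.
Qed.

Lemma filterlim_at_right_unique (H : Hilbert) (f : R -> H) (l m : H) :
  filterlim f (at_right 0) (locally l) -> filterlim f (at_right 0) (locally m) ->
  l = m.
Proof.
rewrite !at_right_nlim. intros hl hm. apply minus_eq0, le_epsilon. intros eps he.
destruct (hl (eps / 2)) as [d [hd h1]]; [lra|].
destruct (hm (eps / 2)) as [d' [hd' h2]]; [lra|].
assert (h0 : 0 < Rmin d d' / 2).
{ assert (0 < Rmin d d') by now apply Rmin_pos. lra. }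
pose proof (Rmin_l d d'). pose proof (Rmin_r d d').
specialize (h1 (Rmin d d' / 2) ltac:(lra)). specialize (h2 (Rmin d d' / 2) ltac:(lra)).
pose proof (norm_tri_mid' _ (f (Rmin d d' / 2)) l m). lra.
Qed.

Lemma filterlim_Rscal {T : Type} (H : Hilbert) (F : (T -> Prop) -> Prop) {FF : Filter F}
  (r : T -> R) (v : T -> H) (r0 : R) (v0 : H) :
  filterlim r F (locally r0) -> filterlim v F (locally v0) ->
  filterlim (fun t => scal (RtoC (r t)) (v t)) F (locally (scal (RtoC r0) v0)).
Proof.
intros hr hv.
exact (filterlim_comp_2 (FF:=FF) r v (@scal R_Ring (real_Hilbert H)) hr hv
  (@filterlim_scal R_AbsRing (real_Hilbert H) r0 v0)).
Qed.

Lemma filterlim_Hplus {T : Type} (H : Hilbert) (F : (T -> Prop) -> Prop) {FF : Filter F}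
  (u v : T -> H) (u0 v0 : H) :
  filterlim u F (locally u0) -> filterlim v F (locally v0) ->
  filterlim (fun t => plus (u t) (v t)) F (locally (plus u0 v0)).
Proof.
intros hu hv. exact (filterlim_comp_2 (FF:=FF) u v (@plus H) hu hv
  (@filterlim_plus C_AbsRing H u0 v0)).
Qed.

Lemma filterlim_Hminus {T : Type} (H : Hilbert) (F : (T -> Prop) -> Prop) {FF : Filter F}
  (u v : T -> H) (u0 v0 : H) :
  filterlim u F (locally u0) -> filterlim v F (locally v0) ->
  filterlim (fun t => minus (u t) (v t)) F (locally (minus u0 v0)).
Proof.
intros hu hv. apply filterlim_Hplus; [exact FF|exact hu|].
exact (filterlim_comp _ _ _ v opp F _ _ hv (@filterlim_opp C_AbsRing H v0)).
Qed.

Lemma filterlim_linear {T : Type} (H1 H2 : Hilbert) (F : (T -> Prop) -> Prop)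
  (f : H1 -> H2) (u : T -> H1) (u0 : H1) :
  is_linear f -> filterlim u F (locally u0) ->
  filterlim (fun t => f (u t)) F (locally (f u0)).
Proof.
intros hf hu. exact (filterlim_comp _ _ _ u f F _ _ hu
  (@linear_cont C_AbsRing H1 H2 f u0 hf)).
Qed.

Lemma Riemann_sum_linear (H : Hilbert) (L : H -> H) (f : R -> H) (ptd : SF_seq) :
  is_linear L ->
  @Riemann_sum (real_Hilbert H) (fun s => L (f s)) ptd =
  L (@Riemann_sum (real_Hilbert H) f ptd).
Proof.
intros hL. induction ptd as [x0|h s IH] using SF_cons_ind.
- symmetry. exact (linear_zero L hL).
- rewrite !Riemann_sum_cons, IH. symmetry. etransitivity; [apply (linear_plus L hL)|].
  apply f_equal2; [|reflexivity]. apply (linear_scal L hL).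
Qed.

Lemma RInt_linear (H : Hilbert) (L : H -> H) (f : R -> H) (a b : R) :
  is_linear L -> @ex_RInt (real_Hilbert H) f a b ->
  @RInt (real_Hilbert H) (fun s => L (f s)) a b = L (@RInt (real_Hilbert H) f a b).
Proof.
intros hL hf. apply is_RInt_unique. apply RInt_correct in hf. unfold is_RInt in *.
apply (filterlim_ext (fun ptd => L (scal (sign (b - a))
  (@Riemann_sum (real_Hilbert H) f ptd)))).
- intros ptd. etransitivity; [apply (linear_scal L hL (RtoC (sign (b - a))))|].
  exact (f_equal (scal (RtoC (sign (b - a))))
    (eq_sym (Riemann_sum_linear H L f ptd hL))).
- exact (filterlim_linear H H _ L _ _ hL hf).
Qed.

Section Semigroup.

Variables (X : Hilbert) (T : R -> X -> X).
Hypothesis sgT : C0_semigroup T.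

Let Tlin (t : R) (ht : 0 <= t) : is_linear (T t) := proj1 sgT t ht.
Let T0 (x : X) : T 0 x = x := proj1 (proj2 sgT) x.
Let Tadd : forall s t, 0 <= s -> 0 <= t -> forall x, T (s + t) x = T s (T t x) :=
  proj1 (proj2 (proj2 sgT)).

Lemma semigroup_plus (t : R) (x y : X) : 0 <= t -> T t (plus x y) = plus (T t x) (T t y).
Proof. intros ht. apply (linear_plus (T t)), Tlin, ht. Qed.

Lemma semigroup_minus (t : R) (x y : X) :
  0 <= t -> T t (minus x y) = minus (T t x) (T t y).
Proof. intros ht. apply (linear_minus (T t)), Tlin, ht. Qed.

Lemma semigroup_Rscal (t r : R) (x : X) :
  0 <= t -> T t (scal (RtoC r) x) = scal (RtoC r) (T t x).
Proof. intros ht. apply (linear_scal (T t)), Tlin, ht. Qed.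

Lemma semigroup_right_cont (x : X) (eps : R) : 0 < eps ->
  exists d, 0 < d /\ forall h, 0 <= h < d -> norm (minus (T h x) x) < eps.
Proof.
intros he. pose proof (proj2 (proj2 (proj2 sgT)) x) as h.
rewrite at_right_nlim in h. destruct (h eps he) as [d [hd hf]].
exists d. split; [exact hd|]. intros t ht.
destruct (Req_dec t 0) as [->|e]; [|apply hf; lra].
rewrite T0. replace (minus x x) with (@zero X) by vec. rewrite hnorm0. exact he.
Qed.

(** Otherwise some times [t n] tending to 0 would have operators of norm exceeding [n + 1]. Strong
    continuity at 0 bounds these operators pointwise, contradicting uniform boundedness. *)
Lemma semigroup_bounded_near_0 :
  exists d M, 0 < d /\ 1 <= M /\
    forall t x, 0 <= t <= d -> norm (T t x) <= M * norm x.
Proof.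
apply NNPP. intros hno.
assert (hex : forall n : nat, exists t, 0 <= t <= / (INR n + 1) /\
  exists x, (INR n + 1) * norm x < norm (T t x)).
{ intros n. apply NNPP. intros hn. apply hno. pose proof (pos_INR n).
  exists (/ (INR n + 1)), (INR n + 1).
  split; [apply Rinv_0_lt_compat; lra|]. split; [lra|].
  intros t x ht. apply Rnot_lt_le. intros hl. apply hn.
  exists t. split; [exact ht|]. exists x. exact hl. }
destruct (choice _ hex) as [t ht].
destruct (uniform_boundedness X nat (fun n x => norm (T (t n) x))) as [C hC].
- intros n x y. rewrite semigroup_plus by apply ht. apply hnorm_plus.
- intros n r x. rewrite semigroup_Rscal by apply ht. apply norm_scalR.
- intros n. destruct (linear_bound _ _ _ (Tlin (t n) (proj1 (proj1 (ht n))))) as [M [_ hM]].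
  exists M. exact hM.
- intros x. destruct (semigroup_right_cont x 1 Rlt_0_1) as [d [hd hx]].
  destruct (archimed_cor1 d hd) as [N [hN hN0]].
  (* Continuity at 0 controls only the indices from [N] on; the finitely many earlier ones
     contribute a maximum. *)
  assert (hfin : exists C, forall n, (n < N)%nat -> norm (T (t n) x) <= C).
  { clear hN hN0. induction N as [|N [C hC]]; [exists 0; intros; lia|].
    exists (Rmax C (norm (T (t N) x))). intros n hn.
    destruct (Nat.eq_dec n N) as [->|e]; [apply Rmax_r|].
    eapply Rle_trans; [apply hC; lia|apply Rmax_l]. }
  destruct hfin as [C hC]. exists (Rmax C (1 + norm x)). intros n.
  destruct (Nat.lt_ge_cases n N) as [hn|hn].
  + eapply Rle_trans; [apply hC, hn|apply Rmax_l].
  + eapply Rle_trans; [|apply Rmax_r].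
    pose proof (norm_le_mid _ x (T (t n) x)).
    assert (norm (minus (T (t n) x) x) < 1); [|lra].
    apply hx. split; [apply ht|]. eapply Rle_lt_trans; [apply ht|].
    eapply Rle_lt_trans; [|exact hN]. apply Rinv_le_contravar.
    * apply lt_0_INR. lia.
    * apply le_INR in hn. lra.
- destruct (nfloor_ex (Rabs C)) as [N [_ hN]]; [apply Rabs_pos|].
  destruct (ht N) as [_ [x hx]]. specialize (hC N x). pose proof (Rle_abs C).
  pose proof (norm_pos _ x). nra.
Qed.

Lemma semigroup_locally_bounded (a : R) :
  exists M, 1 <= M /\ forall t x, 0 <= t <= a -> norm (T t x) <= M * norm x.
Proof.
destruct semigroup_bounded_near_0 as [d [M [hd [hM hb]]]].
assert (hn : forall n : nat, forall t x, 0 <= t <= INR (S n) * d ->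
   norm (T t x) <= M ^ S n * norm x).
{ induction n as [|n IH]; intros t x ht.
  - rewrite pow_1. apply hb. simpl in ht. lra.
  - assert (hMn : 1 <= M ^ S n) by now apply pow_R1_Rle.
    change (M ^ S (S n)) with (M * M ^ S n).
    destruct (Rle_lt_dec t d) as [h|h].
    + eapply Rle_trans; [apply hb; lra|].
      apply Rmult_le_compat_r; [apply norm_pos|]. nra.
    + replace t with (d + (t - d)) by ring. rewrite Tadd by lra.
      eapply Rle_trans; [apply hb; lra|]. rewrite Rmult_assoc.
      apply Rmult_le_compat_l; [lra|]. apply IH. rewrite S_INR in ht. lra. }
destruct (nfloor_ex (Rabs a / d)) as [N [_ hN]].
{ apply Rmult_le_pos; [apply Rabs_pos|]. left. now apply Rinv_0_lt_compat. }
exists (M ^ S N). split; [now apply pow_R1_Rle|]. intros t x ht. apply hn.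
split; [lra|]. rewrite S_INR. pose proof (Rle_abs a).
apply Rmult_lt_compat_r with (r := d) in hN; [|exact hd].
replace (Rabs a / d * d) with (Rabs a) in hN by (field; lra). lra.
Qed.

(** Factoring out [T u] at the earlier time [u] reduces both sides to right continuity at 0, at the
    cost of the local bound [M]. *)
Lemma semigroup_continuous (x : X) (t eps : R) : 0 <= t -> 0 < eps ->
  exists d, 0 < d /\ forall s, 0 <= s -> Rabs (s - t) < d ->
    norm (minus (T s x) (T t x)) < eps.
Proof.
intros ht he. destruct (semigroup_locally_bounded (t + 1)) as [M [hM hb]].
destruct (semigroup_right_cont x (eps / M)) as [d [hd hc]].
{ apply Rdiv_lt_0_compat; lra. }
assert (key : forall u v, 0 <= u <= v -> v <= t + 1 -> v - u < d ->
  norm (minus (T v x) (T u x)) < eps).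
{ intros u v hu hv huv. replace v with (u + (v - u)) by ring.
  rewrite Tadd, <- semigroup_minus by lra.
  eapply Rle_lt_trans; [apply hb; lra|].
  replace eps with (M * (eps / M)) by (field; lra).
  apply Rmult_lt_compat_l; [lra|]. apply hc. lra. }
exists (Rmin d 1). split; [apply Rmin_pos; lra|]. intros s hs hst.
pose proof (Rmin_l d 1). pose proof (Rmin_r d 1).
destruct (Rle_lt_dec t s) as [h|h].
- rewrite Rabs_pos_eq in hst by lra. apply key; lra.
- rewrite Rabs_left in hst by lra. rewrite norm_minus_sym. apply key; lra.
Qed.

(* The clamp makes the orbit continuous on all of [R]: [T t] is junk for [t < 0]. *)
Definition orbit (x : X) (s : R) : real_Hilbert X := T (Rmax 0 s) x.

Lemma orbit_continuous (x : X) (s : R) : continuous (orbit x) s.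
Proof.
unfold continuous.
apply (proj2 (@filterlim_nlim R X (orbit x) (locally s)
  (@filter_filter _ _ (locally_filter s)) (orbit x s))).
intros eps he.
destruct (semigroup_continuous x (Rmax 0 s) eps (Rmax_l 0 s) he) as [d [hd hf]].
exists (mkposreal d hd). intros u hu. change (Rabs (u - s) < d) in hu.
apply hf; [apply Rmax_l|]. eapply Rle_lt_trans; [|exact hu].
unfold Rmax. destruct (Rle_dec 0 u), (Rle_dec 0 s); unfold Rabs;
  repeat destruct Rcase_abs; lra.
Qed.

Lemma ex_RInt_orbit (x : X) (a b : R) : ex_RInt (orbit x) a b.
Proof. apply ex_RInt_continuous. intros. apply orbit_continuous. Qed.

Definition primitive (x : X) (t : R) : X := RInt (orbit x) 0 t.

Lemma primitive_quotient (x : X) (t : R) : 0 <= t ->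
  filterlim (fun h => scal (RtoC (/ h)) (minus (primitive x (t + h)) (primitive x t)))
    (at_right 0) (locally (T t x)).
Proof.
intros ht.
assert (hd : is_derive (primitive x : R -> real_Hilbert X) t (orbit x t)).
{ apply is_derive_RInt with 0; [|apply orbit_continuous].
  apply filter_forall. intros b. apply RInt_correct, ex_RInt_orbit. }
apply (proj2 (at_right_nlim X _ _)). intros eps he. destruct hd as [_ hd].
specialize (hd t (fun P HP => HP) (mkposreal (eps / 2) ltac:(lra))).
destruct hd as [d hd]. exists d. split; [apply cond_pos|]. intros h hh.
specialize (hd (t + h)). simpl in hd.
assert (h1 : norm (minus (minus (primitive x (t + h)) (primitive x t))
  (scal (RtoC h) (T t x))) <= eps / 2 * h).
{ assert (e : T t x = orbit x t) by (unfold orbit; rewrite Rmax_right; [reflexivity|lra]).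
  rewrite e. replace h with (t + h - t) at 2 3 by ring.
  replace (t + h - t) with (norm (minus (t + h) t : R_NormedModule)) at 2.
  - apply hd. change (Rabs (t + h - t) < d).
    replace (t + h - t) with h by ring. rewrite Rabs_pos_eq; lra.
  - change (Rabs (t + h - t) = t + h - t). apply Rabs_pos_eq. lra. }
norm_as (scal (RtoC (/ h)) (minus (minus (primitive x (t + h)) (primitive x t))
    (scal (RtoC h) (T t x)))) by (field; lra).
rewrite norm_scalR, Rabs_pos_eq by (left; apply Rinv_0_lt_compat; lra).
apply Rle_lt_trans with (/ h * (eps / 2 * h)).
- apply Rmult_le_compat_l; [left; apply Rinv_0_lt_compat; lra|exact h1].
- replace (/ h * (eps / 2 * h)) with (eps / 2) by (field; lra). lra.
Qed.

Lemma primitive_0 (x : X) : primitive x 0 = zero.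
Proof. unfold primitive. apply (@RInt_point (real_Hilbert X)). Qed.

Lemma semigroup_primitive (x : X) (t h : R) : 0 <= t -> 0 <= h ->
  T h (primitive x t) = minus (primitive x (t + h)) (primitive x h).
Proof.
intros ht hh. unfold primitive.
rewrite <- (RInt_linear X (T h) (orbit x) 0 t (Tlin h hh) (ex_RInt_orbit x 0 t)).
transitivity (@RInt (real_Hilbert X) (orbit x) h (t + h)).
- pose proof (@RInt_comp_lin (real_Hilbert X) (orbit x) 1 h 0 t
    (ex_RInt_orbit x _ _)) as e.
  replace (1 * 0 + h) with h in e by ring. replace (1 * t + h) with (t + h) in e by ring.
  etransitivity; [|exact e]. apply (@RInt_ext (real_Hilbert X)).
  intros s hs. rewrite Rmin_left, Rmax_right in hs by lra.
  unfold orbit. rewrite !Rmax_right, <- Tadd by lra.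
  replace (1 * s + h) with (h + s) by ring.
  symmetry. apply (@scal_one R_Ring (real_Hilbert X)).
- rewrite <- (RInt_Chasles (orbit x) 0 h (t + h)) by apply ex_RInt_orbit.
  set (a := RInt (orbit x) h (t + h)). set (b := RInt (orbit x) 0 h).
  change (a = minus (@plus X b a) b). clear. clearbody a b.
  change (@eq X a (@minus X (@plus X b a) b)). vec.
Qed.

(** [T h] shifts the interval of integration, so only the two strips at its ends remain, and each
    quotient tends to an end value of the orbit. Integrals of orbits thus lie in the domain of the
    generator, which yields both its density and its range condition. *)
Lemma semigroup_primitive_quotient (x : X) (t : R) : 0 <= t ->
  filterlim (fun h => scal (RtoC (/ h)) (minus (T h (primitive x t)) (primitive x t)))
    (at_right 0) (locally (minus (T t x) x)).
Proof.
intros ht.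
pose proof (filterlim_Hminus X _ _ _ _ _ (primitive_quotient x t ht)
  (primitive_quotient x 0 (Rle_refl 0))) as h.
rewrite T0 in h. eapply filterlim_within_ext; [|exact h].
intros u hu. simpl. rewrite semigroup_primitive by lra.
rewrite primitive_0, Rplus_0_l. vec.
Qed.

End Semigroup.

(** * Derivatives along orbits and generators *)

(** The derivative is relative to [I] because orbits live on a half-line and classical solutions on
    a closed interval, with one-sided derivatives at the ends. *)
Definition deriv_at {H : Hilbert} (I : R -> Prop) (f : R -> H) (t : R) (l : H) : Prop :=
  forall eps, 0 < eps -> exists d, 0 < d /\
    forall s, I s -> s <> t -> Rabs (s - t) < d ->
      norm (minus (scal (RtoC (/ (s - t))) (minus (f s) (f t))) l) < eps.

Lemma deriv_at_intro (H : Hilbert) (I : R -> Prop) (f : R -> H) (t : R) (l : H) :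
  filterlim (fun s => scal (RtoC (/ (s - t))) (minus (f s) (f t)))
    (within I (locally' t)) (locally l) ->
  deriv_at I f t l.
Proof.
assert (FF : Filter (within I (locally' t)))
  by apply within_filter, within_filter, locally_filter.
intros h eps he. rewrite (filterlim_nlim _ (within I (locally' t)) l) in h.
destruct (h eps he) as [d hd]. exists d. split; [apply cond_pos|].
intros s hs hst hd'. apply hd; assumption.
Qed.

Definition rderiv_at (I : R -> Prop) (f : R -> R) (t l : R) : Prop :=
  forall eps, 0 < eps -> exists d, 0 < d /\
    forall s, I s -> s <> t -> Rabs (s - t) < d ->
      Rabs (f s - f t - l * (s - t)) <= eps * Rabs (s - t).

Lemma deriv_at_bound (H : Hilbert) (I : R -> Prop) (f : R -> H) (t : R) (l : H) :
  deriv_at I f t l <->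
  forall eps, 0 < eps -> exists d, 0 < d /\
    forall s, I s -> s <> t -> Rabs (s - t) < d ->
      norm (minus (minus (f s) (f t)) (scal (RtoC (s - t)) l)) <= eps * Rabs (s - t).
Proof.
assert (key : forall s, s <> t ->
  norm (minus (minus (f s) (f t)) (scal (RtoC (s - t)) l)) =
  Rabs (s - t) * norm (minus (scal (RtoC (/ (s - t))) (minus (f s) (f t))) l)).
{ intros s hs. rewrite <- norm_scalR. apply (f_equal norm). vec. field. lra. }
split; intros h eps he.
- destruct (h eps he) as [d [hd hf]]. exists d. split; [exact hd|].
  intros s hs hst hsd. rewrite key by exact hst. rewrite Rmult_comm.
  apply Rmult_le_compat_r; [apply Rabs_pos|]. left. now apply hf.
- destruct (h (eps / 2)) as [d [hd hf]]; [lra|]. exists d. split; [exact hd|].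
  intros s hs hst hsd. specialize (hf s hs hst hsd). rewrite key in hf by exact hst.
  assert (0 < Rabs (s - t)) by (apply Rabs_pos_lt; lra).
  apply Rle_lt_trans with (eps / 2); [|lra].
  apply Rmult_le_reg_l with (Rabs (s - t)); [assumption|]. lra.
Qed.

Lemma deriv_at_linear (H1 H2 : Hilbert) (L : H1 -> H2) (I : R -> Prop) (f : R -> H1)
  (t : R) (l : H1) :
  is_linear L -> deriv_at I f t l -> deriv_at I (fun s => L (f s)) t (L l).
Proof.
intros hL. rewrite !deriv_at_bound. intros h eps he.
destruct (linear_bound _ _ L hL) as [M [hM hb]].
destruct (h (eps / M)) as [d [hd hf]]; [now apply Rdiv_lt_0_compat|].
exists d. split; [exact hd|]. intros s hs hst hsd. specialize (hf s hs hst hsd).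
assert (e : minus (minus (L (f s)) (L (f t))) (scal (RtoC (s - t)) (L l)) =
  L (minus (minus (f s) (f t)) (scal (RtoC (s - t)) l))).
{ rewrite !(linear_minus L _ _ hL). f_equal. symmetry. apply (linear_scal L hL). }
eapply Rle_trans; [right; exact (f_equal norm e)|]. eapply Rle_trans; [apply hb|].
replace (eps * Rabs (s - t)) with (M * (eps / M * Rabs (s - t))) by (field; lra).
apply Rmult_le_compat_l; lra.
Qed.

Lemma deriv_at_minus (H : Hilbert) (I : R -> Prop) (f g : R -> H) (t : R) (l m : H) :
  deriv_at I f t l -> deriv_at I g t m ->
  deriv_at I (fun s => minus (f s) (g s)) t (minus l m).
Proof.
rewrite !deriv_at_bound. intros hf hg eps he.
destruct (hf (eps / 2)) as [d [hd h1]]; [lra|].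
destruct (hg (eps / 2)) as [d' [hd' h2]]; [lra|].
exists (Rmin d d'). split; [now apply Rmin_pos|]. intros s hs hst hsd.
pose proof (Rmin_l d d'). pose proof (Rmin_r d d').
specialize (h1 s hs hst ltac:(lra)). specialize (h2 s hs hst ltac:(lra)).
norm_as (minus (minus (minus (f s) (f t)) (scal (RtoC (s - t)) l))
  (minus (minus (g s) (g t)) (scal (RtoC (s - t)) m))).
eapply Rle_trans; [apply norm_minus_le|]. lra.
Qed.

Lemma deriv_at_subset (H : Hilbert) (I J : R -> Prop) (f : R -> H) (t : R) (l : H) :
  (forall s, J s -> I s) -> deriv_at I f t l -> deriv_at J f t l.
Proof.
intros hJ h eps he. destruct (h eps he) as [d [hd hf]]. exists d.
split; [exact hd|]. auto.
Qed.

Lemma deriv_at_ext (H : Hilbert) (I : R -> Prop) (f g : R -> H) (t : R) (l : H) :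
  I t -> (forall s, I s -> f s = g s) -> deriv_at I f t l -> deriv_at I g t l.
Proof.
intros ht e h eps he. destruct (h eps he) as [d [hd hf]]. exists d.
split; [exact hd|]. intros s hs. rewrite <- !e by assumption. now apply hf.
Qed.

Lemma deriv_at_shift (H : Hilbert) (I : R -> Prop) (f : R -> H) (r t : R) (l : H) :
  deriv_at I f (r + t) l -> deriv_at (fun s => I (r + s)) (fun s => f (r + s)) t l.
Proof.
intros h eps he. destruct (h eps he) as [d [hd hf]]. exists d.
split; [exact hd|]. intros s hs hst hsd.
replace (s - t) with (r + s - (r + t)) by ring.
apply hf; [exact hs|lra|]. now replace (r + s - (r + t)) with (s - t) by ring.
Qed.

Lemma rderiv_at_normsq (H : Hilbert) (I : R -> Prop) (f : R -> H) (t : R) (l : H) :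
  deriv_at I f t l -> rderiv_at I (fun s => norm (f s) ^ 2) t (2 * dot l (f t)).
Proof.
rewrite deriv_at_bound. intros h eps he.
set (A := norm l + 1). set (B := 2 * norm (f t) + 1).
assert (hA : 1 <= A) by (unfold A; pose proof (norm_pos _ l); lra).
assert (hB : 1 <= B) by (unfold B; pose proof (norm_pos _ (f t)); lra).
destruct (h (Rmin 1 (eps / 2 / B))) as [d [hd hf]].
{ apply Rmin_pos; [lra|]. apply Rdiv_lt_0_compat; lra. }
exists (Rmin d (eps / 2 / A ^ 2)). split.
{ apply Rmin_pos; [exact hd|]. apply Rdiv_lt_0_compat; [lra|]. nra. }
intros s hs hst hsd.
pose proof (Rmin_l d (eps / 2 / A ^ 2)). pose proof (Rmin_r d (eps / 2 / A ^ 2)).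
specialize (hf s hs hst ltac:(lra)).
pose proof (Rmin_l 1 (eps / 2 / B)) as m1. pose proof (Rmin_r 1 (eps / 2 / B)) as m2.
set (r := Rabs (s - t)) in *. assert (hr : 0 <= r) by apply Rabs_pos.
set (w := minus (minus (f s) (f t)) (scal (RtoC (s - t)) l)) in *.
set (v := minus (f s) (f t)).
assert (hv : norm v <= A * r).
{ pose proof (norm_le_mid _ (scal (RtoC (s - t)) l) v) as h1.
  rewrite norm_scalR in h1. fold r in h1. change (minus v _) with w in h1.
  unfold A. nra. }
(* Exact expansion in the increment [v] and its first-order error [w]: the first term is quadratic
   in [s - t], the second is small by differentiability. *)
assert (e : norm (f s) ^ 2 - norm (f t) ^ 2 - 2 * dot l (f t) * (s - t) =
  norm v ^ 2 + 2 * dot w (f t)).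
{ rewrite !normsq. unfold v, w. dots. rewrite (dot_sym _ (f t) (f s)). ring. }
rewrite e. eapply Rle_trans; [apply Rabs_triang|].
rewrite Rabs_pos_eq by apply pow2_ge_0. rewrite Rabs_mult, (Rabs_pos_eq 2) by lra.
pose proof (dot_abs _ w (f t)) as h2.
assert (h3 : norm v ^ 2 <= eps / 2 * r).
{ apply Rle_trans with ((A * r) ^ 2).
  - apply pow_incr. split; [apply norm_pos|exact hv].
  - replace ((A * r) ^ 2) with (A ^ 2 * r * r) by ring.
    apply Rmult_le_compat_r; [exact hr|].
    apply Rle_trans with (A ^ 2 * (eps / 2 / A ^ 2)).
    + apply Rmult_le_compat_l; [apply pow2_ge_0|lra].
    + right. field. lra. }
assert (h4 : norm w * B <= eps / 2 * r).
{ apply Rle_trans with (eps / 2 / B * r * B).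
  - apply Rmult_le_compat_r; [lra|]. eapply Rle_trans; [exact hf|].
    apply Rmult_le_compat_r; lra.
  - right. field. lra. }
pose proof (norm_pos _ w). unfold B in h4. lra.
Qed.

Lemma rderiv_at_lincomb (I : R -> Prop) (f g : R -> R) (t l m k : R) :
  rderiv_at I f t l -> rderiv_at I g t m ->
  rderiv_at I (fun s => f s + k * g s) t (l + k * m).
Proof.
intros hf hg eps he. assert (hk : 0 < Rabs k + 1) by (pose proof (Rabs_pos k); lra).
destruct (hf (eps / 2)) as [d [hd h1]]; [lra|].
destruct (hg (eps / 2 / (Rabs k + 1))) as [d' [hd' h2]].
{ apply Rdiv_lt_0_compat; lra. }
exists (Rmin d d'). split; [now apply Rmin_pos|]. intros s hs hst hsd.
pose proof (Rmin_l d d'). pose proof (Rmin_r d d').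
specialize (h1 s hs hst ltac:(lra)). specialize (h2 s hs hst ltac:(lra)).
replace (_ - _ - _) with ((f s - f t - l * (s - t)) + k * (g s - g t - m * (s - t)))
  by ring.
eapply Rle_trans; [apply Rabs_triang|]. rewrite (Rabs_mult k).
set (r := Rabs (s - t)) in *. assert (hr : 0 <= r) by apply Rabs_pos.
set (b := Rabs (g s - g t - m * (s - t))) in *. assert (0 <= b) by apply Rabs_pos.
assert (Rabs k * b <= eps / 2 * r).
{ apply Rle_trans with ((Rabs k + 1) * (eps / 2 / (Rabs k + 1) * r)).
  - apply Rmult_le_compat; [apply Rabs_pos|assumption|lra|exact h2].
  - right. field. lra. }
lra.
Qed.

Lemma rderiv_at_continuous (I : R -> Prop) (f : R -> R) (t l : R) :
  rderiv_at I f t l -> forall eps, 0 < eps -> exists d, 0 < d /\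
    forall s, I s -> Rabs (s - t) < d -> Rabs (f s - f t) < eps.
Proof.
intros h eps he. destruct (h 1 Rlt_0_1) as [d [hd hf]].
set (A := Rabs l + 1). assert (hA : 1 <= A) by (unfold A; pose proof (Rabs_pos l); lra).
exists (Rmin d (eps / A)). split; [apply Rmin_pos; [exact hd|apply Rdiv_lt_0_compat; lra]|].
intros s hs hsd. pose proof (Rmin_l d (eps / A)). pose proof (Rmin_r d (eps / A)).
destruct (Req_dec s t) as [->|hst]; [rewrite Rminus_diag, Rabs_R0; exact he|].
specialize (hf s hs hst ltac:(lra)).
replace (f s - f t) with ((f s - f t - l * (s - t)) + l * (s - t)) by ring.
eapply Rle_lt_trans; [apply Rabs_triang|]. rewrite (Rabs_mult l).
apply Rle_lt_trans with (A * Rabs (s - t)); [unfold A; lra|].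
replace eps with (A * (eps / A)) by (field; lra). apply Rmult_lt_compat_l; lra.
Qed.

Lemma clamp_lip (a b s t : R) : a <= b ->
  Rabs (Rmax a (Rmin b s) - Rmax a (Rmin b t)) <= Rabs (s - t).
Proof.
intros hab. unfold Rmax, Rmin.
repeat destruct Rle_dec; unfold Rabs; repeat destruct Rcase_abs; lra.
Qed.

Lemma clamp_in (a b s : R) : a <= b -> a <= Rmax a (Rmin b s) <= b.
Proof.
intros hab. split; [apply Rmax_l|]. apply Rmax_lub; [exact hab|apply Rmin_l].
Qed.

Lemma clamp_id (a b s : R) : a <= s <= b -> Rmax a (Rmin b s) = s.
Proof. intros h. rewrite Rmin_right, Rmax_right; lra. Qed.

(** Clamping the argument extends [f] continuously past the end points. The classical theorem then
    needs derivatives only in the open interval, where relative and two-sided derivatives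
    coincide. *)
Lemma mvt_closed (f f' : R -> R) (a b : R) : a <= b ->
  (forall t, a <= t <= b -> rderiv_at (fun s => a <= s <= b) f t (f' t)) ->
  exists c, a <= c <= b /\ f b - f a = f' c * (b - a).
Proof.
intros hab hf. set (g := fun s => f (Rmax a (Rmin b s))).
destruct (MVT_gen g a b f') as [c [hc e]].
- rewrite Rmin_left, Rmax_right by exact hab. intros t ht.
  apply is_derive_Reals. intros eps he.
  destruct (hf t ltac:(lra) (eps / 2)) as [d [hd h1]]; [lra|].
  assert (hm : 0 < Rmin d (Rmin (t - a) (b - t))).
  { apply Rmin_pos; [exact hd|]. apply Rmin_pos; lra. }
  exists (mkposreal _ hm). simpl. intros h h0 hh.
  pose proof (Rmin_l d (Rmin (t - a) (b - t))).
  pose proof (Rmin_r d (Rmin (t - a) (b - t))).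
  pose proof (Rmin_l (t - a) (b - t)). pose proof (Rmin_r (t - a) (b - t)).
  pose proof (Rle_abs h). pose proof (Rle_abs (- h)) as h5. rewrite Rabs_Ropp in h5.
  unfold g. rewrite !clamp_id by lra.
  specialize (h1 (t + h) ltac:(lra) ltac:(lra)).
  replace (t + h - t) with h in h1 by ring. specialize (h1 ltac:(lra)).
  replace ((f (t + h) - f t) / h - f' t) with ((f (t + h) - f t - f' t * h) / h)
    by (field; exact h0).
  unfold Rdiv. rewrite Rabs_mult, Rabs_inv.
  assert (0 < Rabs h) by now apply Rabs_pos_lt.
  apply Rle_lt_trans with (eps / 2); [|lra].
  apply Rmult_le_reg_r with (Rabs h); [assumption|].
  rewrite Rmult_assoc, Rinv_l, Rmult_1_r by lra. exact h1.
- intros t _. intros eps he.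
  destruct (rderiv_at_continuous _ _ _ _ (hf _ (clamp_in a b t hab)) eps he)
    as [d [hd h1]].
  exists d. split; [exact hd|]. intros s [_ hs]. apply h1; [now apply clamp_in|].
  eapply Rle_lt_trans; [apply clamp_lip; exact hab|exact hs].
- rewrite Rmin_left, Rmax_right in hc by exact hab. exists c. split; [exact hc|].
  unfold g in e. rewrite !clamp_id in e by lra. exact e.
Qed.

Lemma nonincreasing_closed (f f' : R -> R) (a b : R) : a <= b ->
  (forall t, a <= t <= b -> rderiv_at (fun s => a <= s <= b) f t (f' t)) ->
  (forall t, a <= t <= b -> f' t <= 0) -> f b <= f a.
Proof.
intros hab hf h0. destruct (mvt_closed f f' a b hab hf) as [c [hc e]].
specialize (h0 c hc). nra.
Qed.

Section Generator.

Variables (X : Hilbert) (G : X -> X -> Prop) (T : R -> X -> X).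
Hypothesis gen : generates G T.

Lemma generator_orbit (x y : X) (t : R) : 0 <= t -> G x y -> G (T t x) (T t y).
Proof.
intros ht hxy. destruct gen as [sg hG]. apply hG. apply hG in hxy.
pose proof (proj1 sg t ht) as hL.
pose proof (filterlim_linear X X _ (T t) _ _ hL hxy) as h.
eapply filterlim_within_ext; [|exact h]. intros s hs. simpl.
rewrite (linear_scal (T t) hL), (linear_minus (T t) _ _ hL).
destruct sg as [_ [_ [ha _]]]. rewrite <- !ha by lra.
now rewrite (Rplus_comm s t).
Qed.

(** The generator only provides a right derivative at 0. Taking [T u] out at the earlier time turns
    both one-sided quotients into it; for [s < t] the value is [T s y], and strong continuity moves
    it to [T t y]. *)
Lemma generator_deriv (x y : X) (t : R) : 0 <= t -> G x y ->
  deriv_at (fun s => 0 <= s) (fun s => T s x) t (T t y).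
Proof.
intros ht hxy. destruct gen as [sg hG]. apply hG in hxy.
pose proof (proj1 (at_right_nlim X _ _) hxy) as hq.
destruct (semigroup_locally_bounded X T sg (t + 1)) as [M [hM hb]].
intros eps he.
destruct (hq (eps / 2 / M)) as [d [hd h1]]; [apply Rdiv_lt_0_compat; lra|].
destruct (semigroup_continuous X T sg y t (eps / 2) ht) as [d' [hd' h2]]; [lra|].
assert (ha : forall u v, 0 <= u <= v -> T v x = T u (T (v - u) x)).
{ intros u v huv. replace v with (u + (v - u)) at 1 by ring. apply sg; lra. }
assert (key : forall u v, 0 <= u < v -> u <= t + 1 -> v - u < d ->
  norm (minus (scal (RtoC (/ (v - u))) (minus (T v x) (T u x))) (T u y)) < eps / 2).
{ intros u v huv hu hvu. rewrite (ha u v) by lra.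
  pose proof (proj1 sg u (proj1 huv)) as hL.
  set (z := minus (scal (RtoC (/ (v - u))) (minus (T (v - u) x) x)) y).
  apply Rle_lt_trans with (norm (T u z)).
  { right. apply (f_equal norm). unfold z.
    rewrite (linear_minus (T u) _ _ hL). apply f_equal2; [|reflexivity].
    rewrite (linear_scal (T u) hL), (linear_minus (T u) _ _ hL). reflexivity. }
  eapply Rle_lt_trans; [apply hb; lra|].
  replace (eps / 2) with (M * (eps / 2 / M)) by (field; lra).
  apply Rmult_lt_compat_l; [lra|]. apply h1. lra. }
exists (Rmin 1 (Rmin d d')). split.
{ apply Rmin_pos; [lra|]. now apply Rmin_pos. }
intros s hs hst hsd.
pose proof (Rmin_l 1 (Rmin d d')). pose proof (Rmin_r 1 (Rmin d d')).
pose proof (Rmin_l d d'). pose proof (Rmin_r d d').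
destruct (Rlt_le_dec t s) as [h|h].
- rewrite Rabs_pos_eq in hsd by lra.
  assert (norm (minus (scal (RtoC (/ (s - t))) (minus (T s x) (T t x))) (T t y)) < eps / 2);
    [|lra].
  apply key; lra.
- assert (hlt : s < t) by lra. specialize (h2 s hs ltac:(lra)).
  rewrite Rabs_left in hsd by lra. specialize (key s t ltac:(lra) ltac:(lra) ltac:(lra)).
  norm_as (plus (minus (scal (RtoC (/ (t - s))) (minus (T t x) (T s x))) (T s y))
    (minus (T s y) (T t y))) by (field; lra).
  eapply Rle_lt_trans; [apply hnorm_plus|]. lra.
Qed.

(** The averages of the orbit over short intervals starting at 0 lie in the domain and tend to
    [x]. *)
Lemma generator_dense (x : X) : adherent (fun z => exists y, G z y) x.
Proof.
destruct gen as [sg hG].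
pose proof (proj1 (at_right_nlim X _ _)
  (primitive_quotient X T sg x 0 (Rle_refl 0))) as h.
intros eps he. destruct (h eps he) as [d [hd h1]].
specialize (h1 (d / 2) ltac:(lra)).
assert (e0 : T 0 x = x) by apply sg.
rewrite primitive_0, Rplus_0_l, e0 in h1.
exists (scal (RtoC (/ (d / 2))) (primitive X T x (d / 2))). split.
- exists (scal (RtoC (/ (d / 2))) (minus (T (d / 2) x) x)). apply hG.
  pose proof (semigroup_primitive_quotient X T sg x (d / 2) ltac:(lra)) as hp.
  assert (hr : filterlim (fun _ : R => / (d / 2)) (at_right 0) (locally (/ (d / 2))))
    by apply filterlim_const.
  pose proof (filterlim_Rscal X _ _ _ _ _ hr hp) as h2.
  eapply filterlim_within_ext; [|exact h2]. intros s hs. simpl.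
  rewrite (semigroup_Rscal X T sg) by lra. vec.
- rewrite norm_minus_sym. eapply Rle_lt_trans; [|exact h1]. right.
  apply (f_equal norm). vec.
Qed.

End Generator.

Lemma semigroup_rescaled (X : Hilbert) (T : R -> X -> X) (l : R) :
  C0_semigroup T -> C0_semigroup (fun t x => scal (RtoC (exp (- l * t))) (T t x)).
Proof.
intros [hl [h0 [ha hc]]]. split; [|split; [|split]].
- intros t ht. exact (@is_linear_comp C_AbsRing X X X (T t) _ (hl t ht)
    (@is_linear_scal_r C_AbsRing X (RtoC (exp (- l * t))) Cmult_comm)).
- intros x. rewrite h0. replace (- l * 0) with 0 by ring. rewrite exp_0. vec.
- intros s t hs ht x. rewrite ha by assumption.
  replace (- l * (s + t)) with (- l * s + - l * t) by ring. rewrite exp_plus.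
  rewrite (linear_scal (T s) (hl s hs)). vec.
- intros x. assert (he : filterlim (fun t => exp (- l * t)) (at_right 0) (locally 1)).
  { replace 1 with (exp (- l * 0)) by (rewrite Rmult_0_r, exp_0; reflexivity).
    apply (filterlim_filter_le_1 (F := locally 0)); [apply filter_le_within|].
    apply (ex_derive_continuous (fun t => exp (- l * t)) 0). auto_derive. exact I. }
  pose proof (filterlim_Rscal X _ _ _ _ _ he (hc x)) as h.
  replace (scal (RtoC 1) x) with x in h by vec. exact h.
Qed.

(** An integral over one period replaces the Laplace transform over the half-line. The rescaled
    semigroup [S] has norm at most one half at time [d], so [x = f + S d x] is solvable. The
    generator [G - l] of [S] maps the integral of the orbit of [x] over [[0, d]] to
    [S d x - x = - f]. *)
Lemma generator_range (X : Hilbert) (G : X -> X -> Prop) (T : R -> X -> X) :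
  generates G T -> exists l0, 0 < l0 /\ forall l, l0 <= l -> forall f,
    exists x y, G x y /\ minus (scal (RtoC l) x) y = f.
Proof.
intros [sg hG]. destruct (semigroup_bounded_near_0 X T sg) as [d [M [hd [hM hb]]]].
(* From this value on, [exp (- l * d)] is at most [/ (2 * M)], which beats the bound [M] of
   [T d]. *)
exists (ln (2 * M) / d + 1).
assert (hln : 0 < ln (2 * M)) by (rewrite <- ln_1; apply ln_increasing; lra).
split. { pose proof (Rdiv_lt_0_compat _ _ hln hd). lra. }
intros l hl f. set (S := fun t x => scal (RtoC (exp (- l * t))) (T t x)).
pose proof (semigroup_rescaled X T l sg) as sgS. fold S in sgS.
assert (hS : forall x, norm (S d x) <= / 2 * norm x).
{ intros x. unfold S. rewrite norm_scalR, Rabs_pos_eq by (left; apply exp_pos).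
  assert (exp (- l * d) <= / (2 * M)).
  { rewrite <- (exp_ln (2 * M)) by lra. rewrite <- exp_Ropp.
    assert (hx : - l * d <= - ln (2 * M)).
    { assert (ln (2 * M) = ln (2 * M) / d * d) by (field; lra). nra. }
    destruct hx as [hx|hx]; [left; now apply exp_increasing|rewrite hx; lra]. }
  apply Rle_trans with (/ (2 * M) * (M * norm x)).
  - apply Rmult_le_compat; [left; apply exp_pos|apply norm_pos|assumption|].
    apply hb. lra.
  - right. field. lra. }
destruct (contraction_fixpoint X (fun x => plus f (S d x)) (/ 2)) as [x hx]; [lra| |].
{ intros x y. norm_as (minus (S d x) (S d y)).
  rewrite <- (semigroup_minus X S sgS) by lra. apply hS. }
set (F := primitive X S x d).
exists F, (minus (scal (RtoC l) F) f). split; [|vec].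
apply hG.
assert (he : is_derive (fun h => exp (l * h)) 0 l).
{ auto_derive; [exact I|]. rewrite Rmult_0_r, exp_0. ring. }
assert (he1 : filterlim (fun h => exp (l * h)) (at_right 0) (locally 1)).
{ replace 1 with (exp (l * 0)) by (rewrite Rmult_0_r, exp_0; reflexivity).
  apply (filterlim_filter_le_1 (F := locally 0)); [apply filter_le_within|].
  apply (ex_derive_continuous (fun h => exp (l * h)) 0). exists l. exact he. }
assert (he2 : filterlim (fun h => (exp (l * h) - 1) / h) (at_right 0) (locally l)).
{ apply filterlim_locally. intros eps. apply is_derive_Reals in he.
  destruct (he eps (cond_pos eps)) as [dd hdd]. exists dd. intros h hh h0.
  change (Rabs (h - 0) < dd) in hh. rewrite Rminus_0_r in hh.
  specialize (hdd h ltac:(lra) hh).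
  rewrite Rplus_0_l, Rmult_0_r, exp_0 in hdd. exact hdd. }
pose proof (semigroup_primitive_quotient X S sgS x d ltac:(lra)) as hp. fold F in hp.
assert (hc : filterlim (fun _ : R => F) (at_right 0) (locally F)) by apply filterlim_const.
(* Undoing the rescaling splits the quotient of [T] at [F] into [exp (l * s)] times the quotient of
   [S] and the quotient of the exponential times [F]. *)
pose proof (filterlim_Hplus X _ _ _ _ _ (filterlim_Rscal X _ _ _ _ _ he1 hp)
  (filterlim_Rscal X _ _ _ _ _ he2 hc)) as h.
assert (e : plus (scal (RtoC 1) (minus (S d x) x)) (scal (RtoC l) F) =
  minus (scal (RtoC l) F) f).
{ assert (e : x = plus f (S d x)) by (symmetry; exact hx).
  rewrite e at 2. vec. }
pose proof (eq_ind _ (fun v : X => filterlim (fun s => plus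
    (scal (RtoC (exp (l * s))) (scal (RtoC (/ s)) (minus (S s F) F)))
    (scal (RtoC ((exp (l * s) - 1) / s)) F)) (at_right 0) (locally v)) h _ e) as h'.
eapply filterlim_within_ext; [|exact h']. intros s hs. simpl. unfold S.
apply dot_ext. intros z. dots.
replace (- l * s) with (- (l * s)) by ring. rewrite exp_Ropp.
pose proof (exp_pos (l * s)). field. lra.
Qed.

(** * Energy balances on a closed time interval *)

Lemma clamp_continuous (V : UniformSpace) (tau : R) (f : R -> V) (t : R) : 0 <= tau ->
  continuous_on (interval tau) f -> continuous (fun s => f (Rmax 0 (Rmin tau s))) t.
Proof.
intros htau hf. unfold continuous.
apply (filterlim_comp _ _ _ (fun s => Rmax 0 (Rmin tau s)) f (locally t)
  (within (interval tau) (locally (Rmax 0 (Rmin tau t))))).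
- intros P [d hd]. exists d. intros s hs. apply hd; [|now apply clamp_in].
  eapply Rle_lt_trans; [apply clamp_lip; exact htau|exact hs].
- apply hf. now apply clamp_in.
Qed.

Lemma continuous_normsq (H : Hilbert) (f : R -> H) (t : R) :
  continuous f t -> continuous (fun s => norm (f s) ^ 2) t.
Proof.
intros hf.
assert (h : continuous (fun s => norm (f s)) t).
{ exact (filterlim_comp _ _ _ f norm _ _ _ hf (@filterlim_norm C_AbsRing H (f t))). }
apply (continuous_ext (fun s => norm (f s) * norm (f s))).
- intros s. simpl. ring.
- exact (continuous_mult _ _ t h h).
Qed.

Lemma is_derive_rderiv_at (I : R -> Prop) (f : R -> R) (t l : R) :
  is_derive f t l -> rderiv_at I f t l.
Proof.
intros h eps he. apply is_derive_Reals in h. destruct (h eps he) as [d hd].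
exists d. split; [apply cond_pos|]. intros s _ hst hs.
specialize (hd (s - t) ltac:(lra) hs). replace (t + (s - t)) with s in hd by ring.
replace (f s - f t - l * (s - t)) with (((f s - f t) / (s - t) - l) * (s - t))
  by (field; lra).
rewrite Rabs_mult. apply Rmult_le_compat_r; [apply Rabs_pos|]. now left.
Qed.

(** [V] plus [ka] times the integral of [a] minus [kb] times that of [b] is nonincreasing. Clamped
    integrands are continuous on the whole line, which makes their primitives differentiable at the
    end points too. *)
Lemma energy_integral (tau ka kb : R) (V V' a b : R -> R) : 0 <= tau ->
  (forall t, interval tau t -> rderiv_at (interval tau) V t (V' t)) ->
  (forall t, interval tau t -> V' t <= kb * b t - ka * a t) ->
  (forall t, continuous (fun s => a (Rmax 0 (Rmin tau s))) t) ->
  (forall t, continuous (fun s => b (Rmax 0 (Rmin tau s))) t) ->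
  V tau + ka * RInt a 0 tau <= V 0 + kb * RInt b 0 tau.
Proof.
intros htau hV hle ha hb.
set (ca := fun s => a (Rmax 0 (Rmin tau s))) in *.
set (cb := fun s => b (Rmax 0 (Rmin tau s))) in *.
assert (ea : RInt a 0 tau = RInt ca 0 tau).
{ apply RInt_ext. rewrite Rmin_left, Rmax_right by exact htau. intros s hs.
  unfold ca. now rewrite clamp_id by lra. }
assert (eb : RInt b 0 tau = RInt cb 0 tau).
{ apply RInt_ext. rewrite Rmin_left, Rmax_right by exact htau. intros s hs.
  unfold cb. now rewrite clamp_id by lra. }
rewrite ea, eb.
assert (ha' : forall u v, ex_RInt ca u v)
  by (intros; apply (@ex_RInt_continuous R_CompleteNormedModule); auto).
assert (hb' : forall u v, ex_RInt cb u v)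
  by (intros; apply (@ex_RInt_continuous R_CompleteNormedModule); auto).
assert (hprim : forall c : R -> R, (forall t, continuous c t) ->
  (forall u v, ex_RInt c u v) -> forall t, is_derive (fun t => RInt c 0 t) t (c t)).
{ intros c hc hc' t. apply (is_derive_RInt c _ 0); [|apply hc].
  apply filter_forall. intros u. apply (@RInt_correct R_CompleteNormedModule), hc'. }
assert (h : (V tau + ka * RInt ca 0 tau) + - kb * RInt cb 0 tau <=
  (V 0 + ka * RInt ca 0 0) + - kb * RInt cb 0 0).
{ apply (nonincreasing_closed (fun t => (V t + ka * RInt ca 0 t) + - kb * RInt cb 0 t)
    (fun t => (V' t + ka * ca t) + - kb * cb t) 0 tau htau).
  - intros t ht. apply rderiv_at_lincomb; [apply rderiv_at_lincomb; [now apply hV|]|];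
      apply is_derive_rderiv_at, hprim; assumption.
  - intros t ht. pose proof (hle t ht). unfold ca, cb. rewrite clamp_id by exact ht.
    lra. }
rewrite !(@RInt_point R_CompleteNormedModule) in h.
change (@zero R_CompleteNormedModule) with 0 in h. lra.
Qed.

Lemma RInt_clamp_ge_0 (tau : R) (f : R -> R) : 0 <= tau -> (forall t, 0 <= f t) ->
  (forall t, continuous (fun s => f (Rmax 0 (Rmin tau s))) t) -> 0 <= RInt f 0 tau.
Proof.
intros htau h0 hf.
rewrite (RInt_ext f (fun s => f (Rmax 0 (Rmin tau s)))).
- apply RInt_ge_0; [exact htau| |intros; apply h0].
  apply (@ex_RInt_continuous R_CompleteNormedModule). auto.
- rewrite Rmin_left, Rmax_right by exact htau. intros s hs. now rewrite clamp_id by lra.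
Qed.

Lemma deriv_at_continuous (H : Hilbert) (I : R -> Prop) (f : R -> H) (t : R) (l : H) :
  I t -> deriv_at I f t l -> filterlim f (within I (locally t)) (locally (f t)).
Proof.
intros ht h.
assert (FF : Filter (within I (locally t))) by apply within_filter, locally_filter.
apply (proj2 (filterlim_nlim f (within I (locally t)) (f t))). intros eps he.
rewrite deriv_at_bound in h. destruct (h 1 Rlt_0_1) as [d [hd hf]].
set (A := norm l + 1). assert (hA : 1 <= A) by (unfold A; pose proof (norm_pos _ l); lra).
assert (hm : 0 < Rmin d (eps / A)).
{ apply Rmin_pos; [exact hd|apply Rdiv_lt_0_compat; lra]. }
exists (mkposreal _ hm). intros s hs hIs. change (Rabs (s - t) < Rmin d (eps / A)) in hs.
pose proof (Rmin_l d (eps / A)). pose proof (Rmin_r d (eps / A)).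
destruct (Req_dec s t) as [->|hst].
{ replace (minus (f t) (f t)) with (@zero H) by vec. now rewrite hnorm0. }
specialize (hf s hIs hst ltac:(lra)).
pose proof (norm_le_mid _ (scal (RtoC (s - t)) l) (minus (f s) (f t))) as h1.
rewrite norm_scalR in h1.
apply Rle_lt_trans with (A * Rabs (s - t)); [unfold A; lra|].
replace eps with (A * (eps / A)) by (field; lra). apply Rmult_lt_compat_l; lra.
Qed.

(** * The Lumer-Phillips theorem *)

Lemma dense_eq (H : Hilbert) (S : H -> Prop) (f g : H -> H) :
  (forall x, adherent S x) ->
  (forall x y, norm (minus (f x) (f y)) <= norm (minus x y)) ->
  (forall x y, norm (minus (g x) (g y)) <= norm (minus x y)) ->
  (forall x, S x -> f x = g x) -> forall x, f x = g x.
Proof.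
intros hS hf hg e x. apply minus_eq0, le_epsilon. intros eps he.
destruct (hS x (eps / 2)) as [s [hs hxs]]; [lra|].
pose proof (norm_tri_mid _ (f s) (f x) (g x)) as h.
pose proof (hf x s). pose proof (hg s x). rewrite (e s hs) in h at 2.
rewrite (norm_minus_sym _ s x) in *. lra.
Qed.

Lemma iter_double {A : Type} (f : A -> A) (n : nat) (x : A) :
  Nat.iter (2 * n) f x = Nat.iter n (fun v => f (f v)) x.
Proof.
induction n as [|n IH]; [reflexivity|].
replace (2 * S n)%nat with (S (S (2 * n))) by lia. simpl Nat.iter in *.
f_equal. f_equal. exact IH.
Qed.

Lemma iter_commute {A : Type} (f g : A -> A) (n : nat) (x : A) :
  (forall v, f (g v) = g (f v)) -> Nat.iter n f (g x) = g (Nat.iter n f x).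
Proof. intros h. induction n as [|n IH]; [reflexivity|]. simpl. rewrite IH. apply h. Qed.

Lemma iter_compose {A : Type} (f g : A -> A) (n : nat) (x : A) :
  (forall v, f (g v) = g (f v)) ->
  Nat.iter n f (Nat.iter n g x) = Nat.iter n (fun v => f (g v)) x.
Proof.
intros h. induction n as [|n IH]; [reflexivity|]. simpl.
rewrite iter_commute by exact h. now rewrite IH.
Qed.

(** Telescoping: each step adds the error at a point of the [Q]-orbit, and later steps of the
    nonexpansive [P] do not amplify it. [W] is where the error bound is available, hence the
    invariance under [Q]. *)
Lemma iter_diff (H : Hilbert) (W : H -> Prop) (P Q : H -> H) (e : R) (n : nat) (x : H) :
  (forall u v, norm (minus (P u) (P v)) <= norm (minus u v)) ->
  (forall v, W v -> W (Q v)) ->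
  (forall v, W v -> norm (minus (P v) (Q v)) <= e) -> W x ->
  norm (minus (Nat.iter n P x) (Nat.iter n Q x)) <= INR n * e.
Proof.
intros hP hQ hPQ hx.
assert (hW : forall k, W (Nat.iter k Q x))
  by (induction k as [|k IH]; [exact hx|simpl; auto]).
induction n as [|n IH].
- simpl. replace (minus x x) with (@zero H) by vec. rewrite hnorm0. lra.
- rewrite S_INR. simpl Nat.iter.
  eapply Rle_trans; [apply (norm_tri_mid _ (P (Nat.iter n Q x)))|].
  pose proof (hP (Nat.iter n P x) (Nat.iter n Q x)). pose proof (hPQ _ (hW n)). lra.
Qed.

Section LumerPhillips.

Variables (X : Hilbert) (G : X -> X -> Prop).
Hypothesis Gplus : forall x y x' y', G x y -> G x' y' -> G (plus x x') (plus y y').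
Hypothesis Gscal : forall (k : C) x y, G x y -> G (scal k x) (scal k y).
Hypothesis Gfun : forall x y y', G x y -> G x y' -> y = y'.
Hypothesis Gdis : forall x y, G x y -> dot y x <= 0.
Hypothesis Grange : exists l0, 0 < l0 /\ forall l, l0 <= l -> forall f : X,
  exists x y, G x y /\ minus (scal (RtoC l) x) y = f.

Lemma dissipative_minus (x y x' y' : X) :
  G x y -> G x' y' -> G (minus x x') (minus y y').
Proof.
intros h h'. apply (Gscal (RtoC (-1))) in h'. pose proof (Gplus _ _ _ _ h h') as h1.
replace (minus x x') with (plus x (scal (RtoC (-1)) x')) by vec.
replace (minus y y') with (plus y (scal (RtoC (-1)) y')) by vec. exact h1.
Qed.

Lemma dissipative_lower_bound (l : R) (x y : X) :
  0 < l -> G x y -> l * norm x <= norm (minus (scal (RtoC l) x) y).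
Proof.
intros hl h. pose proof (Gdis _ _ h) as hd.
pose proof (dot_le _ (minus (scal (RtoC l) x) y) x) as h1. dots_in h1.
rewrite <- normsq in h1. pose proof (norm_pos _ x).
pose proof (norm_pos _ (minus (scal (RtoC l) x) y)).
destruct (Req_dec (norm x) 0) as [e|e]; [rewrite e; lra|].
apply Rmult_le_reg_r with (norm x); [lra|]. nra.
Qed.

(** From [l0] one reaches every smaller positive [l] in a single step: the equation at [l] is a
    fixed point equation for the resolvent at [l0], with ratio [(l0 - l) / l0] by dissipativity. *)
Lemma dissipative_range (l : R) : 0 < l -> forall f,
  exists x y, G x y /\ minus (scal (RtoC l) x) y = f.
Proof.
intros hl f. destruct Grange as [l0 [hl0 hr]].
destruct (Rle_lt_dec l0 l) as [h|h]; [now apply hr|].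
assert (hr0 : forall f, exists x, exists y, G x y /\ minus (scal (RtoC l0) x) y = f)
  by (intros; apply hr; lra).
destruct (choice _ hr0) as [R0 hR0].
destruct (contraction_fixpoint X (fun x => R0 (plus f (scal (RtoC (l0 - l)) x)))
  ((l0 - l) / l0)) as [x hx].
- split.
  + apply Rmult_le_pos; [lra|]. left. now apply Rinv_0_lt_compat.
  + apply Rmult_lt_reg_r with l0; [lra|]. unfold Rdiv.
    rewrite Rmult_assoc, Rinv_l by lra. lra.
- intros u v. cbv beta.
  destruct (hR0 (plus f (scal (RtoC (l0 - l)) u))) as [y [h1 e1]].
  destruct (hR0 (plus f (scal (RtoC (l0 - l)) v))) as [y' [h2 e2]].
  set (a := R0 (plus f (scal (RtoC (l0 - l)) u))) in *.
  set (b := R0 (plus f (scal (RtoC (l0 - l)) v))) in *.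
  pose proof (dissipative_lower_bound l0 _ _ hl0 (dissipative_minus _ _ _ _ h1 h2)) as h3.
  assert (e : minus (scal (RtoC l0) (minus a b)) (minus y y') =
    scal (RtoC (l0 - l)) (minus u v)).
  { transitivity (minus (minus (scal (RtoC l0) a) y) (minus (scal (RtoC l0) b) y'));
      [vec|]. rewrite e1, e2. vec. }
  pose proof (Rle_trans _ _ _ h3 (Req_le _ _ (f_equal norm e))) as h4.
  rewrite norm_scalR, Rabs_pos_eq in h4 by lra.
  apply Rmult_le_reg_l with l0; [exact hl0|]. eapply Rle_trans; [exact h4|].
  right. field. lra.
- destruct (hR0 (plus f (scal (RtoC (l0 - l)) x))) as [y [h1 e1]].
  cbv beta in hx. rewrite hx in *. exists x, y. split; [exact h1|].
  transitivity (minus (minus (scal (RtoC l0) x) y) (scal (RtoC (l0 - l)) x)); [vec|].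
  rewrite e1. vec.
Qed.

Lemma dissipative_graph_0 : G zero zero.
Proof.
destruct (dissipative_range 1 Rlt_0_1 zero) as [x [y [h _]]].
apply (Gscal (RtoC 0)) in h.
replace (@zero X) with (scal (RtoC 0) x) at 1 by vec.
replace (@zero X) with (scal (RtoC 0) y) by vec. exact h.
Qed.

(** If [w] is orthogonal to the domain, write [w = u - v] with [G u v]. Pairing with [u] gives
    [dot u u = dot v u <= 0], so [u] and then [w] vanish. *)
Lemma dissipative_dense (x : X) : adherent (fun z => exists y, G z y) x.
Proof.
apply dense_of_orthogonal.
- split; [exists zero; exact dissipative_graph_0|]. split.
  + intros u v [u' hu] [v' hv]. exists (plus u' v'). now apply Gplus.
  + intros r u [u' hu]. exists (scal (RtoC r) u'). now apply Gscal.
- intros w hw. destruct (dissipative_range 1 Rlt_0_1 w) as [u [v [h e]]].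
  assert (hu : u = zero).
  { apply dot_eq0. pose proof (hw u (ex_intro _ v h)) as h1. rewrite <- e in h1.
    dots_in h1. pose proof (Gdis _ _ h). lra. }
  subst u. rewrite (Gfun _ _ _ h dissipative_graph_0) in e. rewrite <- e. vec.
Qed.

(** [J h] is the backward Euler step, the inverse of [I - h G], stated through the graph. The
    convention [J 0 f = f] lets the estimates below include step size zero. *)
Lemma resolvent_exists : exists J : R -> X -> X,
  (forall f, J 0 f = f) /\
  (forall h f, 0 < h -> G (J h f) (scal (RtoC (/ h)) (minus (J h f) f))).
Proof.
assert (hex : forall a : R * X, exists x, (fst a = 0 -> x = snd a) /\
  (0 < fst a -> G x (scal (RtoC (/ fst a)) (minus x (snd a))))).
{ intros [h f]. simpl. destruct (Rlt_le_dec 0 h) as [hh|hh].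
  - destruct (dissipative_range (/ h) (Rinv_0_lt_compat _ hh) (scal (RtoC (/ h)) f))
      as [x [y [hxy e]]].
    exists x. split; [lra|]. intros _.
    replace (scal (RtoC (/ h)) (minus x f)) with y; [exact hxy|].
    transitivity (minus (scal (RtoC (/ h)) x) (minus (scal (RtoC (/ h)) x) y)); [vec|].
    rewrite e. vec.
  - exists f. split; [reflexivity|lra]. }
destruct (choice _ hex) as [J hJ]. exists (fun h f => J (h, f)). split.
- intros f. now apply (hJ (0, f)).
- intros h f hh. now apply (hJ (h, f)).
Qed.

(** * Backward Euler iterates and their convergence *)

Section Resolvent.

Variable J : R -> X -> X.
Hypothesis J_0 : forall f, J 0 f = f.
Hypothesis J_G : forall h f, 0 < h -> G (J h f) (scal (RtoC (/ h)) (minus (J h f) f)).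

Lemma resolvent_unique (h : R) (f x : X) :
  0 < h -> G x (scal (RtoC (/ h)) (minus x f)) -> J h f = x.
Proof.
intros hh hx. pose proof (Gdis _ _ (dissipative_minus _ _ _ _ (J_G h f hh) hx)) as h1.
apply minus_eq0. set (d := minus (J h f) x) in *.
assert (e : minus (scal (RtoC (/ h)) (minus (J h f) f)) (scal (RtoC (/ h)) (minus x f))
   = scal (RtoC (/ h)) d) by (unfold d; vec).
assert (h2 : dot (scal (RtoC (/ h)) d) d <= 0)
  by exact (Rle_trans _ _ _ (Req_le _ _ (f_equal (fun v => dot v d) (eq_sym e))) h1).
rewrite dot_scal_l in h2.
assert (hd : d = zero).
{ apply dot_eq0. pose proof (Rinv_0_lt_compat _ hh). nra. }
rewrite hd, hnorm0. lra.
Qed.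

Lemma resolvent_inv (h : R) (x y : X) :
  0 <= h -> G x y -> J h (minus x (scal (RtoC h) y)) = x.
Proof.
intros [hh|<-] hx.
- apply resolvent_unique; [exact hh|].
  match goal with |- G x ?a => replace a with y; [exact hx|] end.
  symmetry. vec. field. lra.
- rewrite J_0. vec.
Qed.

Lemma resolvent_plus (h : R) (f g : X) :
  0 <= h -> J h (plus f g) = plus (J h f) (J h g).
Proof.
intros [hh|<-]; [|now rewrite !J_0].
apply resolvent_unique; [exact hh|].
pose proof (Gplus _ _ _ _ (J_G h f hh) (J_G h g hh)) as h1.
match goal with |- G _ ?a => replace a with (plus (scal (RtoC (/ h)) (minus (J h f) f))
  (scal (RtoC (/ h)) (minus (J h g) g))); [exact h1|vec] end.
Qed.

Lemma resolvent_scal (h : R) (k : C) (f : X) :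
  0 <= h -> J h (scal k f) = scal k (J h f).
Proof.
intros [hh|<-]; [|now rewrite !J_0].
apply resolvent_unique; [exact hh|].
pose proof (Gscal k _ _ (J_G h f hh)) as h1.
match goal with |- G _ ?a => replace a with (scal k (scal (RtoC (/ h)) (minus (J h f) f)));
  [exact h1|cvec] end.
Qed.

Lemma resolvent_minus (h : R) (f g : X) :
  0 <= h -> J h (minus f g) = minus (J h f) (J h g).
Proof.
intros hh. replace (minus f g) with (plus f (scal (RtoC (-1)) g)) by vec.
rewrite resolvent_plus, resolvent_scal by exact hh. vec.
Qed.

Lemma resolvent_contr (h : R) (f : X) : 0 <= h -> norm (J h f) <= norm f.
Proof.
intros [hh|<-]; [|rewrite J_0; lra].
pose proof (dissipative_lower_bound (/ h) _ _ (Rinv_0_lt_compat _ hh) (J_G h f hh)) as h1.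
assert (e : minus (scal (RtoC (/ h)) (J h f)) (scal (RtoC (/ h)) (minus (J h f) f)) =
  scal (RtoC (/ h)) f) by vec.
pose proof (Rle_trans _ _ _ h1 (Req_le _ _ (f_equal norm e))) as h2.
pose proof (Rinv_0_lt_compat _ hh).
rewrite norm_scalR, Rabs_pos_eq in h2 by lra.
apply Rmult_le_reg_l with (/ h); assumption.
Qed.

Lemma resolvent_nonexp (h : R) (f g : X) :
  0 <= h -> norm (minus (J h f) (J h g)) <= norm (minus f g).
Proof. intros hh. rewrite <- resolvent_minus by exact hh. now apply resolvent_contr. Qed.

Lemma resolvent_sub (h : R) (x y : X) :
  0 <= h -> G x y -> minus (J h x) x = scal (RtoC h) (J h y).
Proof.
intros hh hx. pose proof (resolvent_inv h x y hh hx) as e.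
rewrite resolvent_minus, resolvent_scal in e by exact hh.
transitivity (minus (J h x) (minus (J h x) (scal (RtoC h) (J h y)))); [|vec].
now rewrite e.
Qed.

Lemma resolvent_graph (h : R) (x y : X) : 0 <= h -> G x y -> G (J h x) (J h y).
Proof.
intros hh hx. destruct hh as [hh|<-]; [|now rewrite !J_0].
replace (J h y) with (scal (RtoC (/ h)) (minus (J h x) x)); [now apply J_G|].
rewrite (resolvent_sub h x y (Rlt_le _ _ hh) hx). vec. field. lra.
Qed.

Lemma resolvent_comm (a b : R) (f : X) :
  0 <= a -> 0 <= b -> J a (J b f) = J b (J a f).
Proof.
intros [ha|<-] hb; [|now rewrite !J_0].
apply resolvent_unique; [exact ha|].
pose proof (resolvent_graph b _ _ hb (J_G a f ha)) as h1.
match goal with |- G _ ?y => replace y with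
  (J b (scal (RtoC (/ a)) (minus (J a f) f))); [exact h1|] end.
rewrite resolvent_scal, resolvent_minus by exact hb. reflexivity.
Qed.

Lemma resolvent_near (h : R) (x y : X) :
  0 <= h -> G x y -> norm (minus (J h x) x) <= h * norm y.
Proof.
intros hh hx. rewrite (resolvent_sub h x y hh hx).
eapply Rle_trans; [right; apply norm_scalR|]. rewrite Rabs_pos_eq by exact hh.
apply Rmult_le_compat_l; [exact hh|now apply resolvent_contr].
Qed.

(** Vectors in the domain of [G^2] with [G^2 x] bounded by [c]. There one Euler step has a
    second-order error, and resolvents preserve the set with the same [c]. *)
Let W (c : R) (x : X) : Prop := exists y z, G x y /\ G y z /\ norm z <= c.

Lemma resolvent_D2 (h c : R) (x : X) : 0 <= h -> W c x -> W c (J h x).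
Proof.
intros hh [y [z [h1 [h2 h3]]]]. exists (J h y), (J h z).
split; [now apply resolvent_graph|]. split; [now apply resolvent_graph|].
eapply Rle_trans; [now apply resolvent_contr|exact h3].
Qed.

(** The product of [I - a G] and [I - b G] differs from [I - (a + b) G] by [a b G^2]. Hence the
    difference of the resolvents is [- a b] times all three resolvents applied to [G^2 x]. *)
Lemma resolvent_add (a b c : R) (x : X) : 0 <= a -> 0 <= b -> W c x ->
  norm (minus (J a (J b x)) (J (a + b) x)) <= a * b * c.
Proof.
intros ha hb [y [z [h1 [h2 h3]]]].
set (f := minus x (scal (RtoC (a + b)) y)).
assert (e1 : J (a + b) f = x) by (apply resolvent_inv; [lra|exact h1]).
assert (e2 : J a (J b (plus f (scal (RtoC (a * b)) z))) = x).
{ pose proof (resolvent_inv a _ _ ha (dissipative_minus _ _ _ _ h1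
    (Gscal (RtoC b) _ _ h2))) as h4.
  pose proof (resolvent_inv b x y hb h1) as h5.
  assert (e : plus f (scal (RtoC (a * b)) z) = minus (minus x (scal (RtoC b) y))
    (scal (RtoC a) (minus y (scal (RtoC b) z)))) by (unfold f; vec).
  rewrite e, resolvent_comm, h4 by assumption. exact h5. }
assert (e : minus (J a (J b x)) (J (a + b) x) =
  scal (RtoC (- (a * b))) (J (a + b) (J a (J b z)))).
{ rewrite <- e1 at 1. rewrite <- e2 at 1.
  rewrite (resolvent_comm b), (resolvent_comm a) by lra.
  rewrite <- resolvent_minus by lra. rewrite <- !resolvent_minus by lra.
  rewrite <- !resolvent_scal by lra. f_equal. f_equal. f_equal. vec. }
rewrite e. eapply Rle_trans; [right; apply norm_scalR|].
rewrite Rabs_Ropp, Rabs_pos_eq by now apply Rmult_le_pos.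
apply Rmult_le_compat_l; [now apply Rmult_le_pos|].
do 3 (eapply Rle_trans; [apply resolvent_contr; lra|]). exact h3.
Qed.

Let step_size (k : nat) (t : R) : R := t / 2 ^ k.

Lemma pow2_pos (k : nat) : 0 < 2 ^ k.
Proof. apply pow_lt. lra. Qed.

Lemma step_size_pos (k : nat) (t : R) : 0 <= t -> 0 <= step_size k t.
Proof.
intros ht. apply Rmult_le_pos; [exact ht|]. left. apply Rinv_0_lt_compat, pow2_pos.
Qed.

Lemma INR_pow2 (k : nat) : INR (2 ^ k) = 2 ^ k.
Proof. rewrite pow_INR. simpl. f_equal. Qed.

(** Dyadic step numbers make each refinement halve every step, so successive differences on [W c]
    decrease geometrically and partitions are compared only by doubling. *)
Definition euler (k : nat) (t : R) (x : X) : X := Nat.iter (2 ^ k) (J (step_size k t)) x.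

Lemma euler_nonexp (k : nat) (t : R) (x y : X) :
  0 <= t -> norm (minus (euler k t x) (euler k t y)) <= norm (minus x y).
Proof.
intros ht. unfold euler. induction (2 ^ k)%nat as [|n IH]; simpl; [lra|].
eapply Rle_trans; [apply resolvent_nonexp, step_size_pos, ht|exact IH].
Qed.

Lemma euler_plus (k : nat) (t : R) (x y : X) :
  0 <= t -> euler k t (plus x y) = plus (euler k t x) (euler k t y).
Proof.
intros ht. unfold euler. induction (2 ^ k)%nat as [|n IH]; simpl; [reflexivity|].
rewrite IH. apply resolvent_plus, step_size_pos, ht.
Qed.

Lemma euler_scal (k : nat) (t : R) (a : C) (x : X) :
  0 <= t -> euler k t (scal a x) = scal a (euler k t x).
Proof.
intros ht. unfold euler. induction (2 ^ k)%nat as [|n IH]; simpl; [reflexivity|].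
rewrite IH. apply resolvent_scal, step_size_pos, ht.
Qed.

Lemma euler_comm (k : nat) (t h : R) (x : X) :
  0 <= t -> 0 <= h -> euler k t (J h x) = J h (euler k t x).
Proof.
intros ht hh. apply iter_commute. intros v. apply resolvent_comm; [|exact hh].
now apply step_size_pos.
Qed.

Lemma euler_near (k : nat) (t : R) (x y : X) :
  0 <= t -> G x y -> norm (minus (euler k t x) x) <= t * norm y.
Proof.
intros ht hx. pose proof (step_size_pos k t ht) as hh.
assert (e : forall n, Nat.iter n (fun v : X => v) x = x)
  by (induction n as [|n IH]; [reflexivity|exact IH]).
pose proof (iter_diff X (eq x) (J (step_size k t)) (fun v => v) (step_size k t * norm y) (2 ^ k) x
  (fun u v => resolvent_nonexp _ u v hh) (fun v h => h)) as h.
rewrite e, INR_pow2 in h. eapply Rle_trans.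
- apply h; [|reflexivity]. intros v <-. now apply resolvent_near.
- right. unfold step_size. field. apply pow_nonzero. lra.
Qed.

Lemma euler_step (k : nat) (t c : R) (x : X) : 0 <= t -> W c x ->
  norm (minus (euler (S k) t x) (euler k t x)) <= t ^ 2 * c / 4 * (/ 2) ^ k.
Proof.
intros ht hx. rewrite norm_minus_sym. unfold euler.
change (2 ^ S k)%nat with (2 * 2 ^ k)%nat. rewrite iter_double.
pose proof (step_size_pos k t ht) as hh. pose proof (step_size_pos (S k) t ht) as hh'.
eapply Rle_trans.
- apply (iter_diff X (W c)) with (e := step_size (S k) t * step_size (S k) t * c).
  + intros. now apply resolvent_nonexp.
  + intros v hv. apply resolvent_D2; [exact hh'|]. now apply resolvent_D2.
  + intros v hv. rewrite norm_minus_sym.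
    replace (step_size k t) with (step_size (S k) t + step_size (S k) t).
    * now apply resolvent_add.
    * unfold step_size. simpl. field. apply pow_nonzero. lra.
  + exact hx.
- right. rewrite INR_pow2, pow_inv. unfold step_size. simpl. field.
  apply pow_nonzero. lra.
Qed.

(** Resolvents commute, so the steps for [s] and for [t] can be interleaved, and each pair is then
    replaced by one step for [s + t]. In the limit this is the semigroup law. *)
Lemma euler_add (k : nat) (s t c : R) (x : X) : 0 <= s -> 0 <= t -> W c x ->
  norm (minus (euler k s (euler k t x)) (euler k (s + t) x)) <= s * t * c * (/ 2) ^ k.
Proof.
intros hs ht hx. unfold euler.
pose proof (step_size_pos k s hs) as hh. pose proof (step_size_pos k t ht) as hh'.
assert (e : step_size k (s + t) = step_size k s + step_size k t) by (unfold step_size; field; apply pow_nonzero; lra).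
rewrite iter_compose by (intros; now apply resolvent_comm). rewrite e.
eapply Rle_trans.
- apply (iter_diff X (W c)) with (e := step_size k s * step_size k t * c).
  + intros. eapply Rle_trans; [apply resolvent_nonexp, hh|]. now apply resolvent_nonexp.
  + intros v hv. apply resolvent_D2; [lra|exact hv].
  + intros v hv. now apply resolvent_add.
  + exact hx.
- right. rewrite INR_pow2, pow_inv. unfold step_size. field. apply pow_nonzero. lra.
Qed.

Lemma iter_resolvent_near (n : nat) (h c : R) (x : X) : 0 <= h -> W c x -> 0 <= c ->
  norm (minus (Nat.iter n (J h) x) (J (INR n * h) x)) <= INR n ^ 2 * h ^ 2 * c.
Proof.
intros hh hx hc. induction n as [|n IH].
- simpl. rewrite Rmult_0_l, J_0. replace (minus x x) with (@zero X) by vec.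
  rewrite hnorm0. lra.
- rewrite S_INR. simpl Nat.iter.
  assert (hn : 0 <= INR n * h) by (apply Rmult_le_pos; [apply pos_INR|exact hh]).
  eapply Rle_trans; [apply (norm_tri_mid _ (J h (J (INR n * h) x)))|].
  pose proof (resolvent_nonexp h (Nat.iter n (J h) x) (J (INR n * h) x) hh) as h1.
  pose proof (resolvent_add h (INR n * h) c x hh hn hx) as h2.
  replace (h + INR n * h) with ((INR n + 1) * h) in h2 by ring.
  pose proof (pos_INR n).
  assert (0 <= h ^ 2 * c) by (apply Rmult_le_pos; [apply pow2_ge_0|exact hc]).
  nra.
Qed.

(** The bound is uniform in [k], so it survives in the limit: a single step [J t] is within [O(t^2)]
    of the semigroup, and the derivative at 0 can be read off from it. *)
Lemma euler_near_resolvent (k : nat) (t c : R) (x : X) : 0 <= t -> W c x -> 0 <= c ->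
  norm (minus (euler k t x) (J t x)) <= t ^ 2 * c.
Proof.
intros ht hx hc.
pose proof (iter_resolvent_near (2 ^ k) (step_size k t) c x (step_size_pos k t ht) hx hc) as h.
rewrite INR_pow2 in h. pose proof (pow2_pos k).
replace (2 ^ k * step_size k t) with t in h by (unfold step_size; field; lra).
replace (t ^ 2 * c) with ((2 ^ k) ^ 2 * step_size k t ^ 2 * c) by (unfold step_size; field; lra).
exact h.
Qed.

Lemma resolvent_approx (x : X) (eps : R) : 0 < eps ->
  exists d, 0 < d /\ forall h, 0 <= h < d -> norm (minus (J h x) x) < eps.
Proof.
intros he. destruct (dissipative_dense x (eps / 3)) as [s [[y hs] hxs]]; [lra|].
assert (hy : 0 < norm y + 1) by (pose proof (norm_pos _ y); lra).
exists (eps / 3 / (norm y + 1)). split; [apply Rdiv_lt_0_compat; lra|].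
intros h [h0 h1].
pose proof (resolvent_near h s y h0 hs) as h2.
pose proof (resolvent_nonexp h x s h0) as h3.
pose proof (norm_tri_mid _ (J h s) (J h x) x). pose proof (norm_tri_mid _ s (J h s) x).
rewrite (norm_minus_sym _ s x) in *.
assert (h * norm y < eps / 3); [|lra].
apply Rle_lt_trans with (h * (norm y + 1)); [nra|].
apply Rmult_lt_compat_r with (r := norm y + 1) in h1; [|exact hy].
replace (eps / 3 / (norm y + 1) * (norm y + 1)) with (eps / 3) in h1 by (field; lra).
exact h1.
Qed.

Lemma W_dense (x : X) : adherent (fun z => exists c, 0 <= c /\ W c z) x.
Proof.
intros eps he. destruct (dissipative_dense x (eps / 2)) as [s [[y hs] hxs]]; [lra|].
destruct (resolvent_approx s (eps / 2)) as [d [hd h]]; [lra|].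
specialize (h (d / 2) ltac:(lra)).
exists (J (d / 2) s). split.
- eexists. split; [apply norm_pos|]. exists (J (d / 2) y). eexists.
  split; [apply resolvent_graph; [lra|exact hs]|].
  split; [apply J_G; lra|apply Rle_refl].
- pose proof (norm_tri_mid _ s x (J (d / 2) s)).
  rewrite (norm_minus_sym _ s (J (d / 2) s)) in *. lra.
Qed.

Lemma euler_converges (t : R) (x : X) : 0 <= t -> exists l, seqlim (fun k => euler k t x) l.
Proof.
intros ht. apply cauchy_seqlim. intros eps he.
destruct (W_dense x (eps / 4)) as [s [[c [hc hs]] hxs]]; [lra|].
destruct (geometric_seqlim X (fun k => euler k t s) (t ^ 2 * c / 4) (/ 2))
  as [l [hl _]].
- pose proof (pow2_ge_0 t). nra.
- lra.
- intros n. now apply euler_step.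
- destruct (hl (eps / 4)) as [N hN]; [lra|]. exists N. intros n m hn hm.
  pose proof (hN n hn). pose proof (hN m hm).
  pose proof (euler_nonexp n t x s ht). pose proof (euler_nonexp m t x s ht).
  pose proof (norm_tri_mid _ (euler n t s) (euler n t x) (euler m t x)).
  pose proof (norm_tri_mid _ l (euler n t s) (euler m t x)).
  pose proof (norm_tri_mid _ (euler m t s) l (euler m t x)).
  rewrite (norm_minus_sym _ l (euler m t s)) in *.
  rewrite (norm_minus_sym _ (euler m t s) (euler m t x)) in *. lra.
Qed.

(** * The limit semigroup and its generator *)

Section Limit.

Variable T : R -> X -> X.
Hypothesis T_lim : forall t x, 0 <= t -> seqlim (fun k => euler k t x) (T t x).

Lemma limit_nonexp (t : R) (x y : X) :
  0 <= t -> norm (minus (T t x) (T t y)) <= norm (minus x y).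
Proof.
intros ht. apply le_epsilon. intros eps he.
destruct (T_lim t x ht (eps / 2)) as [N hN]; [lra|].
destruct (T_lim t y ht (eps / 2)) as [N' hN']; [lra|].
set (n := max N N'). specialize (hN n ltac:(lia)). specialize (hN' n ltac:(lia)).
pose proof (euler_nonexp n t x y ht).
pose proof (norm_tri_mid' _ (euler n t x) (T t x) (T t y)).
pose proof (norm_tri_mid _ (euler n t y) (euler n t x) (T t y)). lra.
Qed.

Lemma limit_linear (t : R) : 0 <= t -> is_linear (T t).
Proof.
intros ht.
assert (hp : forall x y, T t (plus x y) = plus (T t x) (T t y)).
{ intros x y. eapply seqlim_unique; [now apply T_lim|].
  eapply seqlim_ext; [|apply seqlim_plus; now apply T_lim].
  intros n. symmetry. now apply euler_plus. }
assert (hs : forall k x, T t (scal k x) = scal k (T t x)).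
{ intros k x. eapply seqlim_unique; [now apply T_lim|].
  eapply seqlim_ext; [intros n; symmetry; now apply euler_scal|].
  destruct (linear_bound X X (fun v : X => scal k v)
    (@is_linear_scal_r C_AbsRing X k Cmult_comm)) as [M [_ hM]].
  apply (seqlim_lip X X (fun v : X => scal k v) M); [|now apply T_lim].
  intros u v. eapply Rle_trans; [|apply hM]. right. apply (f_equal norm). cvec. }
split; [exact hp|exact hs|]. exists 1. split; [lra|]. intros x.
assert (h0 : T t zero = zero).
{ replace (@zero X) with (scal (RtoC 0) (@zero X)) at 1 by vec. rewrite hs. vec. }
pose proof (limit_nonexp t x zero ht) as h. rewrite h0 in h.
rewrite Rmult_1_l. eapply Rle_trans; [right|eapply Rle_trans; [exact h|right]];
  apply (f_equal norm); vec.
Qed.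

Lemma limit_near (t : R) (x y : X) :
  0 <= t -> G x y -> norm (minus (T t x) x) <= t * norm y.
Proof.
intros ht hx. eapply seqlim_norm_le; [now apply T_lim|].
exists 0%nat. intros n _. now apply euler_near.
Qed.

Lemma limit_semigroup : C0_semigroup T.
Proof.
split; [exact limit_linear|]. split; [|split].
- intros x. eapply seqlim_unique; [now apply T_lim; apply Rle_refl|].
  intros eps he. exists 0%nat. intros n _. unfold euler.
  assert (e : forall m, Nat.iter m (J (step_size n 0)) x = x).
  { assert (e0 : step_size n 0 = 0) by (unfold step_size; unfold Rdiv; ring). rewrite e0.
    induction m as [|m IH]; [reflexivity|]. simpl. now rewrite IH, J_0. }
  rewrite e. replace (minus x x) with (@zero X) by vec. now rewrite hnorm0.
(* The law is checked on the dense set of [W], where the iterates satisfy it up to [O(2^-k)], and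
   extends because both sides are nonexpansive. *)
- intros s t hs ht. apply (dense_eq X _ _ (fun x => T s (T t x)) W_dense).
  + intros x y. apply limit_nonexp. lra.
  + intros x y. eapply Rle_trans; [now apply limit_nonexp|now apply limit_nonexp].
  + intros x [c [hc hx]]. apply minus_eq0, le_epsilon. intros eps he.
    destruct (T_lim s (T t x) hs (eps / 4)) as [N1 h1]; [lra|].
    destruct (T_lim t x ht (eps / 4)) as [N2 h2]; [lra|].
    destruct (T_lim (s + t) x ltac:(lra) (eps / 4)) as [N3 h3]; [lra|].
    set (A := s * t * c + 1).
    assert (hA : 1 <= A).
    { unfold A. pose proof (Rmult_le_pos _ _ (Rmult_le_pos _ _ hs ht) hc). lra. }
    destruct (pow_lt_1_zero (/ 2)) with (y := eps / 4 / A) as [N4 h4].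
    { rewrite Rabs_pos_eq; lra. }
    { apply Rdiv_lt_0_compat; lra. }
    set (n := max (max N1 N2) (max N3 N4)).
    specialize (h1 n ltac:(lia)). specialize (h2 n ltac:(lia)).
    specialize (h3 n ltac:(lia)). specialize (h4 n ltac:(lia)).
    rewrite Rabs_pos_eq in h4 by (apply pow_le; lra).
    pose proof (euler_add n s t c x hs ht hx) as h5.
    pose proof (euler_nonexp n s (euler n t x) (T t x) hs) as h6.
    pose proof (norm_tri_mid' _ (euler n (s + t) x) (T (s + t) x) (T s (T t x))) as h7.
    pose proof (norm_tri_mid' _ (euler n s (euler n t x)) (euler n (s + t) x)
      (T s (T t x))) as h8.
    pose proof (norm_tri_mid _ (euler n s (T t x)) (euler n s (euler n t x))
      (T s (T t x))) as h9.
    assert (h10 : s * t * c * (/ 2) ^ n <= eps / 4).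
    { apply Rle_trans with (A * (/ 2) ^ n).
      - apply Rmult_le_compat_r; [apply pow_le; lra|unfold A; lra].
      - apply Rmult_lt_compat_l with (r := A) in h4; [|lra].
        replace (A * (eps / 4 / A)) with (eps / 4) in h4 by (field; lra). lra. }
    lra.
- intros x. apply (proj2 (at_right_nlim X _ _)). intros eps he.
  destruct (dissipative_dense x (eps / 3)) as [s [[y hs] hxs]]; [lra|].
  assert (hy : 0 < norm y + 1) by (pose proof (norm_pos _ y); lra).
  exists (eps / 3 / (norm y + 1)). split; [apply Rdiv_lt_0_compat; lra|].
  intros h [h0 h1].
  pose proof (limit_near h s y (Rlt_le _ _ h0) hs) as h2.
  pose proof (limit_nonexp h x s (Rlt_le _ _ h0)) as h3.
  pose proof (norm_tri_mid _ (T h s) (T h x) x). pose proof (norm_tri_mid _ s (T h s) x).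
  rewrite (norm_minus_sym _ s x) in *.
  assert (h * norm y < eps / 3); [|lra].
  apply Rle_lt_trans with (h * (norm y + 1)); [nra|].
  apply Rmult_lt_compat_r with (r := norm y + 1) in h1; [|exact hy].
  replace (eps / 3 / (norm y + 1) * (norm y + 1)) with (eps / 3) in h1 by (field; lra).
  exact h1.
Qed.

(** [x] may lie outside the domain of [G^2], so it is replaced by [J a x] with [a] fixed first. The
    replacement costs [t] times a small constant by [limit_near]. The bound [c] on [G^2 (J a x)]
    depends on [a] but enters only with [t^2]. *)
Lemma limit_derivative (x y : X) : G x y ->
  filterlim (fun h => scal (RtoC (/ h)) (minus (T h x) x)) (at_right 0) (locally y).
Proof.
intros hx. apply (proj2 (at_right_nlim X _ _)). intros eps he.
destruct (resolvent_approx y (eps / 4)) as [d [hd h]]; [lra|].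
set (a := d / 2). assert (ha : 0 < a) by (unfold a; lra).
specialize (h a ltac:(unfold a; lra)).
pose proof (resolvent_graph a x y (Rlt_le _ _ ha) hx) as h1.
set (z := scal (RtoC (/ a)) (minus (J a y) y)).
assert (h2 : G (J a y) z) by (now apply J_G).
set (c := norm z).
assert (hW : W c (J a x)) by (exists (J a y), z; auto using Rle_refl).
assert (hc : 0 <= c) by apply norm_pos.
exists (eps / 4 / (c + 1)). split; [apply Rdiv_lt_0_compat; lra|].
intros t [t0 t1]. assert (t0' := Rlt_le _ _ t0).
assert (htc : t * c < eps / 4).
{ apply Rle_lt_trans with (t * (c + 1)); [nra|].
  apply Rmult_lt_compat_r with (r := c + 1) in t1; [|lra].
  replace (eps / 4 / (c + 1) * (c + 1)) with (eps / 4) in t1 by (field; lra).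
  exact t1. }
assert (hT : forall u v, T t (minus u v) = minus (T t u) (T t v)).
{ intros. apply (linear_minus (T t)). now apply limit_linear. }
set (x1 := J a x) in *. set (y1 := J a y) in *.
pose proof (limit_near t _ _ t0' (dissipative_minus _ _ _ _ hx h1)) as k1.
rewrite hT in k1.
assert (k2 : norm (minus (T t x1) (J t x1)) <= t ^ 2 * c).
{ eapply seqlim_norm_le; [now apply T_lim|]. exists 0%nat. intros n _.
  now apply euler_near_resolvent. }
pose proof (resolvent_sub t _ _ t0' h1) as k3.
pose proof (resolvent_near t _ _ t0' h2) as k4. fold c in k4.
(* The pieces are the regularisation error, the distance from [T t] to [J t] at [x1], the defect of
   [J t] at [y1], and [y1 - y]. *)
assert (e : minus (minus (T t x) x) (scal (RtoC t) y) =
  plus (minus (minus (T t x) (T t x1)) (minus x x1)) (plus (minus (T t x1) (J t x1))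
   (plus (scal (RtoC t) (minus (J t y1) y1)) (scal (RtoC t) (minus y1 y))))).
{ transitivity (plus (minus (minus (T t x) (T t x1)) (minus x x1))
    (plus (minus (T t x1) (J t x1)) (minus (minus (J t x1) x1) (scal (RtoC t) y))));
   [vec|]. rewrite k3. vec. }
assert (hfin : norm (minus (minus (T t x) x) (scal (RtoC t) y)) <= t * (eps * 3 / 4)
   + t * (t * c)).
{ rewrite e. eapply Rle_trans; [apply hnorm_plus|].
  assert (norm (plus (minus (T t x1) (J t x1))
   (plus (scal (RtoC t) (minus (J t y1) y1)) (scal (RtoC t) (minus y1 y)))) <=
   t ^ 2 * c + (t * (t * c) + t * (eps / 4))).
  { eapply Rle_trans; [apply hnorm_plus|]. apply Rplus_le_compat; [exact k2|].
    eapply Rle_trans; [apply hnorm_plus|]. rewrite !norm_scalR, !Rabs_pos_eq by lra.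
    apply Rplus_le_compat; apply Rmult_le_compat_l; lra. }
  rewrite (norm_minus_sym _ y y1) in k1.
  assert (t * norm (minus y1 y) <= t * (eps / 4)) by (apply Rmult_le_compat_l; lra).
  assert (t ^ 2 * c <= t * (eps / 4)).
  { replace (t ^ 2 * c) with (t * (t * c)) by ring. apply Rmult_le_compat_l; lra. }
  lra. }
norm_as (scal (RtoC (/ t)) (minus (minus (T t x) x) (scal (RtoC t) y))) by (field; lra).
pose proof (Rinv_0_lt_compat _ t0).
rewrite norm_scalR, Rabs_pos_eq by lra.
apply Rle_lt_trans with (/ t * (t * (eps * 3 / 4) + t * (t * c))).
- apply Rmult_le_compat_l; lra.
- replace (/ t * (t * (eps * 3 / 4) + t * (t * c))) with (eps * 3 / 4 + t * c)
    by (field; lra). lra.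
Qed.

(** For the inclusion into [G], suppose the quotients at [x] tend to [y]. As [J 1] commutes with
    [T], the derivative at [J 1 x] is both [J 1 x - x] and [J 1 y]. Hence [x = J 1 (x - y)], which
    places [x] in the domain with value [y]. *)
Lemma limit_generates : generates G T.
Proof.
split; [exact limit_semigroup|]. intros x y. split; [apply limit_derivative|].
intros hxy. assert (h1 : 0 <= 1) by lra.
assert (hJ : G (J 1 x) (minus (J 1 x) x)).
{ pose proof (J_G 1 x Rlt_0_1) as h. rewrite Rinv_1 in h.
  replace (minus (J 1 x) x) with (scal (RtoC 1) (minus (J 1 x) x)) by vec. exact h. }
assert (hcomm : forall t, 0 <= t -> T t (J 1 x) = J 1 (T t x)).
{ intros t ht. eapply seqlim_unique; [now apply T_lim|].
  eapply seqlim_ext; [intros n; symmetry; now apply euler_comm|].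
  apply (seqlim_lip X X (J 1) 1); [|now apply T_lim].
  intros u v. rewrite Rmult_1_l. now apply resolvent_nonexp. }
assert (e : minus (J 1 x) x = J 1 y).
{ eapply filterlim_at_right_unique; [apply limit_derivative, hJ|].
  apply (proj2 (at_right_nlim X _ _)). intros eps he.
  destruct (proj1 (at_right_nlim X _ _) hxy eps he) as [d [hd h]].
  exists d. split; [exact hd|]. intros t ht. rewrite hcomm by lra.
  rewrite <- resolvent_minus, <- resolvent_scal by exact h1.
  eapply Rle_lt_trans; [now apply resolvent_nonexp|now apply h]. }
assert (e2 : J 1 (minus x y) = x).
{ rewrite resolvent_minus, <- e by exact h1. vec. }
pose proof (J_G 1 (minus x y) Rlt_0_1) as h. rewrite e2, Rinv_1 in h.
replace y with (scal (RtoC 1) (minus x (minus x y))) by vec. exact h.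
Qed.

End Limit.

End Resolvent.

Theorem lumer_phillips : exists T, generates G T.
Proof.
destruct resolvent_exists as [J [hJ0 hJ]].
assert (hex : forall a : R * X, exists l, 0 <= fst a ->
  seqlim (fun k => euler J k (fst a) (snd a)) l).
{ intros [t x]. simpl. destruct (Rle_lt_dec 0 t) as [ht|ht].
  - destruct (euler_converges J hJ0 hJ t x ht) as [l hl]. exists l. auto.
  - exists zero. lra. }
destruct (choice _ hex) as [T hT]. exists (fun t x => T (t, x)).
apply (limit_generates J hJ0 hJ). intros t x ht. now apply (hT (t, x)).
Qed.

End LumerPhillips.

(** * Passive nodes under feedback *)

Lemma dot_pair (H1 H2 : Hilbert) (x x' : H1) (y y' : H2) :
  @dot (prod_Hilbert H1 H2) (x, y) (x', y') = dot x x' + dot y y'.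
Proof. reflexivity. Qed.

Lemma normsq_pair (H1 H2 : Hilbert) (x : H1) (y : H2) :
  @norm _ (prod_Hilbert H1 H2) (x, y) ^ 2 = norm x ^ 2 + norm y ^ 2.
Proof. rewrite !normsq. apply dot_pair. Qed.

Lemma norm_fst_le (H1 H2 : Hilbert) (p : prod_Hilbert H1 H2) :
  norm (fst p) <= @norm _ (prod_Hilbert H1 H2) p.
Proof.
destruct p as [x y]. apply norm_le_of_sq; [apply norm_pos|].
rewrite normsq_pair, <- normsq. pose proof (pow2_ge_0 (norm y)). simpl fst. lra.
Qed.

Lemma norm_snd_le (H1 H2 : Hilbert) (p : prod_Hilbert H1 H2) :
  norm (snd p) <= @norm _ (prod_Hilbert H1 H2) p.
Proof.
destruct p as [x y]. apply norm_le_of_sq; [apply norm_pos|].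
rewrite normsq_pair, <- normsq. pose proof (pow2_ge_0 (norm x)). simpl snd. lra.
Qed.

Lemma norm_pair_le (H1 H2 : Hilbert) (p : prod_Hilbert H1 H2) :
  @norm _ (prod_Hilbert H1 H2) p <= norm (fst p) + norm (snd p).
Proof.
destruct p as [x y]. simpl fst. simpl snd.
pose proof (norm_pos _ x). pose proof (norm_pos _ y).
apply norm_le_of_sq; [lra|]. rewrite <- normsq, normsq_pair. nra.
Qed.

Lemma linear_pair (H H1 H2 : Hilbert) (f : H -> H1) (g : H -> H2) :
  is_linear f -> is_linear g ->
  @is_linear C_AbsRing H (prod_Hilbert H1 H2) (fun x => (f x, g x)).
Proof. exact (@is_linear_prod C_AbsRing H H1 H2 f g). Qed.

Lemma linear_fst (H1 H2 : Hilbert) :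
  @is_linear C_AbsRing (prod_Hilbert H1 H2) H1 (fun p => fst p).
Proof. exact (@is_linear_fst C_AbsRing H1 H2). Qed.

Lemma linear_snd (H1 H2 : Hilbert) :
  @is_linear C_AbsRing (prod_Hilbert H1 H2) H2 (fun p => snd p).
Proof. exact (@is_linear_snd C_AbsRing H1 H2). Qed.

Lemma linear_comp (H1 H2 H3 : Hilbert) (f : H1 -> H2) (g : H2 -> H3) :
  is_linear f -> is_linear g -> is_linear (fun x => g (f x)).
Proof. exact (@is_linear_comp C_AbsRing H1 H2 H3 f g). Qed.

Lemma linear_comp_fst (H1 H2 H3 : Hilbert) (f : H1 -> H3) : is_linear f ->
  @is_linear C_AbsRing (prod_Hilbert H1 H2) H3 (fun p => f (fst p)).
Proof.
intros hf. exact (linear_comp (prod_Hilbert H1 H2) H1 H3 _ f (linear_fst H1 H2) hf).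
Qed.

Lemma linear_comp_snd (H1 H2 H3 : Hilbert) (f : H2 -> H3) : is_linear f ->
  @is_linear C_AbsRing (prod_Hilbert H1 H2) H3 (fun p => f (snd p)).
Proof.
intros hf. exact (linear_comp (prod_Hilbert H1 H2) H2 H3 _ f (linear_snd H1 H2) hf).
Qed.

Lemma linear_opp_fun (H1 H2 : Hilbert) (f : H1 -> H2) :
  is_linear f -> is_linear (fun x => opp (f x)).
Proof. intros hf. exact (linear_comp _ _ _ f opp hf (@is_linear_opp C_AbsRing H2)). Qed.

Lemma linear_plus_fun (H1 H2 : Hilbert) (f g : H1 -> H2) :
  is_linear f -> is_linear g -> is_linear (fun x => plus (f x) (g x)).
Proof.
intros hf hg. exact (@is_linear_comp C_AbsRing H1 (prod_Hilbert H2 H2) H2 _ _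
  (linear_pair _ _ _ f g hf hg) (@is_linear_plus C_AbsRing H2)).
Qed.

Lemma linear_minus_fun (H1 H2 : Hilbert) (f g : H1 -> H2) :
  is_linear f -> is_linear g -> is_linear (fun x => minus (f x) (g x)).
Proof. intros hf hg. apply linear_plus_fun; [exact hf|]. now apply linear_opp_fun. Qed.

Lemma linear_scal_fun (H1 H2 : Hilbert) (k : C) (f : H1 -> H2) :
  is_linear f -> is_linear (fun x => scal k (f x)).
Proof.
intros hf. exact (linear_comp _ _ _ f (fun v : H2 => scal k v) hf
  (@is_linear_scal_r C_AbsRing H2 k Cmult_comm)).
Qed.

Lemma lin_plus (H1 H2 : Hilbert) (f : H1 -> H2) : is_linear f ->
  forall x y, f (plus x y) = plus (f x) (f y).
Proof. exact (linear_plus f). Qed.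

Lemma lin_minus (H1 H2 : Hilbert) (f : H1 -> H2) : is_linear f ->
  forall x y, f (minus x y) = minus (f x) (f y).
Proof. intros h x y. exact (linear_minus f x y h). Qed.

Lemma lin_scal (H1 H2 : Hilbert) (f : H1 -> H2) : is_linear f ->
  forall (k : C) x, f (scal k x) = scal k (f x).
Proof. exact (linear_scal f). Qed.

Lemma lin_zero (H1 H2 : Hilbert) (f : H1 -> H2) : is_linear f -> f zero = zero.
Proof. exact (linear_zero f). Qed.

Lemma eq_of_minus_zero (H : Hilbert) (x y : H) : minus x y = zero -> x = y.
Proof. intros h. apply minus_eq0. rewrite h, hnorm0. lra. Qed.

Lemma minus_self (H : Hilbert) (x y : H) : x = y -> minus x y = zero.
Proof. intros ->. vec. Qed.

(** A change to an equivalent inner product is expressed as conjugation by an isomorphism [S], so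
    that Lumer-Phillips can be applied with the inner product of [Z]. *)
Lemma generates_similar (X Z : Hilbert) (S : X -> Z) (S' : Z -> X) (G : X -> X -> Prop)
  (T : R -> Z -> Z) :
  is_linear S -> is_linear S' -> (forall x, S' (S x) = x) -> (forall z, S (S' z) = z) ->
  generates (fun z w => G (S' z) (S' w)) T ->
  generates G (fun t x => S' (T t (S x))).
Proof.
intros hS hS' e1 e2 [[hl [h0 [ha hc]]] hG]. split; [split; [|split; [|split]]|].
- intros t ht. apply (linear_comp X Z X (fun x => T t (S x)) S'); [|exact hS'].
  exact (linear_comp X Z Z S (T t) hS (hl t ht)).
- intros x. now rewrite h0.
- intros s t hs ht x. now rewrite ha, e2.
- intros x. pose proof (filterlim_linear Z X _ S' _ _ hS' (hc (S x))) as h.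
  now rewrite e1 in h.
- intros x y. pose proof (hG (S x) (S y)) as h. rewrite !e1 in h. rewrite h.
  assert (e : forall t x, minus (T t (S x)) (S x) = S (minus (S' (T t (S x))) x)).
  { intros. now rewrite (lin_minus _ _ S hS), e2. }
  split; intros hlim.
  + pose proof (filterlim_linear Z X _ S' _ _ hS' hlim) as h1. rewrite e1 in h1.
    eapply filterlim_within_ext; [|exact h1]. intros t _. simpl.
    now rewrite (lin_scal _ _ S' hS'), e, e1.
  + pose proof (filterlim_linear X Z _ S _ _ hS hlim) as h1.
    eapply filterlim_within_ext; [|exact h1]. intros t _. simpl.
    now rewrite (lin_scal _ _ S hS), e.
Qed.

Section RestrictedGraph.

Variables (X D V : Hilbert) (i A : D -> X) (B : D -> V).
Hypothesis hi : is_linear i.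
Hypothesis hA : is_linear A.
Hypothesis hB : is_linear B.
Hypothesis inj : forall d1 d2, i d1 = i d2 -> d1 = d2.

Lemma restr_ker_plus (x y x' y' : X) : restr_ker i A B x y -> restr_ker i A B x' y' ->
  restr_ker i A B (plus x x') (plus y y').
Proof.
intros [d [h1 [-> ->]]] [d' [h1' [-> ->]]]. exists (plus d d').
rewrite (lin_plus _ _ i hi), (lin_plus _ _ A hA), (lin_plus _ _ B hB).
split; [|split; reflexivity]. rewrite h1, h1'. vec.
Qed.

Lemma restr_ker_scal (k : C) (x y : X) : restr_ker i A B x y ->
  restr_ker i A B (scal k x) (scal k y).
Proof.
intros [d [h1 [-> ->]]]. exists (scal k d).
rewrite (lin_scal _ _ i hi), (lin_scal _ _ A hA), (lin_scal _ _ B hB).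
split; [|split; reflexivity]. rewrite h1. exact (@scal_zero_r C_Ring V k).
Qed.

Lemma restr_ker_fun (x y y' : X) : restr_ker i A B x y -> restr_ker i A B x y' -> y = y'.
Proof.
intros [d [h1 [-> ->]]] [d' [h1' [e ->]]]. now rewrite (inj d d' e).
Qed.

End RestrictedGraph.

(** The semigroup acts on [X] but boundary and output maps act on [D], so the orbit is lifted by
    choice. The identity for [A (d t)] carries bounds on the semigroup over to the graph norm. *)
Lemma restr_ker_orbit (X D V : Hilbert) (i A : D -> X) (B : D -> V) (T : R -> X -> X)
  (d0 : D) : generates (restr_ker i A B) T -> B d0 = zero ->
  exists d : R -> D, forall t, 0 <= t ->
    B (d t) = zero /\ T t (i d0) = i (d t) /\ T t (A d0) = A (d t) /\
    deriv_at (fun s => 0 <= s) (fun s => i (d s)) t (A (d t)).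
Proof.
intros gen h0.
assert (g0 : restr_ker i A B (i d0) (A d0)) by (exists d0; auto).
assert (hex : forall t, exists d, 0 <= t ->
  B d = zero /\ T t (i d0) = i d /\ T t (A d0) = A d).
{ intros t. destruct (Rle_lt_dec 0 t) as [ht|ht]; [|exists d0; lra].
  destruct (generator_orbit X _ T gen _ _ t ht g0) as [d hd]. exists d. auto. }
destruct (choice _ hex) as [d hd]. exists d. intros t ht.
destruct (hd t ht) as [h1 [h2 h3]]. split; [exact h1|]. split; [exact h2|].
split; [exact h3|]. rewrite <- h3.
apply (deriv_at_ext _ _ (fun s => T s (i d0)) _ _ _ ht); [intros s hs; now apply hd|].
exact (generator_deriv X _ T gen _ _ t ht g0).
Qed.

Section PassiveNode.

Variables (U X D : Hilbert) (emb A : D -> X) (B C : D -> U) (Br : U -> D)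
  (T : R -> X -> X).
Hypothesis hemb : is_linear emb.
Hypothesis hA : is_linear A.
Hypothesis hB : is_linear B.
Hypothesis hC : is_linear C.
Hypothesis inj : forall d1 d2, emb d1 = emb d2 -> d1 = d2.
Hypothesis hBr : forall v, B (Br v) = v.
Hypothesis gen : generates (restr_ker emb A B) T.
Hypothesis passive : forall d, dot (A d) (emb d) <= dot (B d) (C d).

(** Subtracting the lift [Br u] leaves a homogeneous boundary condition, and the resolvent of the
    given generator solves the rest. *)
Lemma node_bvp : exists l0, 0 < l0 /\ forall l, l0 <= l -> forall f u,
  exists d, minus (scal (RtoC l) (emb d)) (A d) = f /\ B d = u.
Proof.
destruct (generator_range X _ T gen) as [l0 [hl0 hr]]. exists l0. split; [exact hl0|].
intros l hl f u.
destruct (hr l hl (minus f (minus (scal (RtoC l) (emb (Br u))) (A (Br u)))))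
  as [x [y [[d [h1 [-> ->]]] e]]].
exists (plus d (Br u)).
rewrite (lin_plus _ _ emb hemb), (lin_plus _ _ A hA), (lin_plus _ _ B hB), h1, hBr. split; [|vec].
transitivity (plus (minus (scal (RtoC l) (emb d)) (A d))
  (minus (scal (RtoC l) (emb (Br u))) (A (Br u)))); [vec|]. rewrite e. vec.
Qed.

Lemma emb_eq0 (d : D) : emb d = zero -> d = zero.
Proof. intros h. apply inj. now rewrite h, (lin_zero _ _ emb hemb). Qed.

Lemma linear_lambda_minus (l : R) :
  is_linear (fun d => minus (scal (RtoC l) (emb d)) (A d)).
Proof. apply linear_minus_fun; [|exact hA]. now apply linear_scal_fun. Qed.

(** * A passive node under strictly dissipative output feedback *)

Section Feedback.

Variables (M : U -> U) (c : R).
Hypothesis hM : is_linear M.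
Hypothesis hc : 0 < c.
Hypothesis posM : forall u, c * norm u ^ 2 <= dot (M u) u.

(** Serves twice: the kernel gives [A_K] for [M = K] and [A_L] for [M = - L]. *)
Definition feedback (d : D) : U := plus (B d) (M (C d)).

Lemma feedback_linear : is_linear feedback.
Proof. apply linear_plus_fun; [exact hB|]. now apply (linear_comp _ _ _ C M). Qed.

Lemma feedback_energy (d : D) :
  dot (A d) (emb d) + c * norm (C d) ^ 2 <= dot (feedback d) (C d).
Proof.
pose proof (passive d). pose proof (posM (C d)). unfold feedback. dots. lra.
Qed.

(** Passivity gives [l |d|^2 + c s^2 <= |v| s] with [s] the norm of the output, and [|v| s - c s^2]
    is at most [|v|^2 / (4 c)]. Later this bounds the boundary correction in [X] by its boundary
    datum. *)
Lemma feedback_solution_bound (l : R) (d : D) (v : U) :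
  0 < l -> scal (RtoC l) (emb d) = A d -> feedback d = v ->
  l * norm (emb d) ^ 2 <= norm v ^ 2 / (4 * c).
Proof.
intros hl e <-. pose proof (feedback_energy d) as h. rewrite <- e, dot_scal_l in h.
rewrite <- normsq in h. pose proof (dot_le _ (feedback d) (C d)).
apply Rmult_le_reg_r with (4 * c); [lra|].
replace (norm (feedback d) ^ 2 / (4 * c) * (4 * c)) with (norm (feedback d) ^ 2)
  by (field; lra).
pose proof (pow2_ge_0 (2 * c * norm (C d) - norm (feedback d))). nra.
Qed.

Lemma feedback_kernel (l : R) (d : D) :
  0 < l -> scal (RtoC l) (emb d) = A d -> feedback d = zero -> d = zero.
Proof.
intros hl e h0. apply emb_eq0, hnorm_eq0.
pose proof (feedback_solution_bound l d zero hl e h0) as h. rewrite hnorm0 in h.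
replace (0 ^ 2 / (4 * c)) with 0 in h by (field; lra).
destruct (norm_pos _ (emb d)) as [hp|hp]; [|now symmetry].
pose proof (Rmult_lt_0_compat _ _ hl (pow_lt _ 2 hp)). lra.
Qed.

(** With [q] the difference of two values of [Mi], the pairing is that of [q] with [M q], at least
    [c |q|^2]. Since [|M q| <= m |q|], this is at least [c / m^2] times the squared distance of the
    arguments. *)
Lemma feedback_inverse : exists Mi : U -> U, (forall u, M (Mi u) = u) /\
  (forall u v, norm (minus (Mi u) (Mi v)) <= / c * norm (minus u v)) /\
  exists k, 0 < k /\ forall u v, k * norm (minus u v) ^ 2 <=
    dot (minus (Mi u) (Mi v)) (minus u v).
Proof.
destruct (linear_bound _ _ M hM) as [m [hm hb]].
assert (hex : forall u, exists q, M q = u).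
{ intros u. destruct (strongly_monotone_zero U (fun q => minus (M q) u) c m hc)
    as [q hq].
  - intros x y. norm_as (minus (M x) (M y)). rewrite <- (lin_minus _ _ M hM). apply hb.
  - intros x y. eapply Rle_trans; [apply posM|]. right. rewrite (lin_minus _ _ M hM).
    apply (f_equal (fun v => dot v (minus x y))). vec.
  - exists q. now apply eq_of_minus_zero. }
destruct (choice _ hex) as [Mi hMi]. exists Mi. split; [exact hMi|].
assert (hd : forall u v, M (minus (Mi u) (Mi v)) = minus u v).
{ intros u v. now rewrite (lin_minus _ _ M hM), !hMi. }
assert (h1 : forall u v, norm (minus (Mi u) (Mi v)) <= / c * norm (minus u v)).
{ intros u v. set (q := minus (Mi u) (Mi v)). pose proof (posM q) as h.
  unfold q in h at 2. rewrite hd in h. pose proof (dot_le _ (minus u v) q).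
  pose proof (norm_pos _ q). pose proof (norm_pos _ (minus u v)).
  apply Rmult_le_reg_l with c; [exact hc|]. rewrite <- Rmult_assoc, Rinv_r by lra.
  destruct (Req_dec (norm q) 0) as [e|e]; [rewrite e; lra|].
  apply Rmult_le_reg_r with (norm q); [lra|]. nra. }
split; [exact h1|]. exists (c / m ^ 2).
split; [apply Rdiv_lt_0_compat; [exact hc|now apply pow_lt]|]. intros u v.
set (q := minus (Mi u) (Mi v)). pose proof (posM q) as h.
unfold q in h at 2. rewrite hd, dot_sym in h. eapply Rle_trans; [|exact h].
apply Rle_trans with (c / m ^ 2 * (m * norm q) ^ 2).
- apply Rmult_le_compat_l.
  + left. apply Rdiv_lt_0_compat; [exact hc|now apply pow_lt].
  + apply pow_incr. split; [apply norm_pos|].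
    eapply Rle_trans; [right; exact (f_equal norm (eq_sym (hd u v)))|apply hb].
- right. field. lra.
Qed.

(** As a function of the boundary value, [C (s v)] is the transfer function at [l] up to a constant.
    Passivity makes it monotone. Its composite with [M] need not be monotone, so the equation is put
    into a form with [Mi], whose strong monotonicity survives adding a monotone map. *)
Lemma feedback_bvp : exists l0, 0 < l0 /\ forall l, l0 <= l -> forall f u,
  exists d, minus (scal (RtoC l) (emb d)) (A d) = f /\ feedback d = u.
Proof.
destruct node_bvp as [l0 [hl0 hr]]. exists l0. split; [exact hl0|]. intros l hl f u.
destruct (choice _ (hr l hl f)) as [s hs].
destruct feedback_inverse as [Mi [hMi [hL [k [hk hmon]]]]].
assert (hdiff : forall a b, minus (scal (RtoC l) (emb (minus (s a) (s b))))
   (A (minus (s a) (s b))) = zero /\ B (minus (s a) (s b)) = minus a b).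
{ intros a b. rewrite (lin_minus _ _ emb hemb), (lin_minus _ _ A hA),
    (lin_minus _ _ B hB). rewrite !(proj2 (hs _)).
  split; [|reflexivity].
  transitivity (minus (minus (scal (RtoC l) (emb (s a))) (A (s a)))
    (minus (scal (RtoC l) (emb (s b))) (A (s b)))); [vec|].
  rewrite !(proj1 (hs _)). vec. }
(* The solution map [s] comes from choice; its Lipschitz dependence on the boundary value is the
   bounded inverse of the boundary value problem, injective by passivity. *)
destruct (bounded_inverse D (prod_Hilbert X U)
  (fun d => (minus (scal (RtoC l) (emb d)) (A d), B d))) as [m [hm hb]].
{ apply linear_pair; [apply linear_lambda_minus|exact hB]. }
{ intros d e.
  assert (e1 : minus (scal (RtoC l) (emb d)) (A d) = zero) by exact (f_equal fst e).
  assert (e2 : B d = zero) by exact (f_equal snd e).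
  apply eq_of_minus_zero in e1. apply emb_eq0, dot_eq0.
  pose proof (passive d) as h. rewrite e2, dot_zero_l, <- e1, dot_scal_l in h. nra. }
{ intros [x v]. destruct (hr l hl x v) as [d [h1 h2]]. exists d. now rewrite h1, h2. }
destruct (linear_bound _ _ C hC) as [mC [hmC hbC]].
(* With [v] the unknown value of [B d], the condition [v + M (C d) = u] becomes
   [Mi (v - u) + C (s v) = 0]. *)
destruct (strongly_monotone_zero U (fun v => plus (Mi (minus v u)) (C (s v))) k
  (/ c + mC * m) hk) as [v hv].
- intros a b. norm_as (plus (minus (Mi (minus a u)) (Mi (minus b u)))
    (minus (C (s a)) (C (s b)))).
  eapply Rle_trans; [apply hnorm_plus|]. rewrite Rmult_plus_distr_r.
  apply Rplus_le_compat.
  + eapply Rle_trans; [apply hL|]. right. apply f_equal. apply (f_equal norm). vec.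
  + rewrite <- (lin_minus _ _ C hC). eapply Rle_trans; [apply hbC|].
    rewrite Rmult_assoc. apply Rmult_le_compat_l; [lra|].
    eapply Rle_trans; [apply hb|]. destruct (hdiff a b) as [e1 e2]. rewrite e1, e2.
    apply Rmult_le_compat_l; [lra|]. eapply Rle_trans; [apply norm_pair_le|].
    simpl fst. simpl snd. rewrite hnorm0. lra.
- intros a b. destruct (hdiff a b) as [e1 e2]. apply eq_of_minus_zero in e1.
  pose proof (passive (minus (s a) (s b))) as h.
  rewrite e2, <- e1, dot_scal_l, <- normsq, (lin_minus _ _ C hC) in h.
  pose proof (hmon (minus a u) (minus b u)) as h2.
  assert (e : minus (minus a u) (minus b u) = minus a b) by vec. rewrite e in h2.
  assert (0 <= l * norm (emb (minus (s a) (s b))) ^ 2)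
    by (apply Rmult_le_pos; [lra|apply pow2_ge_0]).
  change (k * norm (minus a b) ^ 2 <= dot (minus (plus (Mi (minus a u)) (C (s a)))
    (plus (Mi (minus b u)) (C (s b)))) (minus a b)).
  apply Rle_trans with (dot (minus (Mi (minus a u)) (Mi (minus b u))) (minus a b));
    [exact h2|]. rewrite (dot_sym _ (minus a b)) in h.
  pose proof (Rle_trans _ _ _ H h) as h3. revert h3. dots. intros. lra.
- exists (s v). destruct (hs v) as [h1 h2]. split; [exact h1|].
  unfold feedback. rewrite h2.
  assert (e : C (s v) = opp (Mi (minus v u))).
  { transitivity (minus (plus (Mi (minus v u)) (C (s v))) (Mi (minus v u))); [vec|].
    rewrite hv. vec. }
  rewrite e. replace (opp (Mi (minus v u))) with (scal (RtoC (-1)) (Mi (minus v u))) by vec.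
  rewrite (lin_scal _ _ M hM), hMi. vec.
Qed.

(** The lift is taken in the kernel of [l - A]. There it is unique, which makes it linear, and [A]
    acts as multiplication by [l], so a bound on the state controls the graph norm. *)
Lemma feedback_right_inverse : exists (l : R) (Rm : U -> D), 0 < l /\ is_linear Rm /\
  forall v, feedback (Rm v) = v /\ scal (RtoC l) (emb (Rm v)) = A (Rm v).
Proof.
destruct feedback_bvp as [l [hl hr]]. specialize (hr l (Rle_refl l)).
assert (hex : forall v, exists d, feedback d = v /\ scal (RtoC l) (emb d) = A d).
{ intros v. destruct (hr zero v) as [d [h1 h2]]. exists d. split; [exact h2|].
  now apply eq_of_minus_zero. }
destruct (choice _ hex) as [Rm hRm]. exists l, Rm. split; [exact hl|].
split; [|exact hRm]. pose proof feedback_linear as hF.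
assert (huniq : forall d v, feedback d = v -> scal (RtoC l) (emb d) = A d -> Rm v = d).
{ intros d v h1 h2. apply eq_of_minus_zero. destruct (hRm v) as [h3 h4].
  apply (feedback_kernel l); [exact hl| |].
  - rewrite (lin_minus _ _ emb hemb), (lin_minus _ _ A hA), <- h2, <- h4. vec.
  - rewrite (lin_minus _ _ feedback hF), h3, h1. vec. }
split.
- intros u v. destruct (hRm u) as [h1 h2]. destruct (hRm v) as [h3 h4]. apply huniq.
  + now rewrite (lin_plus _ _ feedback hF), h1, h3.
  + rewrite (lin_plus _ _ emb hemb), (lin_plus _ _ A hA), <- h2, <- h4. vec.
- intros k v. destruct (hRm v) as [h1 h2]. apply huniq.
  + now rewrite (lin_scal _ _ feedback hF), h1.
  + rewrite (lin_scal _ _ emb hemb), (lin_scal _ _ A hA), <- h2. cvec.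
- destruct (bounded_inverse D (prod_Hilbert X U)
    (fun d => (minus (scal (RtoC l) (emb d)) (A d), feedback d))) as [m [hm hb]].
  { apply linear_pair; [apply linear_lambda_minus|exact hF]. }
  { intros d e.
    assert (e1 : minus (scal (RtoC l) (emb d)) (A d) = zero) by exact (f_equal fst e).
    assert (e2 : feedback d = zero) by exact (f_equal snd e).
    apply eq_of_minus_zero in e1. now apply (feedback_kernel l). }
  { intros [x v]. destruct (hr x v) as [d [h1 h2]]. exists d. now rewrite h1, h2. }
  exists m. split; [exact hm|]. intros v. eapply Rle_trans; [apply hb|].
  apply Rmult_le_compat_l; [lra|]. eapply Rle_trans; [apply norm_pair_le|].
  simpl fst. simpl snd. destruct (hRm v) as [h1 h2].
  rewrite h1. eapply Rle_trans;
    [apply Rplus_le_compat_r; right; exact (f_equal norm (minus_self _ _ _ h2))|].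
  rewrite hnorm0. lra.
Qed.

Lemma feedback_generates : exists TM, generates (restr_ker emb A feedback) TM.
Proof.
pose proof feedback_linear as hF.
apply lumer_phillips.
- intros x y x' y'. now apply restr_ker_plus.
- intros k x y. now apply restr_ker_scal.
- intros x y y'. now apply restr_ker_fun.
- intros x y [d [h1 [-> ->]]]. pose proof (feedback_energy d) as h.
  rewrite h1, dot_zero_l in h. pose proof (pow2_ge_0 (norm (C d))). nra.
- destruct feedback_bvp as [l0 [hl0 hr]]. exists l0. split; [exact hl0|].
  intros l hl f. destruct (hr l hl f zero) as [d [h1 h2]].
  exists (emb d), (A d). split; [exists d; auto|exact h1].
Qed.

End Feedback.

(** * The closed loop as a cascade of two feedback loops *)

Section ClosedLoop.

Variables (K M : U -> U) (c1 c2 : R).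
Hypothesis hK : is_linear K.
Hypothesis hM : is_linear M.
Hypothesis hc1 : 0 < c1.
Hypothesis hc2 : 0 < c2.
Hypothesis posK : forall u, c1 * norm u ^ 2 <= dot (K u) u.
Hypothesis posM : forall u, c2 * norm u ^ 2 <= dot (M u) u.

Definition loop_emb (d : prod_Hilbert D D) : prod_Hilbert X X := (emb (fst d), emb (snd d)).
Definition loop_A (d : prod_Hilbert D D) : prod_Hilbert X X := (A (fst d), A (snd d)).
(** The boundary operator of [closed_loop] for [Q = I] and state feedback [- K C], written with
    [M = - L] so that both gains are strictly positive. *)
Definition loop_B (d : prod_Hilbert D D) : prod_Hilbert U U :=
  (plus (B (fst d)) (K (C (snd d))),
   plus (opp (M (C (fst d))))
     (plus (plus (B (snd d)) (K (C (snd d)))) (M (C (snd d))))).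

Lemma loop_emb_linear : is_linear loop_emb.
Proof.
apply linear_pair.
- now apply linear_comp_fst.
- now apply linear_comp_snd.
Qed.

Lemma loop_A_linear : is_linear loop_A.
Proof.
apply linear_pair.
- now apply linear_comp_fst.
- now apply linear_comp_snd.
Qed.

Lemma loop_B_linear : is_linear loop_B.
Proof.
pose proof (fun f => linear_comp_fst D D U f) as h1.
pose proof (fun f => linear_comp_snd D D U f) as h2.
pose proof (linear_comp _ _ _ C K hC hK) as hKC.
pose proof (linear_comp _ _ _ C M hC hM) as hMC.
apply linear_pair.
- exact (linear_plus_fun _ _ _ _ (h1 B hB) (h2 _ hKC)).
- exact (linear_plus_fun _ _ _ _ (linear_opp_fun _ _ _ (h1 _ hMC))
    (linear_plus_fun _ _ _ _ (linear_plus_fun _ _ _ _ (h2 B hB) (h2 _ hKC)) (h2 _ hMC))).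
Qed.

Lemma loop_emb_inj (d1 d2 : prod_Hilbert D D) : loop_emb d1 = loop_emb d2 -> d1 = d2.
Proof.
destruct d1 as [x1 y1], d2 as [x2 y2]. unfold loop_emb. simpl. intros h.
injection h. intros h1 h2. now rewrite (inj _ _ h1), (inj _ _ h2).
Qed.

(* In the coordinates given by the first component and the difference of the
   two components, the closed loop is a cascade. *)
Lemma loop_B_cascade (x y : D) (v w : U) :
  loop_B (x, y) = (v, w) <->
  feedback M (minus x y) = minus v w /\ feedback K x = plus v (K (C (minus x y))).
Proof.
unfold loop_B, feedback. simpl fst. simpl snd.
rewrite !(lin_minus _ _ B hB), !(lin_minus _ _ C hC), !(lin_minus _ _ M hM),
  !(lin_minus _ _ K hK). split.
- intros h. injection h. intros h2 h1. split; apply dot_ext; intros z;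
    test_eq z h1; test_eq z h2; dots; lra.
- intros [h1 h2]. apply f_equal2; apply dot_ext; intros z;
    test_eq z h1; test_eq z h2; dots; lra.
Qed.

Lemma loop_B_kernel (x y : D) :
  loop_B (x, y) = zero <->
  feedback M (minus x y) = zero /\ feedback K x = K (C (minus x y)).
Proof.
pose proof (loop_B_cascade x y zero zero) as h. split.
- intros g. destruct (proj1 h g) as [h1 h2].
  split; [rewrite h1|rewrite h2]; vec.
- intros [h1 h2]. apply h. split; [rewrite h1|rewrite h2]; vec.
Qed.

(** The cascade is triangular: the error [e] is lifted first, then [x] with the additional datum
    [K (C e)], and the second component is [x - e]. *)
Lemma loop_B_right_inverse : exists Be : prod_Hilbert U U -> prod_Hilbert D D,
  is_linear Be /\ forall v, loop_B (Be v) = v.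
Proof.
destruct (feedback_right_inverse K c1 hK hc1 posK) as [l1 [RK [_ [hRK eK]]]].
destruct (feedback_right_inverse M c2 hM hc2 posM) as [l2 [RM [_ [hRM eM]]]].
set (e := fun v : prod_Hilbert U U => RM (minus (fst v) (snd v))).
set (x := fun v : prod_Hilbert U U => RK (plus (fst v) (K (C (e v))))).
assert (he : is_linear e).
{ apply (linear_comp (prod_Hilbert U U) U D (fun v => minus (fst v) (snd v)) RM); [|exact hRM].
  apply (linear_minus_fun (prod_Hilbert U U) U (fun v => fst v) (fun v => snd v));
    [apply linear_fst|apply linear_snd]. }
assert (hx : is_linear x).
{ apply (linear_comp (prod_Hilbert U U) U D (fun v => plus (fst v) (K (C (e v)))) RK);
    [|exact hRK].
  apply (linear_plus_fun (prod_Hilbert U U) U (fun v => fst v) (fun v => K (C (e v))));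
    [apply linear_fst|].
  exact (linear_comp _ _ _ (fun v => C (e v)) K (linear_comp _ _ _ e C he hC) hK). }
exists (fun v => (x v, minus (x v) (e v))). split.
- apply linear_pair; [exact hx|]. now apply linear_minus_fun.
- intros [v w]. apply loop_B_cascade.
  assert (h : minus (x (v, w)) (minus (x (v, w)) (e (v, w))) = e (v, w)) by vec.
  rewrite h. split; [apply eM|apply eK].
Qed.

(** The cross term is at most [m |C e| |C x|]. The two dissipations [c1 |C x|^2] and [k c2 |C e|^2]
    absorb it as soon as [m^2 <= 4 c1 c2 k], and [k] is chosen with equality. *)
Lemma cascade_energy : exists k, 0 < k /\ forall x e : D,
  feedback M e = zero -> feedback K x = K (C e) ->
  dot (A x) (emb x) + k * dot (A e) (emb e) <= 0.
Proof.
destruct (linear_bound _ _ K hK) as [m [hm hb]].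
exists (m ^ 2 / (4 * c1 * c2)). split.
{ apply Rdiv_lt_0_compat; [now apply pow_lt|].
  apply Rmult_lt_0_compat; [lra|exact hc2]. }
intros x e he hx. set (k := m ^ 2 / (4 * c1 * c2)).
assert (hk : 0 < k).
{ apply Rdiv_lt_0_compat; [now apply pow_lt|].
  apply Rmult_lt_0_compat; [lra|exact hc2]. }
pose proof (feedback_energy K c1 posK x) as h1. rewrite hx in h1.
pose proof (feedback_energy M c2 posM e) as h2. rewrite he, dot_zero_l in h2.
pose proof (dot_le _ (K (C e)) (C x)) as h3. pose proof (hb (C e)) as h4.
pose proof (norm_pos _ (C x)) as px. pose proof (norm_pos _ (C e)) as pe.
assert (h5 : norm (K (C e)) * norm (C x) <= m * norm (C e) * norm (C x))
  by (apply Rmult_le_compat_r; assumption).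
assert (h6 : k * dot (A e) (emb e) <= - (k * c2 * norm (C e) ^ 2)).
{ replace (- (k * c2 * norm (C e) ^ 2)) with (k * (- (c2 * norm (C e) ^ 2))) by ring.
  apply Rmult_le_compat_l; lra. }
assert (e1 : k * c2 = m ^ 2 / (4 * c1)) by (unfold k; field; lra).
rewrite e1 in h6.
assert (h7 : m * norm (C e) * norm (C x) <=
  c1 * norm (C x) ^ 2 + m ^ 2 / (4 * c1) * norm (C e) ^ 2).
{ apply Rmult_le_reg_l with (4 * c1); [lra|].
  replace (4 * c1 * (c1 * norm (C x) ^ 2 + m ^ 2 / (4 * c1) * norm (C e) ^ 2))
    with (4 * c1 ^ 2 * norm (C x) ^ 2 + m ^ 2 * norm (C e) ^ 2) by (field; lra).
  pose proof (pow2_ge_0 (2 * c1 * norm (C x) - m * norm (C e))). nra. }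
lra.
Qed.

Lemma closed_loop_generates : exists Te, generates (restr_ker loop_emb loop_A loop_B) Te.
Proof.
destruct cascade_energy as [k [hk henergy]].
(* [S] maps the state to coordinates in which the product norm squared is the energy: [|x1|^2] plus
   [k] times the squared norm of the difference. *)
set (a := sqrt k). assert (ha : 0 < a) by now apply sqrt_lt_R0.
assert (haa : a * a = k) by (apply sqrt_sqrt; lra).
set (S := fun p : prod_Hilbert X X =>
  (scal (RtoC a) (minus (fst p) (snd p)), fst p) : prod_Hilbert X X).
set (S' := fun p : prod_Hilbert X X =>
  (snd p, minus (snd p) (scal (RtoC (/ a)) (fst p))) : prod_Hilbert X X).
assert (hS : is_linear S).
{ apply linear_pair; [|apply linear_fst]. apply linear_scal_fun.
  apply (linear_minus_fun (prod_Hilbert X X) X (fun v => fst v) (fun v => snd v));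
    [apply linear_fst|apply linear_snd]. }
assert (hS' : is_linear S').
{ apply linear_pair; [apply linear_snd|].
  apply (linear_minus_fun (prod_Hilbert X X) X (fun v => snd v)
    (fun v => scal (RtoC (/ a)) (fst v))); [apply linear_snd|].
  apply (linear_scal_fun (prod_Hilbert X X) X (RtoC (/ a)) (fun v => fst v)).
  apply linear_fst. }
assert (eS : forall x, S' (S x) = x).
{ intros [x y]. unfold S, S'. simpl. apply f_equal2; [reflexivity|]. vec. field. lra. }
assert (eS' : forall x, S (S' x) = x).
{ intros [x y]. unfold S, S'. simpl. apply f_equal2; [|reflexivity]. vec. field. lra. }
assert (hgen : exists T', generates
  (fun z w => restr_ker loop_emb loop_A loop_B (S' z) (S' w)) T').
{ pose proof loop_emb_linear as h1. pose proof loop_A_linear as h2. pose proof loop_B_linear as h3.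
  apply lumer_phillips.
  - intros x y x' y' g g'. rewrite !(lin_plus _ _ S' hS'). now apply restr_ker_plus.
  - intros r x y g. rewrite !(lin_scal _ _ S' hS'). now apply restr_ker_scal.
  - intros x y y' g g'.
    pose proof (restr_ker_fun _ _ _ _ _ _ loop_emb_inj _ _ _ g g') as e.
    now rewrite <- (eS' y), <- (eS' y'), e.
  - intros z w [[x y] [g1 [g2 g3]]].
    rewrite <- (eS' z), <- (eS' w), g2, g3. unfold S, loop_emb, loop_A. simpl fst. simpl snd.
    rewrite dot_pair, dot_scal_l, dot_scal_r, <- Rmult_assoc, haa.
    apply loop_B_kernel in g1. destruct g1 as [g1 g4].
    pose proof (henergy _ _ g1 g4) as h.
    rewrite (lin_minus _ _ A hA), (lin_minus _ _ emb hemb) in h. lra.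
  (* The range condition is solved along the cascade: the difference of the data determines [e],
     then [K (C e)] is the boundary datum for [x]. *)
  - destruct (feedback_bvp K c1 hK hc1 posK) as [l1 [hl1 r1]].
    destruct (feedback_bvp M c2 hM hc2 posM) as [l2 [hl2 r2]].
    exists (Rmax l1 l2). split; [eapply Rlt_le_trans; [exact hl1|apply Rmax_l]|].
    intros l hl f. pose proof (Rmax_l l1 l2). pose proof (Rmax_r l1 l2).
    destruct (r2 l ltac:(lra) (minus (fst (S' f)) (snd (S' f))) zero) as [e [e1 e2]].
    destruct (r1 l ltac:(lra) (fst (S' f)) (K (C e))) as [x [x1 x2]].
    set (d := (x, minus x e) : prod_Hilbert D D).
    assert (hd : minus x (minus x e) = e) by vec.
    exists (S (loop_emb d)), (S (loop_A d)). rewrite !eS. split.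
    + exists d. split; [|split; reflexivity]. apply loop_B_kernel. rewrite hd.
      split; assumption.
    + rewrite <- (lin_scal _ _ S hS), <- (lin_minus _ _ S hS), <- (eS' f).
      apply f_equal. unfold d, loop_emb, loop_A. simpl fst. simpl snd.
      rewrite (lin_minus _ _ emb hemb), (lin_minus _ _ A hA).
      rewrite (surjective_pairing (S' f)).
      transitivity (minus (scal (RtoC l) (emb x)) (A x),
        minus (scal (RtoC l) (minus (emb x) (emb e))) (minus (A x) (A e)));
        [reflexivity|].
      apply f_equal2; [exact x1|].
      apply dot_ext. intros z. test_eq z x1. test_eq z e1. dots. lra. }
destruct hgen as [T' hT']. exists (fun t x => S' (T' t (S x))).
exact (generates_similar _ _ S S' _ T' hS hS' eS eS' hT').
Qed.

(** The weight exceeds that of [cascade_energy] because part of the dissipation must be left over to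
    bound the outputs. Young's inequality with half of each stage's dissipation separates inputs
    from outputs. *)
Lemma io_energy : exists k a b, 0 < k /\ 0 < a /\ 0 < b /\ forall (x e : D) (u w : U),
  feedback M e = M w -> feedback K x = plus u (K (C e)) ->
  dot (A x) (emb x) + k * dot (A e) (emb e) <=
  - a * (norm (C x) ^ 2 + norm (C e) ^ 2) + b * (norm u ^ 2 + norm w ^ 2).
Proof.
destruct (linear_bound _ _ K hK) as [m [hm hb]].
destruct (linear_bound _ _ M hM) as [n [hn hb']].
(* The coupling costs [m^2 / c1] times [|C e|^2], which for this [k] equals [k c2 / 4]: half of the
   [k c2 / 2] still available, leaving [k c2 / 4] for [a]. *)
set (k := 4 * m ^ 2 / (c1 * c2)).
assert (hm2 : 0 < m ^ 2) by now apply pow_lt.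
assert (hk : 0 < k) by (apply Rdiv_lt_0_compat; [lra|now apply Rmult_lt_0_compat]).
assert (hkc : 0 < k * c2) by now apply Rmult_lt_0_compat.
assert (hkn : 0 < k * (n ^ 2 / (2 * c2))).
{ apply Rmult_lt_0_compat; [exact hk|]. apply Rdiv_lt_0_compat; [now apply pow_lt|lra]. }
assert (hi : 0 < / c1) by now apply Rinv_0_lt_compat.
exists k, (Rmin (c1 / 2) (k * c2 / 4)), (/ c1 + k * (n ^ 2 / (2 * c2))).
split; [exact hk|]. split; [apply Rmin_pos; lra|]. split; [lra|].
intros x e u w he hx.
pose proof (feedback_energy K c1 posK x) as h1. rewrite hx in h1.
pose proof (feedback_energy M c2 posM e) as h2. rewrite he in h2.
pose proof (dot_le _ (plus u (K (C e))) (C x)) as h3.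
pose proof (dot_le _ (M w) (C e)) as h4.
pose proof (hnorm_plus _ u (K (C e))) as h5. pose proof (hb (C e)) as h6.
pose proof (hb' w) as h7.
pose proof (norm_pos _ (C x)) as px. pose proof (norm_pos _ (C e)) as pe.
pose proof (norm_pos _ u) as pu. pose proof (norm_pos _ w) as pw.
pose proof (Rmin_l (c1 / 2) (k * c2 / 4)) as r1.
pose proof (Rmin_r (c1 / 2) (k * c2 / 4)) as r2.
set (a := Rmin (c1 / 2) (k * c2 / 4)) in *.
set (X1 := norm (C x)) in *. set (E1 := norm (C e)) in *.
set (u1 := norm u) in *. set (w1 := norm w) in *.
assert (h8 : dot (A e) (emb e) <= - (c2 / 2) * E1 ^ 2 + n ^ 2 / (2 * c2) * w1 ^ 2).
{ assert (h9 : norm (M w) * E1 <= n * w1 * E1) by (apply Rmult_le_compat_r; assumption).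
  assert (h10 : n * w1 * E1 <= c2 / 2 * E1 ^ 2 + n ^ 2 / (2 * c2) * w1 ^ 2).
  { apply Rmult_le_reg_l with (2 * c2); [lra|].
    replace (2 * c2 * (c2 / 2 * E1 ^ 2 + n ^ 2 / (2 * c2) * w1 ^ 2)) with
      (c2 ^ 2 * E1 ^ 2 + n ^ 2 * w1 ^ 2) by (field; lra).
    pose proof (pow2_ge_0 (c2 * E1 - n * w1)). nra. }
  lra. }
assert (h9 : dot (A x) (emb x) <=
  - (c1 / 2) * X1 ^ 2 + / c1 * (u1 ^ 2 + m ^ 2 * E1 ^ 2)).
{ assert (h10 : norm (plus u (K (C e))) * X1 <= (u1 + m * E1) * X1)
    by (apply Rmult_le_compat_r; lra).
  assert (h11 : (u1 + m * E1) * X1 <=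
    c1 / 2 * X1 ^ 2 + / c1 * (u1 ^ 2 + m ^ 2 * E1 ^ 2)).
  { apply Rmult_le_reg_l with (2 * c1); [lra|].
    replace (2 * c1 * (c1 / 2 * X1 ^ 2 + / c1 * (u1 ^ 2 + m ^ 2 * E1 ^ 2))) with
      (c1 ^ 2 * X1 ^ 2 + 2 * (u1 ^ 2 + m ^ 2 * E1 ^ 2)) by (field; lra).
    pose proof (pow2_ge_0 (c1 * X1 - (u1 + m * E1))).
    pose proof (pow2_ge_0 (u1 - m * E1)). nra. }
  lra. }
apply Rmult_le_compat_l with (r := k) in h8; [|lra].
assert (e1 : / c1 * (m ^ 2 * E1 ^ 2) = k * c2 / 4 * E1 ^ 2) by (unfold k; field; lra).
assert (h10 : a * X1 ^ 2 <= c1 / 2 * X1 ^ 2)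
  by (apply Rmult_le_compat_r; [apply pow2_ge_0|exact r1]).
assert (h11 : a * E1 ^ 2 <= k * c2 / 4 * E1 ^ 2)
  by (apply Rmult_le_compat_r; [apply pow2_ge_0|exact r2]).
assert (h12 : 0 <= / c1 * w1 ^ 2) by (apply Rmult_le_pos; [lra|apply pow2_ge_0]).
assert (h13 : 0 <= k * (n ^ 2 / (2 * c2)) * u1 ^ 2)
  by (apply Rmult_le_pos; [lra|apply pow2_ge_0]).
lra.
Qed.

Definition loop_C (d : prod_Hilbert D D) : prod_Hilbert (prod_Hilbert U U) U :=
  ((C (fst d), C (snd d)), opp (K (C (snd d)))).
Definition loop_Q (w : prod_Hilbert U U) : prod_Hilbert U U :=
  (fst w, plus (fst w) (opp (M (snd w)))).

(** [N] is independent of [tau] because the energy inequality has no growth term: only the inputs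
    feed the energy. *)
Lemma closed_loop_energy_estimate : exists N, 0 < N /\ forall tau, 0 < tau ->
  forall (z : R -> prod_Hilbert D D) (u : R -> prod_Hilbert U U),
  (forall t, interval tau t ->
    deriv_at (interval tau) (fun s => loop_emb (z s)) t (loop_A (z t))) ->
  (forall t, interval tau t -> loop_B (z t) = loop_Q (u t)) ->
  continuous_on (interval tau) (fun t => loop_C (z t)) -> continuous_on (interval tau) u ->
  norm (loop_emb (z tau)) ^ 2 + RInt (fun t => norm (loop_C (z t)) ^ 2) 0 tau <=
  N * (norm (loop_emb (z 0)) ^ 2 + RInt (fun t => norm (u t) ^ 2) 0 tau).
Proof.
destruct io_energy as [k [a [b [hk [ha [hb henergy]]]]]].
destruct (linear_bound _ _ K hK) as [m [hm hbK]].
(* [n] bounds the full output by [C x] and [C e], and [p] bounds the squared state norm by the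
   energy. With [g = p + / ka], the product [g (V + ka Y)] dominates [p V + Y], that is, final state
   and output together. *)
set (n := 3 + 2 * m ^ 2). assert (hn : 0 < n) by (unfold n; pose proof (pow2_ge_0 m); lra).
set (ka := 2 * a / n). assert (hka : 0 < ka) by (apply Rdiv_lt_0_compat; lra).
set (p := 3 + 2 / k). assert (hp : 0 < 2 / k) by (apply Rdiv_lt_0_compat; lra).
set (g := p + / ka). assert (hg : 0 < / ka) by now apply Rinv_0_lt_compat.
exists (g * (1 + 2 * k + 2 * b)). split.
{ apply Rmult_lt_0_compat; [unfold g, p|]; lra. }
intros tau htau z u hd hBz hCz hu.
set (x := fun t => fst (z t)). set (e := fun t => minus (fst (z t)) (snd (z t))).
assert (hze : forall t, z t = (x t, minus (x t) (e t))).
{ intros t. unfold x, e. rewrite (surjective_pairing (z t)) at 1.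
  apply f_equal2; [reflexivity|]. vec. }
set (V := fun t => norm (emb (x t)) ^ 2 + k * norm (emb (e t)) ^ 2).
assert (hV0 : forall t, 0 <= V t).
{ intros t. unfold V. pose proof (pow2_ge_0 (norm (emb (x t)))).
  pose proof (Rmult_le_pos _ _ (Rlt_le _ _ hk) (pow2_ge_0 (norm (emb (e t))))). lra. }
assert (pu1 : forall (H : Hilbert) (v w : H),
  norm (minus v w) ^ 2 <= 2 * norm v ^ 2 + 2 * norm w ^ 2).
{ intros H v w. pose proof (norm_minus_le _ v w). pose proof (norm_pos _ (minus v w)).
  pose proof (pow2_ge_0 (norm v - norm w)). nra. }
assert (hV1 : forall t, norm (loop_emb (z t)) ^ 2 <= p * V t).
{ intros t. rewrite hze. unfold loop_emb. simpl fst. simpl snd.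
  rewrite normsq_pair, (lin_minus _ _ emb hemb). pose proof (pu1 _ (emb (x t)) (emb (e t))).
  unfold V, p. set (P := norm (emb (x t)) ^ 2) in *. set (Q := norm (emb (e t)) ^ 2) in *.
  assert (0 <= P) by apply pow2_ge_0. assert (0 <= Q) by apply pow2_ge_0.
  replace ((3 + 2 / k) * (P + k * Q)) with (3 * P + 2 * Q + (2 / k * P + 3 * (k * Q)))
    by (field; lra).
  pose proof (Rmult_le_pos _ _ (Rlt_le _ _ hp) H0).
  pose proof (Rmult_le_pos _ _ (Rlt_le _ _ hk) H1). lra. }
assert (hV2 : forall t, V t <= (1 + 2 * k) * norm (loop_emb (z t)) ^ 2).
{ intros t. unfold V, loop_emb. rewrite normsq_pair. unfold e.
  rewrite (lin_minus _ _ emb hemb). fold (x t).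
  pose proof (pu1 _ (emb (x t)) (emb (snd (z t)))) as h.
  apply Rmult_le_compat_l with (r := k) in h; [|lra].
  pose proof (pow2_ge_0 (norm (emb (x t)))). pose proof (pow2_ge_0 (norm (emb (snd (z t))))).
  lra. }
assert (hCE : forall t, norm (loop_C (z t)) ^ 2 <=
  n * (norm (C (x t)) ^ 2 + norm (C (e t)) ^ 2)).
{ intros t. unfold loop_C. rewrite !normsq_pair, hnorm_opp.
  rewrite hze. simpl fst. simpl snd.
  pose proof (hbK (C (minus (x t) (e t)))) as h1.
  assert (h2 : norm (K (C (minus (x t) (e t)))) ^ 2 <=
    m ^ 2 * norm (C (minus (x t) (e t))) ^ 2).
  { rewrite <- Rpow_mult_distr. apply pow_incr. split; [apply norm_pos|exact h1]. }
  rewrite (lin_minus _ _ C hC) in *. pose proof (pu1 _ (C (x t)) (C (e t))) as h3.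
  pose proof (Rmult_le_compat_l _ _ _ (pow2_ge_0 m) h3) as h4.
  pose proof (pow2_ge_0 (norm (C (e t)))). unfold n. lra. }
assert (hCc : forall t,
  continuous (fun s => norm (loop_C (z (Rmax 0 (Rmin tau s)))) ^ 2) t).
{ intros t. apply continuous_normsq.
  apply (clamp_continuous _ tau (fun t => loop_C (z t))); [lra|exact hCz]. }
assert (huc : forall t, continuous (fun s => norm (u (Rmax 0 (Rmin tau s))) ^ 2) t).
{ intros t. apply continuous_normsq. apply (clamp_continuous _ tau u); [lra|exact hu]. }
assert (hmain : V tau + ka * RInt (fun t => norm (loop_C (z t)) ^ 2) 0 tau <=
  V 0 + 2 * b * RInt (fun t => norm (u t) ^ 2) 0 tau).
{ apply (energy_integral tau ka (2 * b) V (fun t => 2 * dot (A (x t)) (emb (x t)) +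
    k * (2 * dot (A (e t)) (emb (e t))))); [lra| | |exact hCc|exact huc].
  - intros t ht. specialize (hd t ht).
    pose proof (deriv_at_linear _ _ _ _ _ t _ (linear_fst X X) hd) as d1.
    pose proof (deriv_at_linear _ _ _ _ _ t _ (linear_snd X X) hd) as d2.
    pose proof (deriv_at_minus _ _ _ _ _ _ _ d1 d2) as d3.
    apply rderiv_at_lincomb.
    + exact (rderiv_at_normsq _ _ _ _ _ d1).
    + pose proof (rderiv_at_normsq X (interval tau) (fun s => emb (e s)) t
        (A (e t))) as d4. apply d4.
      unfold e. rewrite (lin_minus _ _ A hA).
      apply (deriv_at_ext _ _ _ _ _ _ ht) with (2 := d3). intros s _.
      now rewrite (lin_minus _ _ emb hemb).
  - intros t ht. pose proof (hBz t ht) as hBt. rewrite (hze t) in hBt.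
    apply (proj1 (loop_B_cascade _ _ (fst (u t)) (plus (fst (u t)) (opp (M (snd (u t)))))))
      in hBt.
    assert (hxe : minus (x t) (minus (x t) (e t)) = e t) by vec.
    rewrite hxe in hBt. destruct hBt as [h1 h2].
    assert (h3 : feedback M (e t) = M (snd (u t))) by (rewrite h1; vec).
    pose proof (henergy _ _ _ _ h3 h2) as h4.
    pose proof (normsq_pair _ _ (fst (u t)) (snd (u t))) as h5.
    rewrite <- (surjective_pairing (u t)) in h5.
    pose proof (hCE t) as h6. apply Rmult_le_compat_l with (r := ka) in h6; [|lra].
    replace (ka * (n * (norm (C (x t)) ^ 2 + norm (C (e t)) ^ 2))) with
      (2 * a * (norm (C (x t)) ^ 2 + norm (C (e t)) ^ 2)) in h6 by (unfold ka; field; lra).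
    change (norm (u t)) with (@norm _ (prod_Hilbert U U) (u t)).
    rewrite h5. lra. }
assert (hy0 : 0 <= RInt (fun t => norm (loop_C (z t)) ^ 2) 0 tau).
{ apply RInt_clamp_ge_0; [lra|intros; apply pow2_ge_0|exact hCc]. }
assert (hu0 : 0 <= RInt (fun t => norm (u t) ^ 2) 0 tau).
{ apply RInt_clamp_ge_0; [lra|intros; apply pow2_ge_0|exact huc]. }
set (Y := RInt (fun t => norm (loop_C (z t)) ^ 2) 0 tau) in *.
set (W := RInt (fun t => norm (u t) ^ 2) 0 tau) in *.
pose proof (hV1 tau) as h1. pose proof (hV2 0) as h2. pose proof (hV0 tau) as h3.
set (Z0 := norm (loop_emb (z 0)) ^ 2) in *. assert (hZ0 : 0 <= Z0) by apply pow2_ge_0.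
apply Rle_trans with (g * (V tau + ka * Y)).
- replace (g * (V tau + ka * Y)) with (p * V tau + Y + (/ ka * V tau + p * (ka * Y)))
    by (unfold g; field; lra).
  assert (0 <= / ka * V tau) by (apply Rmult_le_pos; lra).
  assert (0 <= p * (ka * Y)).
  { apply Rmult_le_pos; [unfold p; lra|]. apply Rmult_le_pos; lra. }
  lra.
- rewrite Rmult_assoc. apply Rmult_le_compat_l; [unfold g, p; lra|].
  eapply Rle_trans; [exact hmain|].
  assert (0 <= k * W) by (apply Rmult_le_pos; lra).
  assert (0 <= b * Z0) by (apply Rmult_le_pos; lra). lra.
Qed.

(** * Boundedness and polynomial decay of the cascade *)

Section Stability.

Variables (TK TM : R -> X -> X) (Te : R -> prod_Hilbert X X -> prod_Hilbert X X).
Hypothesis genK : generates (restr_ker emb A (feedback K)) TK.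
Hypothesis genM : generates (restr_ker emb A (feedback M)) TM.
Hypothesis genE : generates (restr_ker loop_emb loop_A loop_B) Te.

Lemma cascade_orbit (d0 : prod_Hilbert D D) : loop_B d0 = zero ->
  exists x e : R -> D, forall t, 0 <= t ->
    Te t (loop_emb d0) = (emb (x t), minus (emb (x t)) (emb (e t))) /\
    Te t (loop_A d0) = (A (x t), minus (A (x t)) (A (e t))) /\
    feedback M (e t) = zero /\ feedback K (x t) = K (C (e t)) /\
    deriv_at (fun s => 0 <= s) (fun s => emb (x s)) t (A (x t)) /\
    deriv_at (fun s => 0 <= s) (fun s => emb (e s)) t (A (e t)).
Proof.
intros h0. destruct (restr_ker_orbit _ _ _ _ _ _ _ d0 genE h0) as [d hd].
exists (fun t => fst (d t)), (fun t => minus (fst (d t)) (snd (d t))). intros t ht.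
destruct (hd t ht) as [h1 [h2 [h3 h4]]].
rewrite (lin_minus _ _ emb hemb), (lin_minus _ _ A hA).
split; [rewrite h2; apply f_equal2; [reflexivity|unfold loop_emb; simpl; vec]|].
split; [rewrite h3; apply f_equal2; [reflexivity|unfold loop_A; simpl; vec]|].
rewrite (surjective_pairing (d t)) in h1. apply loop_B_kernel in h1.
split; [apply h1|]. split; [apply h1|].
pose proof (deriv_at_linear _ _ _ _ _ t _ (linear_fst X X) h4) as d1.
pose proof (deriv_at_linear _ _ _ _ _ t _ (linear_snd X X) h4) as d2.
split; [exact d1|].
apply (deriv_at_ext _ _ _ _ _ _ ht) with (2 := deriv_at_minus _ _ _ _ _ _ _ d1 d2).
intros s _. now rewrite (lin_minus _ _ emb hemb).
Qed.

(* [w] is clocked from time [r] of [e]. *)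
Lemma cascade_decrease (k r : R) (w e : R -> D) (s t : R) :
  (forall x e : D, feedback M e = zero -> feedback K x = K (C e) ->
    dot (A x) (emb x) + k * dot (A e) (emb e) <= 0) ->
  0 <= r -> 0 <= s <= t ->
  (forall t, 0 <= t -> feedback M (e t) = zero) ->
  (forall t, 0 <= t -> feedback K (w t) = K (C (e (r + t)))) ->
  (forall t, 0 <= t ->
     deriv_at (fun s => 0 <= s) (fun s => emb (w s)) t (A (w t))) ->
  (forall t, 0 <= t ->
     deriv_at (fun s => 0 <= s) (fun s => emb (e s)) t (A (e t))) ->
  norm (emb (w t)) ^ 2 + k * norm (emb (e (r + t))) ^ 2 <=
  norm (emb (w s)) ^ 2 + k * norm (emb (e (r + s))) ^ 2.
Proof.
intros henergy hr hst h1 h2 h3 h4.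
apply (nonincreasing_closed
  (fun t => norm (emb (w t)) ^ 2 + k * norm (emb (e (r + t))) ^ 2)
  (fun t => 2 * dot (A (w t)) (emb (w t)) + k * (2 * dot (A (e (r + t))) (emb (e (r + t)))))
  s t); [lra| |].
- intros v hv. apply rderiv_at_lincomb.
  + apply (rderiv_at_normsq X _ (fun s => emb (w s))).
    apply (deriv_at_subset X (fun s => 0 <= s)); [intros; lra|]. apply h3. lra.
  + apply (rderiv_at_normsq X _ (fun s => emb (e (r + s)))).
    apply (deriv_at_subset X (fun s => 0 <= r + s)); [intros; lra|].
    apply (deriv_at_shift X (fun s => 0 <= s) (fun s => emb (e s))). apply h4. lra.
- intros v hv. pose proof (henergy (w v) (e (r + v)) (h1 (r + v) ltac:(lra)) (h2 v ltac:(lra))).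
  lra.
Qed.

(** On the domain the weighted energy does not increase, and it is equivalent to the squared norm.
    [N] is the product of the equivalence constants; being at least 1, it can stand for its own
    square root. *)
Lemma closed_loop_bounded : exists N, 1 <= N /\
  forall t, 0 <= t -> forall z, norm (Te t z) <= N * norm z.
Proof.
destruct cascade_energy as [k [hk henergy]].
assert (hi : 0 < 2 / k) by (apply Rdiv_lt_0_compat; lra).
set (N := (3 + 2 / k) * (1 + 2 * k)). assert (hN : 1 <= N) by (unfold N; nra).
exists N. split; [exact hN|]. intros t ht.
assert (pu1 : forall v w : X,
  norm (minus v w) ^ 2 <= 2 * norm v ^ 2 + 2 * norm w ^ 2).
{ intros v w. pose proof (norm_minus_le _ v w). pose proof (norm_pos _ (minus v w)).
  pose proof (pow2_ge_0 (norm v - norm w)). nra. }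
assert (hdom : forall d0, loop_B d0 = zero -> norm (Te t (loop_emb d0)) <= N * norm (loop_emb d0)).
{ intros d0 h0. destruct (cascade_orbit d0 h0) as [x [e h]].
  pose proof (cascade_decrease k 0 x e 0 t henergy (Rle_refl 0) ltac:(lra)
    (fun t ht => proj1 (proj2 (proj2 (h t ht))))) as hV.
  assert (hV' : norm (emb (x t)) ^ 2 + k * norm (emb (e (0 + t))) ^ 2 <=
    norm (emb (x 0)) ^ 2 + k * norm (emb (e (0 + 0))) ^ 2).
  { apply hV; intros v hv; rewrite ?Rplus_0_l; apply h, hv. }
  clear hV. rewrite !Rplus_0_l in hV'.
  destruct (h t ht) as [et _]. destruct (h 0 (Rle_refl 0)) as [e0 _].
  assert (hT0 : Te 0 (loop_emb d0) = loop_emb d0) by apply genE. rewrite hT0 in e0.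
  apply norm_le_of_sq; [apply Rmult_le_pos; [lra|apply norm_pos]|].
  rewrite <- normsq, et, e0, Rpow_mult_distr, !normsq_pair.
  pose proof (pu1 (emb (x t)) (emb (e t))) as h1.
  pose proof (pu1 (emb (x 0)) (minus (emb (x 0)) (emb (e 0)))) as h2.
  assert (es : minus (emb (x 0)) (minus (emb (x 0)) (emb (e 0))) = emb (e 0)) by vec.
  rewrite es in h2.
  set (P := norm (emb (x t)) ^ 2) in *. set (Q := norm (emb (e t)) ^ 2) in *.
  set (P0 := norm (emb (x 0)) ^ 2) in *. set (Q0 := norm (emb (e 0)) ^ 2) in *.
  set (R0 := norm (minus (emb (x 0)) (emb (e 0))) ^ 2) in *.
  assert (0 <= P) by apply pow2_ge_0. assert (0 <= Q) by apply pow2_ge_0.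
  assert (0 <= P0) by apply pow2_ge_0. assert (0 <= R0) by apply pow2_ge_0.
  apply Rle_trans with ((3 + 2 / k) * (P + k * Q)).
  - replace ((3 + 2 / k) * (P + k * Q)) with (3 * P + 2 * Q + (2 / k * P + 3 * (k * Q)))
      by (field; lra).
    assert (0 <= 2 / k * P) by (apply Rmult_le_pos; lra).
    assert (0 <= k * Q) by (apply Rmult_le_pos; lra). lra.
  - apply Rle_trans with ((3 + 2 / k) * ((1 + 2 * k) * (P0 + R0))).
    + apply Rmult_le_compat_l; [lra|]. eapply Rle_trans; [exact hV'|].
      apply Rmult_le_compat_l with (r := k) in h2; [|lra]. lra.
    + rewrite <- Rmult_assoc. fold N. apply Rmult_le_compat_r; [lra|]. nra. }
(* Extension by density: the operator bound [m] at this [t] enters only the approximation error, so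
   the final constant stays uniform in [t]. *)
intros z. apply le_epsilon. intros eps he.
destruct (linear_bound _ _ _ (proj1 (proj1 genE) t ht)) as [m [hm hb]].
destruct (generator_dense _ _ _ genE z (eps / (m + N))) as [s [[y [d0 [h0 [-> _]]]] hs]].
{ apply Rdiv_lt_0_compat; lra. }
pose proof (norm_le_mid _ (Te t (loop_emb d0)) (Te t z)) as h1.
rewrite <- (semigroup_minus _ _ (proj1 genE)) in h1 by exact ht.
pose proof (hb (minus z (loop_emb d0))) as h2. pose proof (hdom d0 h0) as h3.
pose proof (norm_le_mid _ z (loop_emb d0)) as h4. rewrite norm_minus_sym in h4.
set (q := norm (minus z (loop_emb d0))) in *.
assert (h5 : (m + N) * q <= eps).
{ left. apply Rmult_lt_compat_l with (r := m + N) in hs; [|lra].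
  replace ((m + N) * (eps / (m + N))) with eps in hs by (field; lra). exact hs. }
apply Rmult_le_compat_l with (r := N) in h4; [|lra]. lra.
Qed.

(** The error stage is autonomous, and dissipativity makes the distance to the orbit of [TM] from
    the same initial state nonincreasing. This is how the decay of [TM] becomes available for
    [e]. *)
Lemma cascade_second (e : R -> D) :
  (forall t, 0 <= t -> feedback M (e t) = zero) ->
  (forall t, 0 <= t -> deriv_at (fun s => 0 <= s) (fun s => emb (e s)) t (A (e t))) ->
  forall t, 0 <= t -> emb (e t) = TM t (emb (e 0)).
Proof.
intros h1 h2 t ht.
destruct (restr_ker_orbit _ _ _ _ _ _ _ (e 0) genM (h1 0 (Rle_refl 0))) as [d hd].
assert (hle : norm (minus (emb (e t)) (emb (d t))) ^ 2 <=
  norm (minus (emb (e 0)) (emb (d 0))) ^ 2).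
{ apply (nonincreasing_closed (fun t => norm (minus (emb (e t)) (emb (d t))) ^ 2)
    (fun t => 2 * dot (minus (A (e t)) (A (d t))) (minus (emb (e t)) (emb (d t))))
    0 t ht).
  - intros v hv. apply (rderiv_at_normsq X _ (fun t => minus (emb (e t)) (emb (d t)))).
    apply (deriv_at_subset X (fun s => 0 <= s)); [intros; lra|].
    apply deriv_at_minus; [apply h2; lra|apply hd; lra].
  - intros v hv. rewrite <- (lin_minus _ _ A hA), <- (lin_minus _ _ emb hemb).
    pose proof (feedback_energy M c2 posM (minus (e v) (d v))) as h3.
    rewrite (lin_minus _ _ (feedback M) (feedback_linear M hM)), (h1 v) in h3 by lra.
    rewrite (proj1 (hd v (proj1 hv))) in h3.
    pose proof (pow2_ge_0 (norm (C (minus (e v) (d v))))).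
    rewrite dot_minus_l, dot_zero_l in h3. nra. }
destruct (hd 0 (Rle_refl 0)) as [_ [h3 _]]. destruct (hd t ht) as [_ [h4 _]].
assert (hT0 : TM 0 (emb (e 0)) = emb (e 0)) by apply genM.
rewrite hT0 in h3. rewrite h4. apply minus_eq0.
rewrite <- h3 in hle.
assert (e0 : norm (minus (emb (e 0)) (emb (e 0))) = 0)
  by (rewrite <- (hnorm0 X); apply (f_equal norm); vec).
rewrite e0 in hle. pose proof (norm_pos _ (minus (emb (e t)) (emb (d t)))). nra.
Qed.

(* The mean value theorem picks a time at which the output of the first stage
   of the cascade is as small as its state, although the output has no
   pointwise decay rate of its own. *)
Lemma output_small_somewhere (e : R -> D) (s : R) :
  (forall t, 0 <= t -> feedback M (e t) = zero) ->
  (forall t, 0 <= t -> deriv_at (fun s => 0 <= s) (fun s => emb (e s)) t (A (e t))) ->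
  0 <= s -> exists r, s <= r <= s + 1 /\
    2 * c2 * norm (C (e r)) ^ 2 <= norm (emb (e s)) ^ 2.
Proof.
intros h1 h2 hs.
destruct (mvt_closed (fun t => norm (emb (e t)) ^ 2)
  (fun t => 2 * dot (A (e t)) (emb (e t))) s (s + 1)) as [r [hr h]]; [lra| |].
- intros v hv. apply (rderiv_at_normsq X _ (fun t => emb (e t))).
  apply (deriv_at_subset X (fun s => 0 <= s)); [intros; lra|]. apply h2. lra.
- exists r. split; [exact hr|].
  pose proof (feedback_energy M c2 posM (e r)) as h3.
  rewrite (h1 r), dot_zero_l in h3 by lra.
  pose proof (pow2_ge_0 (norm (emb (e (s + 1))))).
  replace (s + 1 - s) with 1 in h by ring. lra.
Qed.

Lemma Rpower_div (t c a : R) : 0 < t -> 0 < c ->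
  Rpower (t / c) (- a) = Rpower c a * Rpower t (- a).
Proof.
intros ht hc. unfold Rpower. rewrite ln_div, <- exp_plus by assumption.
f_equal. ring.
Qed.

Lemma Rpower_neg_le (s t a : R) : 0 <= a -> 0 < s <= t ->
  Rpower t (- a) <= Rpower s (- a).
Proof.
intros ha hst. rewrite !Rpower_Ropp. apply Rinv_le_contravar.
- apply exp_pos.
- now apply Rle_Rpower_l.
Qed.

(** Every bound is linear in the graph norm [n0] of the initial state. Boundedness of [Te], applied
    to both [loop_emb d0] and [loop_A d0], keeps [x] bounded in graph norm up to time [r], so the
    decay of [TK] can be restarted there. *)
Lemma closed_loop_stable (aK aM : R) :
  polynomially_stable (restr_ker emb A (feedback K)) TK aK ->
  polynomially_stable (restr_ker emb A (feedback M)) TM aM ->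
  polynomially_stable (restr_ker loop_emb loop_A loop_B) Te (Rmin aK aM).
Proof.
intros [haK [_ [MK [tK [hMK [htK hK']]]]]] [haM [_ [MM [tM [hMM [htM hM']]]]]].
destruct closed_loop_bounded as [N [hN hbd]].
split; [now apply Rmin_pos|]. split; [exists N; exact hbd|].
destruct cascade_energy as [k [hk henergy]].
destruct (linear_bound _ _ K hK) as [m [hm hbK]].
destruct (feedback_right_inverse K c1 hK hc1 posK) as [l [RK [hl [_ hRK]]]].
(* [Q1] bounds the correction [eta] by [|e(s)|], with [+ 1] making it at most its square. [Q2]
   bounds the remainder [w], and [Q3] the graph norm of [zeta]. [EM] and [EK] are the decay
   constants of [e(t/2)] and of the [TK]-orbit. *)
set (Q1 := m ^ 2 / (8 * c1 * c2 * l) + 1).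
assert (hcc : 0 < c1 * c2) by now apply Rmult_lt_0_compat.
assert (hccl : 0 < 8 * c1 * c2 * l) by (pose proof (Rmult_lt_0_compat _ _ hcc hl); lra).
assert (hQ1 : 0 < m ^ 2 / (8 * c1 * c2 * l))
  by (apply Rdiv_lt_0_compat; [now apply pow_lt|exact hccl]).
set (Q2 := Q1 + k + 1).
set (Q3 := N + (l + 1) * Q1 * (2 * N)).
set (EM := 2 * MM * Rpower 2 aM).
set (EK := MK * Q3 * Rpower 4 aK).
assert (hQ1' : 1 < Q1) by (unfold Q1; lra).
assert (hQ2 : 0 < Q2) by (unfold Q2; lra).
assert (hQ3 : 0 < Q3).
{ unfold Q3. assert (0 < (l + 1) * Q1 * (2 * N)); [|lra].
  repeat apply Rmult_lt_0_compat; lra. }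
assert (hEM : 0 < EM) by (unfold EM; pose proof (exp_pos (aM * ln 2));
  repeat apply Rmult_lt_0_compat; try lra; apply exp_pos).
assert (hEK : 0 < EK) by (unfold EK; repeat apply Rmult_lt_0_compat; try lra; apply exp_pos).
(* The state [(x, x - e)] has norm at most [2 |x| + |e|]. Beyond 4 the time [r <= t/2 + 1] leaves
   [t - r >= t/4]; the other thresholds put [t/2] beyond [tM] and [t/4] beyond [tK]. *)
exists ((2 * Q2 + 1) * EM + 2 * EK), (Rmax 4 (Rmax (2 * tM) (4 * tK))).
split. { assert (0 < (2 * Q2 + 1) * EM) by (apply Rmult_lt_0_compat; lra). lra. }
split. { eapply Rlt_le_trans; [|apply Rmax_l]. lra. }
intros t ht x0 y0 [d0 [h0 [-> ->]]].
pose proof (Rmax_l 4 (Rmax (2 * tM) (4 * tK))).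
pose proof (Rmax_r 4 (Rmax (2 * tM) (4 * tK))).
pose proof (Rmax_l (2 * tM) (4 * tK)). pose proof (Rmax_r (2 * tM) (4 * tK)).
set (n0 := norm (loop_A d0) + norm (loop_emb d0)).
assert (hn0 : 0 <= n0).
{ unfold n0. pose proof (norm_pos _ (loop_A d0)). pose proof (norm_pos _ (loop_emb d0)). lra. }
destruct (cascade_orbit d0 h0) as [x [e hxe]].
assert (heM : forall t, 0 <= t -> feedback M (e t) = zero) by (intros; now apply hxe).
assert (hxK : forall t, 0 <= t -> feedback K (x t) = K (C (e t)))
  by (intros; now apply hxe).
assert (hxd : forall t, 0 <= t ->
  deriv_at (fun s => 0 <= s) (fun s => emb (x s)) t (A (x t))) by (intros; now apply hxe).
assert (hed : forall t, 0 <= t ->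
  deriv_at (fun s => 0 <= s) (fun s => emb (e s)) t (A (e t))) by (intros; now apply hxe).
assert (hx1 : forall t, 0 <= t -> norm (emb (x t)) <= N * norm (loop_emb d0)).
{ intros v hv. eapply Rle_trans; [|apply (hbd v hv)].
  rewrite (proj1 (hxe v hv)). apply (norm_fst_le _ _ (emb (x v), _)). }
assert (hx2 : forall t, 0 <= t -> norm (A (x t)) <= N * norm (loop_A d0)).
{ intros v hv. eapply Rle_trans; [|apply (hbd v hv)].
  rewrite (proj1 (proj2 (hxe v hv))). apply (norm_fst_le _ _ (A (x v), _)). }
assert (htri : forall (Y : Hilbert) (u v : Y), norm v <= norm u + norm (minus u v)).
{ intros Y u v. pose proof (norm_le_mid _ u v) as h. rewrite norm_minus_sym in h. lra. }
assert (he1 : forall t, 0 <= t -> norm (emb (e t)) <= 2 * N * norm (loop_emb d0)).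
{ intros v hv. pose proof (hbd v hv (loop_emb d0)) as h.
  assert (h1 : norm (minus (emb (x v)) (emb (e v))) <= norm (Te v (loop_emb d0))).
  { rewrite (proj1 (hxe v hv)). apply (norm_snd_le X X (_, _)). }
  assert (h2 : norm (emb (e v)) <=
    norm (emb (x v)) + norm (minus (emb (x v)) (emb (e v)))).
  { eapply Rle_trans; [|apply norm_minus_le]. right. apply (f_equal norm). vec. }
  pose proof (hx1 v hv). lra. }
assert (he0 : norm (emb (e 0)) <= 2 * norm (loop_emb d0)).
{ assert (hT0 : Te 0 (loop_emb d0) = loop_emb d0) by apply genE.
  pose proof (proj1 (hxe 0 (Rle_refl 0))) as e1. rewrite hT0 in e1.
  assert (h1 : norm (emb (x 0)) <= norm (loop_emb d0))
    by (rewrite e1; apply (norm_fst_le X X (_, _))).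
  assert (h2 : norm (minus (emb (x 0)) (emb (e 0))) <= norm (loop_emb d0))
    by (rewrite e1; apply (norm_snd_le X X (_, _))).
  assert (h3 : norm (emb (e 0)) <=
    norm (emb (x 0)) + norm (minus (emb (x 0)) (emb (e 0)))).
  { eapply Rle_trans; [|apply norm_minus_le]. right. apply (f_equal norm). vec. }
  lra. }
assert (hA0 : norm (A (e 0)) <= 2 * norm (loop_A d0)).
{ assert (hT0 : Te 0 (loop_A d0) = loop_A d0) by apply genE.
  pose proof (proj1 (proj2 (hxe 0 (Rle_refl 0)))) as e1. rewrite hT0 in e1.
  assert (h1 : norm (A (x 0)) <= norm (loop_A d0))
    by (rewrite e1; apply (norm_fst_le X X (_, _))).
  assert (h2 : norm (minus (A (x 0)) (A (e 0))) <= norm (loop_A d0))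
    by (rewrite e1; apply (norm_snd_le X X (_, _))).
  assert (h3 : norm (A (e 0)) <= norm (A (x 0)) + norm (minus (A (x 0)) (A (e 0)))).
  { eapply Rle_trans; [|apply norm_minus_le]. right. apply (f_equal norm). vec. }
  lra. }
set (s := t / 2). assert (hs : tM <= s) by (unfold s; lra).
set (es := norm (emb (e s))).
set (p := Rpower t (- Rmin aK aM)). assert (hp : 0 < p) by apply exp_pos.
assert (hes : es <= EM * p * n0).
{ unfold es. rewrite (cascade_second e heM hed s) by (unfold s; lra).
  eapply Rle_trans.
  { apply (hM' s hs (emb (e 0)) (A (e 0))). exists (e 0).
    split; [apply heM; lra|split; reflexivity]. }
  unfold s at 1. rewrite Rpower_div by lra.
  assert (hpM : Rpower t (- aM) <= p).
  { apply Rle_Rpower; [lra|]. pose proof (Rmin_r aK aM). lra. }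
  replace (EM * p * n0) with (MM * (Rpower 2 aM * p) * (2 * n0)) by (unfold EM; ring).
  pose proof (exp_pos (aM * ln 2)). pose proof (exp_pos (- aM * ln t)).
  apply Rmult_le_compat.
  - apply Rmult_le_pos; [lra|]. apply Rmult_le_pos; left; apply exp_pos.
  - pose proof (norm_pos _ (A (e 0))). pose proof (norm_pos _ (emb (e 0))). lra.
  - apply Rmult_le_compat_l; [lra|]. apply Rmult_le_compat_l; [left; apply exp_pos|].
    exact hpM.
  - unfold n0. lra. }
assert (hedec : forall u v, 0 <= u <= v -> norm (emb (e v)) <= norm (emb (e u))).
{ intros u v huv.
  assert (h : norm (emb (e v)) ^ 2 <= norm (emb (e u)) ^ 2).
  { apply (nonincreasing_closed (fun t => norm (emb (e t)) ^ 2)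
      (fun t => 2 * dot (A (e t)) (emb (e t))) u v); [lra| |].
    - intros q hq. apply (rderiv_at_normsq X _ (fun t => emb (e t))).
      apply (deriv_at_subset X (fun s => 0 <= s)); [intros; lra|]. apply hed. lra.
    - intros q hq. pose proof (feedback_energy M c2 posM (e q)) as h3.
      rewrite (heM q), dot_zero_l in h3 by lra.
      pose proof (pow2_ge_0 (norm (C (e q)))). nra. }
  pose proof (norm_pos _ (emb (e v))). pose proof (norm_pos _ (emb (e u))). nra. }
destruct (output_small_somewhere e s heM hed) as [r [hr hCr]]; [unfold s; lra|].
fold es in hCr. assert (hr0 : 0 <= r) by (unfold s in hr; lra).
assert (htr : t / 4 <= t - r) by (unfold s in hr; lra).
assert (hes0 : 0 <= es) by apply norm_pos.
(* [eta] carries the boundary datum of [x r]. The quadratic bounds combine to [l |eta|^2 <= m^2 |C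
   e(r)|^2 / (4 c1) <= m^2 |e(s)|^2 / (8 c1 c2)]. *)
destruct (hRK (K (C (e r)))) as [hRK1 hRK2]. set (eta := RK (K (C (e r)))) in *.
assert (heta : norm (emb eta) <= Q1 * es).
{ pose proof (feedback_solution_bound K c1 hc1 posK l eta _ hl hRK2 hRK1) as h.
  assert (h1 : norm (K (C (e r))) ^ 2 <= m ^ 2 * norm (C (e r)) ^ 2).
  { rewrite <- Rpow_mult_distr. apply pow_incr. split; [apply norm_pos|apply hbK]. }
  assert (h2 : norm (emb eta) ^ 2 <= Q1 * es ^ 2).
  { apply Rle_trans with (m ^ 2 / (8 * c1 * c2 * l) * es ^ 2).
    - apply Rmult_le_reg_l with l; [exact hl|]. eapply Rle_trans; [exact h|].
      apply Rle_trans with (m ^ 2 / (8 * c1 * c2) * (2 * c2 * norm (C (e r)) ^ 2)).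
      + replace (m ^ 2 / (8 * c1 * c2) * (2 * c2 * norm (C (e r)) ^ 2)) with
          (m ^ 2 * norm (C (e r)) ^ 2 / (4 * c1)) by (field; lra).
        apply Rmult_le_compat_r; [|exact h1]. left. apply Rinv_0_lt_compat. lra.
      + replace (l * (m ^ 2 / (8 * c1 * c2 * l) * es ^ 2)) with
          (m ^ 2 / (8 * c1 * c2) * es ^ 2) by (field; lra).
        apply Rmult_le_compat_l; [|exact hCr].
        apply Rmult_le_pos; [apply pow2_ge_0|]. left. apply Rinv_0_lt_compat. lra.
    - apply Rmult_le_compat_r; [apply pow2_ge_0|]. unfold Q1. lra. }
  apply norm_le_of_sq; [apply Rmult_le_pos; lra|]. rewrite <- normsq.
  eapply Rle_trans; [exact h2|]. rewrite Rpow_mult_distr.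
  apply Rmult_le_compat_r; [apply pow2_ge_0|]. nra. }
set (zeta := minus (x r) eta).
assert (hzeta : feedback K zeta = zero).
{ unfold zeta. rewrite (lin_minus _ _ (feedback K) (feedback_linear K hK)).
  rewrite hRK1, hxK by exact hr0. vec. }
destruct (restr_ker_orbit _ _ _ _ _ _ _ zeta genK hzeta) as [z hz].
(* [z] satisfies the homogeneous boundary condition, so [w] is driven by the same [e] as [x]; it
   starts at [eta], and its energy together with that of [e] cannot grow. *)
set (w := fun v => minus (x (r + v)) (z v)).
assert (hwdec := cascade_decrease k r w e 0 (t - r) henergy hr0 ltac:(unfold s in hr; lra)
  heM).
assert (hw : norm (emb (w (t - r))) ^ 2 + k * norm (emb (e (r + (t - r)))) ^ 2 <=
  norm (emb (w 0)) ^ 2 + k * norm (emb (e (r + 0))) ^ 2).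
{ apply hwdec; [| |exact hed].
  - intros v hv. unfold w.
    rewrite (lin_minus _ _ (feedback K) (feedback_linear K hK)).
    rewrite (proj1 (hz v hv)), hxK by lra. vec.
  - intros v hv. unfold w. rewrite (lin_minus _ _ A hA).
    apply (deriv_at_ext X _ (fun s => minus (emb (x (r + s))) (emb (z s)))); [exact hv| |].
    + intros q _. now rewrite (lin_minus _ _ emb hemb).
    + apply deriv_at_minus; [|apply hz, hv].
      apply (deriv_at_subset X (fun s => 0 <= r + s)); [intros; lra|].
      apply (deriv_at_shift X (fun s => 0 <= s) (fun s => emb (x s))). apply hxd. lra. }
clear hwdec.
assert (hw0 : emb (w 0) = emb eta).
{ unfold w. rewrite (lin_minus _ _ emb hemb), <- (proj1 (proj2 (hz 0 (Rle_refl 0)))).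
  assert (hT0 : TK 0 (emb zeta) = emb zeta) by apply genK.
  rewrite hT0, Rplus_0_r. unfold zeta. rewrite (lin_minus _ _ emb hemb). vec. }
rewrite hw0, Rplus_0_r in hw.
assert (her : norm (emb (e r)) <= es) by (apply hedec; unfold s in *; lra).
assert (hwt : norm (emb (w (t - r))) <= Q2 * es).
{ apply norm_le_of_sq; [apply Rmult_le_pos; lra|]. rewrite <- normsq.
  assert (h1 : norm (emb eta) ^ 2 <= (Q1 * es) ^ 2)
    by (apply pow_incr; split; [apply norm_pos|exact heta]).
  assert (h2 : k * norm (emb (e r)) ^ 2 <= k * es ^ 2).
  { apply Rmult_le_compat_l; [lra|]. apply pow_incr. split; [apply norm_pos|exact her]. }
  assert (h3 : 0 <= k * norm (emb (e (r + (t - r)))) ^ 2)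
    by (apply Rmult_le_pos; [lra|apply pow2_ge_0]).
  apply Rle_trans with ((Q1 ^ 2 + k) * es ^ 2); [lra|].
  rewrite Rpow_mult_distr. apply Rmult_le_compat_r; [apply pow2_ge_0|].
  unfold Q2. nra. }
assert (hzt : norm (emb (z (t - r))) <= EK * p * n0).
{ destruct (hz (t - r)) as [_ [h1 _]]; [lra|]. rewrite <- h1.
  eapply Rle_trans.
  { apply (hK' (t - r) ltac:(lra) (emb zeta) (A zeta)). exists zeta.
    split; [exact hzeta|split; reflexivity]. }
  assert (h2 : norm (A zeta) + norm (emb zeta) <= Q3 * n0).
  { unfold zeta. rewrite (lin_minus _ _ A hA), (lin_minus _ _ emb hemb).
    pose proof (norm_minus_le _ (A (x r)) (A eta)) as k1.
    pose proof (norm_minus_le _ (emb (x r)) (emb eta)) as k2.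
    (* Here the choice of the lift pays off: [A eta] is [l] times the state of [eta]. *)
    rewrite <- hRK2 in k1 at 2. rewrite norm_scalR, Rabs_pos_eq in k1 by lra.
    pose proof (hx1 r hr0) as k3. pose proof (hx2 r hr0) as k4.
    pose proof (he1 s ltac:(unfold s; lra)) as k5. fold es in k5.
    assert (k6 : norm (emb eta) <= Q1 * (2 * N * n0)).
    { eapply Rle_trans; [exact heta|]. apply Rmult_le_compat_l; [lra|].
      eapply Rle_trans; [exact k5|]. apply Rmult_le_compat_l; [lra|].
      unfold n0. pose proof (norm_pos _ (loop_A d0)). lra. }
    apply Rmult_le_compat_l with (r := l + 1) in k6; [|lra].
    assert (k7 : N * norm (loop_A d0) + N * norm (loop_emb d0) = N * n0) by (unfold n0; ring).
    unfold Q3. lra. }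
  assert (h3 : Rpower (t - r) (- aK) <= Rpower 4 aK * p).
  { eapply Rle_trans; [apply (Rpower_neg_le (t / 4)); lra|].
    rewrite Rpower_div by lra. apply Rmult_le_compat_l; [left; apply exp_pos|].
    apply Rle_Rpower; [lra|]. pose proof (Rmin_l aK aM). lra. }
  replace (EK * p * n0) with (MK * (Rpower 4 aK * p) * (Q3 * n0)) by (unfold EK; ring).
  apply Rmult_le_compat; [| |apply Rmult_le_compat_l; [lra|exact h3]|exact h2].
  - apply Rmult_le_pos; [lra|]. left. apply exp_pos.
  - pose proof (norm_pos _ (A zeta)). pose proof (norm_pos _ (emb zeta)). lra. }
assert (hxt : norm (emb (x t)) <= Q2 * es + EK * p * n0).
{ pose proof (norm_le_mid _ (emb (z (t - r))) (emb (x t))) as h1.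
  assert (h2 : minus (emb (x t)) (emb (z (t - r))) = emb (w (t - r))).
  { unfold w. rewrite (lin_minus _ _ emb hemb). now replace (r + (t - r)) with t by ring. }
  rewrite h2 in h1. lra. }
assert (het : norm (emb (e t)) <= es) by (apply hedec; unfold s; lra).
rewrite (proj1 (hxe t ltac:(lra))).
eapply Rle_trans; [apply norm_pair_le|]. simpl fst. simpl snd.
pose proof (norm_minus_le _ (emb (x t)) (emb (e t))) as h1.
apply Rmult_le_compat_l with (r := 2 * Q2 + 1) in hes; [|lra].
fold p. fold n0. lra.
Qed.

End Stability.

End ClosedLoop.

End PassiveNode.

(** * The closed-loop node *)

Lemma dot_Re_op (H : Hilbert) (T ReT : H -> H) (u : H) :
  is_Re_op T ReT -> dot (ReT u) u = dot (T u) u.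
Proof.
intros [S [[_ hS] hR]]. rewrite hR. dots.
rewrite (dot_sym _ (S u) u). replace (dot u (S u)) with (dot (T u) u).
- field.
- unfold dot. now rewrite hS.
Qed.

Lemma op_ge_dot (H : Hilbert) (T : H -> H) (c : R) (u : H) :
  op_ge T c -> c * norm u ^ 2 <= dot (T u) u.
Proof.
intros h. destruct (h u) as [_ h1].
change (0 <= dot (minus (T u) (scal (RtoC c) u)) u) in h1. dots_in h1.
rewrite normsq. lra.
Qed.

Section ClosedLoopNode.

Variables (U X D : Hilbert) (N : node U U X U D) (K L : U -> U).
Hypothesis Q_id : forall u, nodeQ N u = u.
Hypothesis Bi_0 : forall u, nodeBi N u = zero.

Let KK (x : D) : U := opp (K (nodeC N x)).
Let Li (u : U) : X := zero.
Let M (u : U) : U := opp (L u).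
Let Ne := closed_loop N KK L Li.

(** Proved as equalities of operators, by functional extensionality, so that generation and
    stability can be rewritten along this lemma and the following ones. *)
Lemma op_AK_feedback :
  op_AK N KK = restr_ker (emb N) (nodeA N) (feedback U D (nodeB N) (nodeC N) K).
Proof.
unfold op_AK, feedback. f_equal; apply functional_extensionality; intros d.
- rewrite Bi_0. vec.
- rewrite Q_id. unfold KK. vec.
Qed.

Lemma op_AL_feedback :
  op_AL N L Li = restr_ker (emb N) (nodeA N) (feedback U D (nodeB N) (nodeC N) M).
Proof.
unfold op_AL, feedback. f_equal; apply functional_extensionality;
  intros d; unfold Li, M; vec.
Qed.

Lemma emb_closed_loop : emb Ne = loop_emb X D (emb N).
Proof. reflexivity. Qed.

Lemma nodeA_closed_loop : nodeA Ne = loop_A X D (nodeA N).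
Proof.
apply functional_extensionality. intros [d1 d2]. unfold loop_A. simpl.
rewrite Bi_0. unfold Li. apply f_equal2; vec.
Qed.

Lemma nodeB_closed_loop : nodeB Ne = loop_B U D (nodeB N) (nodeC N) K M.
Proof.
apply functional_extensionality. intros [d1 d2]. unfold loop_B. simpl.
rewrite Q_id. unfold KK, M. apply f_equal2; vec.
Qed.

Lemma nodeC_closed_loop : nodeC Ne = loop_C U D (nodeC N) K.
Proof. reflexivity. Qed.

Lemma nodeQ_closed_loop : nodeQ Ne = loop_Q U M.
Proof.
apply functional_extensionality. intros [u w]. unfold loop_Q, M. simpl.
rewrite Q_id. apply f_equal2; [reflexivity|vec].
Qed.

Lemma nodeBi_closed_loop (w : prod_Hilbert U U) : nodeBi Ne w = zero.
Proof.
destruct w as [u w]. simpl. rewrite Bi_0. unfold Li.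
change (@eq (prod_Hilbert X X) (zero, plus zero zero) (zero, zero)).
apply f_equal2; [reflexivity|vec].
Qed.

End ClosedLoopNode.

Theorem proposition3p2 :
  forall (U X D : Hilbert) (N : node U U X U D) (K L ReK ReL : U -> U)
    (c1 c2 : R),
  boundary_node N ->
  well_posed N ->
  (forall u : U, nodeQ N u = u) ->
  (forall u : U, nodeBi N u = zero) ->
  (forall x : D, Re (inner (nodeA N x) (emb N x))
                 <= Re (inner (nodeB N x) (nodeC N x))) ->
  is_linear K -> is_linear L ->
  is_Re_op K ReK -> is_Re_op L ReL ->
  0 < c1 -> 0 < c2 ->
  op_ge ReK c1 -> op_ge (fun u => opp (ReL u)) c2 ->
  let KK : D -> U := fun x => opp (K (nodeC N x)) in
  let Li : U -> X := fun _ => zero in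
  let Ne := closed_loop N KK L Li in
  boundary_node Ne /\
  well_posed Ne /\
  (exists TK : R -> X -> X, generates (op_AK N KK) TK) /\
  (exists TL : R -> X -> X, generates (op_AL N L Li) TL) /\
  forall (TK TL : R -> X -> X)
    (Te : R -> prod_Hilbert X X -> prod_Hilbert X X) (alphaK alphaL : R),
  generates (op_AK N KK) TK ->
  generates (op_AL N L Li) TL ->
  generates (op_A Ne) Te ->
  polynomially_stable (op_AK N KK) TK alphaK ->
  polynomially_stable (op_AL N L Li) TL alphaL ->
  polynomially_stable (op_A Ne) Te (Rmin alphaK alphaL).
Proof.
intros U X D N K L ReK ReL c1 c2
  [hemb [inj [hB [hA [hC [hQ [hBi [[T gen] [Br [_ hBr]]]]]]]]]]
  _ Q_id Bi_0 passive hK hL hReK hReL hc1 hc2 hgeK hgeL KK Li Ne.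
set (M := fun u => opp (L u)).
assert (hM : is_linear M) by now apply linear_opp_fun.
assert (posK : forall u, c1 * norm u ^ 2 <= dot (K u) u).
{ intros u. rewrite <- (dot_Re_op _ _ _ u hReK). now apply op_ge_dot. }
assert (posM : forall u, c2 * norm u ^ 2 <= dot (M u) u).
{ intros u. unfold M. rewrite dot_opp_l, <- (dot_Re_op _ _ _ u hReL), <- dot_opp_l.
  now apply (op_ge_dot _ (fun u => opp (ReL u))). }
assert (eAK := op_AK_feedback U X D N K Q_id Bi_0 : op_AK N KK = _).
assert (eAL := op_AL_feedback U X D N L : op_AL N L Li = _).
assert (eA := nodeA_closed_loop U X D N K L Bi_0 : nodeA Ne = _).
assert (eB := nodeB_closed_loop U X D N K L Q_id : nodeB Ne = _).
assert (eC := nodeC_closed_loop U X D N K L : nodeC Ne = _).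
assert (eQ := nodeQ_closed_loop U X D N K L Q_id : nodeQ Ne = _).
assert (eBi := nodeBi_closed_loop U X D N K L Bi_0
  : forall w, nodeBi Ne w = zero).
assert (eE := emb_closed_loop U X D N K L : emb Ne = _).
fold M in eAL, eB, eQ.
assert (eAe : op_A Ne = restr_ker (loop_emb X D (emb N)) (loop_A X D (nodeA N))
  (loop_B U D (nodeB N) (nodeC N) K M)) by (unfold op_A; now rewrite eA, eB, eE).
split; [|split; [|split; [|split]]].
- unfold boundary_node. rewrite eAe, eE, eA, eB, eC, eQ.
  split; [now apply loop_emb_linear|]. split; [now apply loop_emb_inj|].
  split; [now apply loop_B_linear|]. split; [now apply loop_A_linear|].
  split.
  { apply linear_pair; [apply linear_pair|].
    - now apply linear_comp_fst.
    - now apply linear_comp_snd.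
    - apply linear_opp_fun, (linear_comp_snd D D U (fun d => K (nodeC N d))).
      now apply (linear_comp D U U). }
  split.
  { apply linear_pair; [apply linear_fst|]. apply linear_plus_fun; [apply linear_fst|].
    apply linear_opp_fun. now apply linear_comp_snd. }
  split.
  { apply is_linear_ext with (fun _ => zero); [intros w; symmetry; apply eBi|].
    apply is_linear_zero. }
  split.
  + exact (closed_loop_generates U X D (emb N) (nodeA N) (nodeB N) (nodeC N) Br T
      hemb hA hB hC inj hBr gen passive K M c1 c2 hK hM hc1 hc2 posK posM).
  + exact (loop_B_right_inverse U X D (emb N) (nodeA N) (nodeB N) (nodeC N) Br T
      hemb hA hB hC inj hBr gen passive K M c1 c2 hK hM hc1 hc2 posK posM).
- destruct (closed_loop_energy_estimate U X D (emb N) (nodeA N) (nodeB N) (nodeC N)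
    hemb hA hB hC passive K M c1 c2 hK hM hc1 hc2 posK posM) as [n [hn hest]].
  (* The estimate holds with one constant for all times, so the time 1 is an arbitrary choice. *)
  exists 1, n. split; [exact Rlt_0_1|]. split; [exact hn|].
  intros x0 u [u' [u'' [hu [_ _]]]] _ z y [[x' [hx' [_ hx'e]]] [hz0 [hzB [hy hyc]]]].
  assert (hyC : forall t, interval 1 t -> y t = loop_C U D (nodeC N) K (z t))
    by (intros t ht; rewrite hy by exact ht; now rewrite eC).
  rewrite <- hz0, eE. rewrite (RInt_ext _ (fun t => norm (loop_C U D (nodeC N) K (z t)) ^ 2)).
  + apply (hest 1 Rlt_0_1).
    * intros t ht. pose proof (deriv_at_intro _ _ _ _ _ (hx' t ht)) as h.
      rewrite hx'e, eBi, eA in h by exact ht.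
      replace (loop_A X D (nodeA N) (z t)) with
        (plus (loop_A X D (nodeA N) (z t)) (@zero (prod_Hilbert X X))); [exact h|].
      apply plus_zero_r.
    * intros t ht. rewrite <- eB, <- eQ. now apply hzB.
    * intros t ht. rewrite <- hyC by exact ht.
      eapply filterlim_within_ext; [|exact (hyc t ht)]. intros s hs. now apply hyC.
    * intros t ht. eapply deriv_at_continuous; [exact ht|].
      exact (deriv_at_intro _ _ _ _ _ (hu t ht)).
  + rewrite Rmin_left, Rmax_right by lra. intros t ht. rewrite hyC; [reflexivity|].
    unfold interval. lra.
- rewrite eAK. exact (feedback_generates U X D (emb N) (nodeA N) (nodeB N) (nodeC N) Br T
    hemb hA hB hC inj hBr gen passive K c1 hK hc1 posK).
- rewrite eAL. exact (feedback_generates U X D (emb N) (nodeA N) (nodeB N) (nodeC N) Br T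
    hemb hA hB hC inj hBr gen passive M c2 hM hc2 posM).
- intros TK TL Te aK aL. rewrite eAK, eAL, eAe. intros gK gL gE sK sL.
  exact (closed_loop_stable U X D (emb N) (nodeA N) (nodeB N) (nodeC N) Br T
    hemb hA hB hC inj hBr gen passive K M c1 c2 hK hM hc1 hc2 posK posM
    TK TL Te gK gL gE aK aL sK sL).
Qed.
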